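(* Let $s>0$ and $q=s+1$, and assume that $\mathbf E[Z^q]<+\infty$. Let $g:\mathbb R_+\to\mathbb R_+$ be concave and bounded, and assume that there are constants $\kappa_1,\kappa_2>0$ such that for all $x>0$ $$\frac{x}{(1+\kappa_1x^s)^{1/s}}\le g(x)\le\frac{x}{(1+\kappa_2x^s)^{1/s}}.$$ Let $(R_n)$ be a sequence of positive numbers and, for each $n$, define $(B_n(u))_{u\in T_n}$ by $B_n(u)=+\infty$ for $u\in\partial T_n$ and $B_n(u)=R_n\sum_{v\leftarrow u}g(B_n(v))$ for $u\in T_n\setminus\partial T_n$; set $B_n:=B_n(\rho)$. If $\limsup_{n\to\infty}mR_n\le1$ and $\inf_nR_n>0$, then, as $n\to\infty$, $$\frac{B_n}{\mathbf E[B_n]}\longrightarrow W\qquad\text{in }L^q,$$ where $W:=\lim_{n\to\infty}m^{-n}Z_n$ is the almost sure (and $L^q$) limit of the martingale associated with the branching process. If $R_n\equiv R$ with $R\in(0,m^{-1}]$, then the convergence also holds almost surely.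
   Context: $\mu$ is a probability distribution on $\{0,1,2,\dots\}$ with $\mu(0)=0$, $\mu(1)<1$; $Z\sim\mu$ and $m:=\mathbf E[Z]<\infty$ (so $m>1$). $T$ is the Galton--Watson tree with offspring law $\mu$ and root $\rho$; $T_n$ is the subtree of vertices at distance at most $n$ from the root, $\partial T_n$ is the set of vertices at distance exactly $n$, and $Z_n=|\partial T_n|$. The notation $v\leftarrow u$ means that $v$ is a child of $u$. $\mathbf P,\mathbf E$ refer to the randomness of the tree; all $T_n$ are subtrees of the same tree $T$. The convention $g(+\infty):=\lim_{x\to\infty}g(x)$ is used. The number $R_n$ is deterministic, fixed along $T_n$, but may depend on $n$. *)

(* Defs.v *)
From HB Require Import structures.
From mathcomp Require Import all_boot all_order all_algebra.
From mathcomp Require Import all_classical all_reals all_analysis.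

Set Implicit Arguments.
Unset Strict Implicit.
Unset Printing Implicit Defensive.

Import Order.TTheory GRing.Theory Num.Theory.
Import numFieldNormedType.Exports.

Local Open Scope classical_set_scope.
Local Open Scope ring_scope.

(** Trees are in Ulam-Harris form: a vertex is a word over [nat], the root is
    the empty word, and [nu u] is the number of children of [u], namely the
    words [rcons u i] with [i < nu u]. The values of [nu] outside the tree play
    no role. *)
Section Tree.
Implicit Types (nu : seq nat -> nat) (n : nat) (u v : seq nat).

Definition children nu u : seq (seq nat) :=
  [seq rcons u i | i <- iota 0 (nu u)].

Definition generation nu n : seq (seq nat) :=
  iter n (fun s => flatten [seq children nu u | u <- s]) [:: [::]].

Definition in_tree nu u : bool :=
  all (fun i => nth 0 u i < nu (take i u))%N (iota 0 (size u)).

Definition generation_size nu n : nat := size (generation nu n).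

Lemma in_tree_rcons nu u i :
  in_tree nu (rcons u i) = in_tree nu u && (i < nu u)%N.
Proof.
rewrite /in_tree size_rcons -addn1 iotaD all_cat add0n /= andbT.
rewrite nth_rcons ltnn eqxx -cats1 take_size_cat //; congr andb.
apply: eq_in_all => j; rewrite mem_iota add0n => /andP[_ ju].
by rewrite nth_cat ju takel_cat // ltnW.
Qed.

Lemma mem_generation nu n u :
  (u \in generation nu n) = in_tree nu u && (size u == n).
Proof.
elim: n u => [|n IH] u; first by rewrite inE size_eq0 andb_idl // => /eqP ->.
rewrite /generation iterS -/(generation nu n).
apply/flatten_mapP/andP => [[v]|].
  rewrite IH => /andP[tv /eqP <-] /mapP[i]; rewrite mem_iota => /andP[_ iv] ->.
  by rewrite in_tree_rcons tv iv size_rcons.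
case/lastP: u => [|v i]; first by case.
rewrite in_tree_rcons size_rcons eqSS => -[/andP[tv iv] sv].
by exists v; rewrite ?IH ?tv // map_f // mem_iota.
Qed.

Lemma generation_uniq nu n : uniq (generation nu n).
Proof.
elim: n => [//|n IH]; rewrite /generation iterS -/(generation nu n).
apply: allpairs_uniq_dep => // [u _|]; first exact: iota_uniq.
by move=> [u i] [v j] _ _ /= /rcons_inj[-> ->].
Qed.

End Tree.

Section Recursion.
Variable R : realType.
Implicit Types (g : R -> R) (nu : seq nat -> nat) (r : R) (u : seq nat).

(** [g] is only relevant on [[0, +oo]]. *)
Definition extend_pinfty g (x : \bar R) : R :=
  match x with
  | x%:E => g x
  | +oo%E => lim (g y @[y --> +oo])
  | -oo%E => 0
  end.

(** [B_height g nu r h u] is the value at [u] when the boundary is [h]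
    generations below [u]. *)
Fixpoint B_height g nu r (h : nat) u : \bar R :=
  if h is h'.+1 then
    (r * \sum_(v <- children nu u) extend_pinfty g (B_height g nu r h' v))%:E
  else +oo%E.

Definition B_at g nu r (n : nat) u : \bar R := B_height g nu r (n - size u) u.

Definition B_root g nu r (n : nat) : \bar R := B_at g nu r n [::].

Lemma B_at_boundary g nu r n u : u \in generation nu n ->
  B_at g nu r n u = +oo%E.
Proof. by rewrite mem_generation /B_at => /andP[_ /eqP ->]; rewrite subnn. Qed.

Lemma B_at_interior g nu r n u : in_tree nu u -> (size u < n)%N ->
  B_at g nu r n u =
  (r * \sum_(v <- children nu u) extend_pinfty g (B_at g nu r n v))%:E.
Proof.
move=> _ un; rewrite /B_at -[(n - size u)%N]prednK ?subn_gt0 //=.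
congr (_ * _)%:E; apply: eq_big_seq => v /mapP[i _ ->].
by rewrite size_rcons subnS.
Qed.

End Recursion.

Section Probability.
Variables (R : realType) (d : measure_display) (Omega : measurableType d).
Variable P : probability Omega R.

Definition mutually_independent (I : eqType) (X : I -> {RV P >-> nat}) : Prop :=
  forall (J : seq I) (A : I -> set nat), uniq J ->
    P (\bigcap_(i in [set` J]) (X i @^-1` A i)) =
    (\prod_(i <- J) P (X i @^-1` A i))%E.

Definition galton_watson (mu : probability nat R)
    (N : seq nat -> {RV P >-> nat}) : Prop :=
  (forall u A, distribution P (N u) A = mu A) /\ mutually_independent N.

(** Finitely many of the [X n] may fail to be in [L^q]. *)
Definition cvg_in_Lq (q : R) (X : nat -> Omega -> R) (Y : Omega -> R) : Prop :=
  [/\ \forall n \near \oo, X n \in Lfun P q%:E,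
      Y \in Lfun P q%:E &
      ('N[P]_(q%:E)[EFin \o (X n \- Y)%R])%E @[n --> \oo] --> 0%E].

Definition cvg_as (X : nat -> Omega -> R) (Y : Omega -> R) : Prop :=
  {ae P, forall w, X n w @[n --> \oo] --> Y w}.

(** At [n = 0] the value [B_root] is [+oo] and the quotient is a dummy value;
    for [n >= 1] it is finite. *)
Definition B_normalized (g : R -> R) (N : seq nat -> Omega -> nat)
    (r : nat -> R) (n : nat) (w : Omega) : R :=
  fine (B_root g (N ^~ w) (r n) n) /
  fine (\int[P]_w' B_root g (N ^~ w') (r n) n)%E.

Definition W_martingale (m : R) (N : seq nat -> Omega -> nat)
    (n : nat) (w : Omega) : R :=
  (generation_size (N ^~ w) n)%:R / m ^+ n.

(** Equals [0] where the sequence diverges. *)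
Definition W_limit (m : R) (N : seq nat -> Omega -> nat) (w : Omega) : R :=
  lim (W_martingale m N n w @[n --> \oo]).

End Probability.

Section Moments.
Variables (R : realType) (mu : probability nat R).

Definition moment (q : R) : \bar R := (\int[mu]_k ((k%:R `^ q)%R)%:E)%E.

Definition emean : \bar R := (\int[mu]_k (k%:R)%:E)%E.

Definition mean : R := fine emean.

End Moments.

Definition concave_on_nonneg (R : realType) (g : R -> R) : Prop :=
  convex_function (`[0, +oo[%classic : set R^o) (fun x : R^o => - g x).

(* Main.v *)
Require Import Defs.
From HB Require Import structures.
From mathcomp Require Import all_boot all_order all_algebra.
From mathcomp Require Import all_classical all_reals all_analysis.
From mathcomp Require Import measurable_realfun.
From mathcomp Require Import ring lra.

(** The subtrees at the children of the root are independent copies of the tree, so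
    that the value [X_n] at the root of the tree truncated at height [n + 1] obeys a
    distributional recursion: [X_(n+1)] is [r] times the sum over the children of
    independent copies of [g X_n]. All this takes place on the space of offspring
    fields with its product law, and is carried over to the given probability space
    at the end.

    With [a_n] and [b_n] the means of [X_n] and [g X_n], let [Y_n = X_n / a_n] and
    [G_n = g X_n / b_n]. Then [Y_(n+1)] is [1 / m] times the sum over the children of
    copies of [G_n], just as the martingale [W_(n+1)] is [1 / m] times the sum of
    copies of [W_n]. As [g x] is close to [x] for small [x], the difference
    [Y_n - G_n] is small when [a_n] is. Unrolling the recursion expresses
    [Y_n - W_(n+1)] through averages over the generations of these centred
    differences ([normalized_decomposition]). The [p]-th moment of a sum of
    independent centred variables, for [1 < p <= 2], grows linearly with their number
    ([von_Bahr_Esseen]); hence averaging over [i] generations gains a factor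
    [decay ^+ i], and the mean of [`|Y_n - W_(n+1)|] is at most a constant times the
    sum over [k < n] of [decay ^+ (n - k) * a_k `^ theta] ([normalized_approx]).

    The constant depends neither on [n] nor on [r] because the [q]-th moments of the
    [Y_n] are bounded by that of [W]. This is a matter of convex order: concavity
    makes [g X / E (g X)] less spread out than [X / E X] ([concave_convex_order]),
    so that by induction [Y_n] is dominated by [W_(n+1)] ([convex_dominated]), whose
    [q]-th moment is at most that of the limit [W] ([Ex_Wn_powR_le]).

    If [m * r_n] has upper limit at most 1, concavity and [g x < x] force the means
    to 0 ([mean_value_small]), whence convergence in mean; since the [q]-th moments
    of the [Y_n] do not exceed that of [W], convergence in mean is convergence in
    [L^q] ([L1_cvg_Lq]). The same applies to the martingale itself, whose increments
    are averages over generations of the centred number of children.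

    If [r] is constant, the means decay at most geometrically, so that the error is
    bounded by a power of [a_n] ([normalized_approx_powR]) and is summable along
    heights at which the means decay geometrically. Between such heights the
    monotonicity of [X_n] in [n] takes over ([level_sandwich]). *)

Set Implicit Arguments.
Unset Strict Implicit.
Unset Printing Implicit Defensive.

Import Order.TTheory GRing.Theory Num.Theory.
Import numFieldNormedType.Exports.

Local Open Scope classical_set_scope.
Local Open Scope ring_scope.

(** * Inequalities for real powers *)

Section PowerInequalities.
Variable R : realType.
Implicit Types (x y c p q : R).

Lemma le_of_eq x y : x = y -> x <= y.
Proof. by move=> ->. Qed.

Lemma le_powR x y p : 0 <= p -> 0 <= x -> x <= y -> x `^ p <= y `^ p.
Proof.
by move=> p0 x0 xy; rewrite ge0_ler_powR ?nnegrE//; exact: le_trans xy.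
Qed.

(** Young's inequality. *)
Lemma powR_tangent q x c : 1 < q -> 0 <= x -> 0 <= c ->
  c `^ q + q * c `^ (q - 1) * (x - c) <= x `^ q.
Proof.
move=> q1 x0 c0; have q0 : 0 < q by lra.
have qB : 0 < q / (q - 1) by rewrite divr_gt0//; lra.
have := @conjugate_powR R x (c `^ (q - 1)) q (q / (q - 1)) x0 (powR_ge0 _ _) q0 qB.
rewrite -powRrM mulrCA divff ?mulr1; last by rewrite subr_eq0 gt_eqF.
have -> : q^-1 + (q / (q - 1))^-1 = 1.
  by field; rewrite ?subr_eq0 !gt_eqF.
move=> /(_ erefl) H.
have E : c * c `^ (q - 1) = c `^ q by rewrite mulr_powRB1.
have -> : c `^ q + q * c `^ (q - 1) * (x - c) =
   q * (x * c `^ (q - 1)) - (q - 1) * (c * c `^ (q - 1)) by rewrite -E; ring.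
rewrite E lerBlDr.
have := ler_wpM2l (ltW q0) H; move=> /le_trans; apply.
rewrite le_eqVlt; apply/orP; left; apply/eqP; field; rewrite ?subr_eq0 !gt_eqF//.
Qed.

Lemma powR_superadditive q x y : 1 <= q -> 0 <= x -> 0 <= y ->
  x `^ q + y `^ q <= (x + y) `^ q.
Proof.
move=> q1 x0 y0; have q0 : 0 < q by lra.
rewrite -!(mulr_powRB1 _ q0) ?addr_ge0// mulrDl.
by apply: lerD; apply: ler_wpM2l => //; apply: le_powR; rewrite ?subr_ge0//; lra.
Qed.

Lemma powR_subadditive p x y : 0 < p <= 1 -> 0 <= x -> 0 <= y ->
  (x + y) `^ p <= x `^ p + y `^ p.
Proof.
move=> /andP[p0 p1] x0 y0.
have ip : 1 <= p^-1 by rewrite invf_ge1.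
have K z : 0 <= z -> (z `^ p) `^ p^-1 = z.
  by move=> z0; rewrite -powRrM divff ?gt_eqF// powRr1.
have := powR_superadditive ip (powR_ge0 x p) (powR_ge0 y p).
rewrite !K// => /(le_powR (ltW p0) (addr_ge0 x0 y0)).
by rewrite -[X in _ <= X -> _]powRrM mulVf ?gt_eqF// powRr1// addr_ge0 ?powR_ge0.
Qed.

(** The factor of [x `^ p] can be brought as close to 1 as desired, at the
    expense of the other one. *)
Lemma powR_addl_le d p x y : 0 < d -> 0 <= p -> 0 <= x -> 0 <= y ->
  (x + y) `^ p <= (1 + d) `^ p * x `^ p + (1 + d^-1) `^ p * y `^ p.
Proof.
move=> d0 p0 x0 y0; have id0 : 0 < d^-1 by rewrite invr_gt0.
rewrite -!powRM//; [|lra|lra].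
have [ydx|dxy] := leP y (d * x).
  apply: ler_wpDr; first exact: powR_ge0.
  by apply: le_powR => //; [lra|nra].
apply: ler_wpDl; first exact: powR_ge0.
apply: le_powR => //; first lra.
have : x <= d^-1 * y by rewrite ler_pdivlMl// ltW.
by move=> ?; rewrite mulrDl mul1r addrC lerD2l.
Qed.

(** The derivative of [x |-> `|x| `^ p / p]. *)
Definition spow p x := Num.sg x * `|x| `^ (p - 1).

Lemma spow_tangent p x y : 1 < p ->
  `|x| `^ p + p * spow p x * (y - x) <= `|y| `^ p.
Proof.
move=> p1; apply: le_trans (powR_tangent p1 (normr_ge0 y) (normr_ge0 x)).
rewrite lerD2l -mulrA -mulrA ler_wpM2l//; first lra.
rewrite /spow mulrAC mulrC ler_wpM2l ?powR_ge0// mulrBr -normrEsg lerB//.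
rewrite (le_trans (ler_norm _))// normrM normr_sg.
by case: (x != 0); rewrite ?mul1r ?mul0r.
Qed.

(** Powers of exponent [p - 1 <= 1] are subadditive. *)
Lemma spow_holder p x y : 1 < p <= 2 ->
  `|spow p x - spow p y| <= 2 * `|x - y| `^ (p - 1).
Proof.
move=> /andP[p1 p2]; have pp : 0 < p - 1 <= 1 by lra.
have pp0 : 0 <= p - 1 by lra.
have spN z : spow p (- z) = - spow p z by rewrite /spow sgrN normrN mulNr.
have sp0 z : 0 <= z -> spow p z = z `^ (p - 1).
  rewrite le_eqVlt => /orP[/eqP<-|z0]; last by rewrite /spow gtr0_sg// mul1r gtr0_norm.
  by rewrite /spow sgr0 mul0r powR0// gt_eqF; lra.
suff H u v : 0 <= u -> `|v| <= u ->
    `|spow p u - spow p v| <= 2 * `|u - v| `^ (p - 1).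
  wlog xy : x y / `|y| <= `|x|.
    move=> W; have [/W//|/ltW yx] := leP `|y| `|x|.
    by rewrite distrC (distrC x); exact: W.
  have [x0|/ltW x0] := leP 0 x; first by apply: H => //; rewrite -(ger0_norm x0).
  have := @H (- x) (- y); rewrite !spN normrN oppr_ge0 => /(_ x0).
  have xy' : `|y| <= - x by rewrite -(ler0_norm x0).
  move=> /(_ xy').
  have -> : - spow p x - - spow p y = - (spow p x - spow p y) by ring.
  have -> : - x - - y = - (x - y) by ring.
  by rewrite !normrN.
move=> u0 vu; have [v0|v0] := leP 0 v.
  have {}vu : v <= u by rewrite -(ger0_norm v0).
  have uv0 : 0 <= u - v by rewrite subr_ge0.
  rewrite !sp0// !ger0_norm ?subr_ge0 ?le_powR//.
  have := powR_subadditive pp uv0 v0; rewrite subrK => h.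
  by have := powR_ge0 (u - v) (p - 1); lra.
have vn0 : 0 <= - v by lra.
rewrite -[v]opprK spN !opprK !sp0// !ger0_norm ?addr_ge0 ?powR_ge0//.
have := @le_powR u (u + - v) (p - 1) pp0 u0.
have := @le_powR (- v) (u + - v) (p - 1) pp0 vn0.
by move=> /(_ ltac:(lra)) h1 /(_ ltac:(lra)) h2; lra.
Qed.

(** The tangent inequality at [x + y], with the slope moved back to [x] by
    [spow_holder]. *)
Lemma normr_powR_expand p x y : 1 < p <= 2 ->
  `|x + y| `^ p <= `|x| `^ p + p * spow p x * y + 2 * p * `|y| `^ p.
Proof.
move=> p12; have p1 : 1 < p by case/andP: p12.
have := @spow_tangent p (x + y) x p1.
have := @spow_holder p (x + y) x p12.
have -> : x + y - x = y by ring.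
have -> : x - (x + y) = - y by ring.
rewrite mulrN => h1 h2.
have h3 : (spow p (x + y) - spow p x) * y <= 2 * `|y| `^ p.
  apply: le_trans (ler_norm _) _; rewrite normrM.
  apply: le_trans (ler_wpM2r (normr_ge0 _) h1) _.
  by rewrite -mulrA [_ `^ _ * _]mulrC mulr_powRB1//; lra.
have p0 : 0 <= p by lra.
have := ler_wpM2l p0 h3; nra.
Qed.

(** Sum the tangents at the average of the [f i]. *)
Lemma powR_sum_le p (I : Type) (L : seq I) (f : I -> R) : 1 <= p ->
  (forall i, 0 <= f i) -> (0 < size L)%N ->
  (\sum_(i <- L) f i) `^ p <= (size L)%:R `^ (p - 1) * \sum_(i <- L) f i `^ p.
Proof.
move=> p1 f0 L0; set k := (size L)%:R : R.
have k0 : 0 < k by rewrite ltr0n.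
move: p1; rewrite le_eqVlt => /orP[/eqP<-|p1].
  rewrite subrr powRr0 mul1r powRr1 ?sumr_ge0//.
  by under [leRHS]eq_bigr do rewrite powRr1//.
have S0 : 0 <= \sum_(i <- L) f i by rewrite sumr_ge0.
set c := (\sum_(i <- L) f i) / k.
have c0 : 0 <= c by rewrite divr_ge0// ltW.
have E : \sum_(i <- L) f i = k * c by rewrite mulrC divfK ?gt_eqF.
have : \sum_(i <- L) (c `^ p + p * c `^ (p - 1) * (f i - c)) <=
       \sum_(i <- L) f i `^ p.
  by apply: ler_sum => i _; exact: powR_tangent.
rewrite big_split/= -mulr_sumr sumrB E !big_const_seq !count_predT.
rewrite !iter_addr_0 -[X in _ + _ * (_ - X)]mulr_natl subrr mulr0 addr0 -mulr_natl.
move=> h; rewrite powRM// ?(ltW k0)// -(mulr_powRB1 (ltW k0)); last lra.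
by rewrite (mulrC k) -mulrA ler_wpM2l ?powR_ge0.
Qed.

End PowerInequalities.

(** * Offspring fields and local functionals *)

Definition cylinder (J : seq (seq nat)) (A : seq nat -> set nat) :
  set (seq nat -> nat) := [set nu | forall u, u \in J -> A u (nu u)].

Definition cylinders (S : set (seq nat)) : set (set (seq nat -> nat)) :=
  [set E | exists J A, [/\ uniq J, {in J, forall u, S u} & E = cylinder J A]].

(** An offspring field assigns a number of children to every word; the cylinders
    generate the product sigma-algebra. *)
Notation field := (g_sigma_algebraType (cylinders setT)).

Lemma setI_closed_cylinders S : setI_closed (cylinders S).
Proof.
move=> E F [J [A [uJ JS ->]]] [K [B [uK KS ->]]].
exists (undup (J ++ K)), (fun u => (if u \in J then A u else setT) `&`
                              (if u \in K then B u else setT)); split.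
- exact: undup_uniq.
- by move=> u; rewrite mem_undup mem_cat => /orP[/JS|/KS].
- apply/seteqP; split => nu /=.
    by move=> [h1 h2] u _; split; case: ifPn => // ?; [exact: h1|exact: h2].
  move=> h; split => u uJK; have := h u; rewrite mem_undup mem_cat uJK ?orbT;
    by move=> /(_ isT)[].
Qed.

(** [F] is determined by finitely many coordinates in [S], which ones may depend
    on the field. In contrast with measurability this is visibly stable under
    all operations, random sums included. *)
Definition local (S : set (seq nat)) (V : Type) (F : (seq nat -> nat) -> V) :=
  forall nu, exists J : seq (seq nat), {in J, forall u, S u} /\
    forall nu', {in J, nu' =1 nu} -> F nu' = F nu.

Section Local.
Implicit Types (S : set (seq nat)) (nu : seq nat -> nat).

Lemma local_cst S V (c : V) : local S (fun=> c).
Proof. by move=> nu; exists [::]. Qed.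

Lemma local_coord S u : S u -> local S (fun nu => nu u).
Proof.
move=> Su nu; exists [:: u]; split; first by move=> v; rewrite inE => /eqP ->.
by move=> nu' /(_ u); rewrite mem_head => /(_ isT).
Qed.

Lemma local_bind S V W (F : (seq nat -> nat) -> V)
    (G : V -> (seq nat -> nat) -> W) :
  local S F -> (forall nu, local S (G (F nu))) ->
  local S (fun nu => G (F nu) nu).
Proof.
move=> lF lG nu; have [J [JS hJ]] := lF nu; have [K [KS hK]] := lG nu nu.
exists (J ++ K); split; first by move=> u; rewrite mem_cat => /orP[/JS|/KS].
move=> nu' h; have -> : F nu' = F nu.
  by apply: hJ => u uJ; apply: h; rewrite mem_cat uJ.
by apply: hK => u uK; apply: h; rewrite mem_cat uK orbT.
Qed.

Lemma local_comp S V W (f : V -> W) (F : (seq nat -> nat) -> V) :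
  local S F -> local S (fun nu => f (F nu)).
Proof.
move=> lF; apply: (@local_bind S V W F (fun v _ => f v) lF) => nu.
exact: local_cst.
Qed.

Lemma local_comp2 S V V' W (f : V -> V' -> W) (F : (seq nat -> nat) -> V) G :
  local S F -> local S G -> local S (fun nu => f (F nu) (G nu)).
Proof.
move=> lF lG; apply: (@local_bind S V W F (fun v nu => f v (G nu)) lF) => nu.
exact: local_comp.
Qed.

Lemma local_sub S S' V (F : (seq nat -> nat) -> V) :
  S `<=` S' -> local S F -> local S' F.
Proof. by move=> SS' lF nu; have [J [JS hJ]] := lF nu; exists J; split=> // u /JS/SS'. Qed.

Lemma local_setT S V (F : (seq nat -> nat) -> V) : local S F -> local setT F.
Proof. by apply: local_sub. Qed.

Lemma local_big S V (op : V -> V -> V) (x0 : V) (I : eqType) (L : seq I)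
    (F : I -> (seq nat -> nat) -> V) :
  {in L, forall i, local S (F i)} ->
  local S (fun nu => \big[op/x0]_(i <- L) F i nu).
Proof.
elim: L => [|i L IH] lF.
  by under eq_fun do rewrite big_nil; exact: local_cst.
under eq_fun do rewrite big_cons; apply: local_comp2.
  by apply: lF; rewrite mem_head.
by apply: IH => j jL; apply: lF; rewrite inE jL orbT.
Qed.

Definition subtree u nu : seq nat -> nat := fun v => nu (u ++ v).

Lemma subtree_nil : subtree [::] = id.
Proof. by []. Qed.

Lemma subtree_cat u v nu : subtree v (subtree u nu) = subtree (u ++ v) nu.
Proof. by apply/funext => w; rewrite /subtree catA. Qed.

(** The vertices of the subtree at [u]. *)
Definition below u : set (seq nat) := [set v | prefix u v].

Lemma local_subtree V (F : (seq nat -> nat) -> V) u :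
  local setT F -> local (below u) (fun nu => F (subtree u nu)).
Proof.
move=> lF nu; have [J [_ hJ]] := lF (subtree u nu).
exists [seq u ++ v | v <- J]; split.
  by move=> _ /mapP[v _ ->]; exact: prefix_prefix.
move=> nu' h; apply: hJ => v vJ; rewrite /subtree; apply: h.
exact: map_f.
Qed.

End Local.

(** There are only countably many cylinders with prescribed coordinates, and the
    preimage is the union of those that it contains. *)
Lemma local_preimage S V (F : (seq nat -> nat) -> V) (A : set V) :
  local S F -> <<s cylinders S >> (F @^-1` A).
Proof.
move=> lF.
pose C (c : seq (seq nat * nat)) := cylinder (unzip1 c) (fun u => [set k | (u, k) \in c]).
pose ok (c : seq (seq nat * nat)) := [/\ uniq (unzip1 c), {in unzip1 c, forall u, S u} &
  C c `<=` F @^-1` A].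
pose D n := if @unpickle (seq (seq nat * nat)) n is Some c then
  if `[< ok c >] then C c else set0 else set0.
have -> : F @^-1` A = \bigcup_n D n.
  apply/seteqP; split => [nu Fnu|nu [n _]]; last first.
    by rewrite /D; case: unpickle => // c; case: asboolP => // -[_ _]; exact.
  have [J [JS hJ]] := lF nu.
  pose c := [seq (u, nu u) | u <- undup J].
  have cE : unzip1 c = undup J by rewrite /unzip1 -map_comp map_id.
  exists (pickle c) => //; rewrite /D pickleK asboolT.
    by move=> u; rewrite cE => uJ /=; apply/mapP; exists u.
  split; rewrite ?cE ?undup_uniq//; first by move=> u; rewrite mem_undup => /JS.
  move=> nu'; rewrite /C cE /= => h; rewrite (hJ nu')// => u uJ.
  by have := h u; rewrite mem_undup => /(_ uJ)/mapP[v _ [-> ->]].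
apply: sigma_algebra_bigcup => n; rewrite /D.
have h0 : <<s cylinders S >> set0 by exact: sigma_algebra0.
case: unpickle => // c; case: asboolP => // -[uc cS _].
by apply: sub_sigma_algebra; exists (unzip1 c), (fun u => [set k | (u, k) \in c]).
Qed.

Lemma cylinders_measurable S E : <<s cylinders S >> E ->
  (measurable : set (set field)) E.
Proof.
apply: smallest_sub; first exact: smallest_sigma_algebra.
move=> F [J [A [uJ _ ->]]]; apply: sub_sigma_algebra; exists J, A; split=> //.
Qed.

Lemma measurable_local d (T : measurableType d) (F : field -> T) :
  local setT F -> measurable_fun setT F.
Proof.
move=> lF _ A _; rewrite setTI; apply: (@cylinders_measurable setT).
exact: local_preimage.
Qed.

(** * Expectation, moments and independence *)

Section Expectation.
Context (R : realType) d (T : measurableType d) (P : probability T R).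
Implicit Types (f g : T -> R) (c : R).

Definition L1 f := P.-integrable setT (EFin \o f).
Definition Ex f : R := \int[P]_x f x.

Lemma eq_L1 f g : f =1 g -> L1 g -> L1 f.
Proof. by move=> /funext ->. Qed.

Lemma eq_Ex f g : f =1 g -> Ex f = Ex g.
Proof. by move=> /funext ->. Qed.

Lemma L1_measurable f : L1 f -> measurable_fun setT f.
Proof. by move=> /measurable_int/measurable_EFinP. Qed.

Lemma measurable_fun_norm f : measurable_fun setT f ->
  measurable_fun setT (fun x => `|f x|).
Proof. by move=> mf; apply: measurableT_comp. Qed.

Lemma measurable_fun_powR p f : measurable_fun setT f ->
  measurable_fun setT (fun x => f x `^ p).
Proof. by move=> mf; exact: (measurableT_comp (measurable_powR p) mf). Qed.

Lemma measurable_set_ler f g : measurable_fun setT f -> measurable_fun setT g ->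
  measurable [set x | f x <= g x].
Proof.
move=> mf mg; have -> : [set x | f x <= g x] = setT `&` (fun x => f x <= g x) @^-1` [set true].
  by rewrite setTI; apply/seteqP; split.
exact: measurable_fun_ler.
Qed.

Lemma measurable_set_ltr f g : measurable_fun setT f -> measurable_fun setT g ->
  measurable [set x | f x < g x].
Proof.
move=> mf mg; have -> : [set x | f x < g x] = setT `&` (fun x => f x < g x) @^-1` [set true].
  by rewrite setTI; apply/seteqP; split.
exact: measurable_fun_ltr.
Qed.

Lemma L1_cst c : L1 (fun=> c).
Proof. exact: finite_measure_integrable_cst. Qed.

Lemma Ex_cst c : Ex (fun=> c) = c.
Proof. by rewrite /Ex Rintegral_cst//= probability_setT mulr1. Qed.

Lemma L1D f g : L1 f -> L1 g -> L1 (fun x => f x + g x).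
Proof. by move=> lf lg; exact: (integrableD measurableT lf lg). Qed.

Lemma ExD f g : L1 f -> L1 g -> Ex (fun x => f x + g x) = Ex f + Ex g.
Proof. by move=> lf lg; rewrite /Ex RintegralD. Qed.

Lemma L1Z c f : L1 f -> L1 (fun x => c * f x).
Proof. by move=> lf; exact: (integrableZl measurableT c lf). Qed.

Lemma ExZ c f : L1 f -> Ex (fun x => c * f x) = c * Ex f.
Proof. by move=> lf; rewrite /Ex RintegralZl. Qed.

Lemma L1B f g : L1 f -> L1 g -> L1 (fun x => f x - g x).
Proof. by move=> lf lg; exact: (integrableB measurableT lf lg). Qed.

Lemma ExB f g : L1 f -> L1 g -> Ex (fun x => f x - g x) = Ex f - Ex g.
Proof. by move=> lf lg; rewrite /Ex RintegralB. Qed.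

Lemma L1_sum (I : eqType) (L : seq I) (F : I -> T -> R) :
  {in L, forall i, L1 (F i)} -> L1 (fun x => \sum_(i <- L) F i x).
Proof.
elim: L => [|i L IH] lF.
  by under eq_fun do rewrite big_nil; exact: L1_cst.
under eq_fun do rewrite big_cons; apply: L1D.
  by apply: lF; rewrite mem_head.
by apply: IH => j jL; apply: lF; rewrite inE jL orbT.
Qed.

Lemma Ex_sum (I : eqType) (L : seq I) (F : I -> T -> R) :
  {in L, forall i, L1 (F i)} ->
  Ex (fun x => \sum_(i <- L) F i x) = \sum_(i <- L) Ex (F i).
Proof.
elim: L => [|i L IH] lF.
  by under eq_fun do rewrite big_nil; rewrite Ex_cst big_nil.
have lL : {in L, forall j, L1 (F j)}.
  by move=> j jL; apply: lF; rewrite inE jL orbT.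
under eq_fun do rewrite big_cons; rewrite big_cons ExD ?IH//; last exact: L1_sum.
by apply: lF; rewrite mem_head.
Qed.

Lemma L1_le f g : measurable_fun setT f -> L1 g -> (forall x, `|f x| <= g x) ->
  L1 f.
Proof.
move=> mf lg fg; apply: (le_integrable measurableT _ _ lg).
  exact/measurable_EFinP.
by move=> x _; rewrite lee_fin (le_trans (fg x))// ler_norm.
Qed.

Lemma Ex_le f g : L1 f -> L1 g -> (forall x, f x <= g x) -> Ex f <= Ex g.
Proof. by move=> lf lg fg; apply: le_Rintegral. Qed.

Lemma Ex_ge0 f : (forall x, 0 <= f x) -> 0 <= Ex f.
Proof. by move=> f0; exact: Rintegral_ge0. Qed.

Lemma L1_norm f : L1 f -> L1 (fun x => `|f x|).
Proof. by move=> lf; exact: (integrable_norm lf). Qed.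

Lemma EFin_Ex f : L1 f -> ((Ex f)%:E = \int[P]_x (f x)%:E)%E.
Proof. by move=> lf; rewrite /Ex /Rintegral fineK// integrable_fin_num. Qed.

Lemma L1_ge0P f : measurable_fun setT f -> (forall x, 0 <= f x) ->
  L1 f <-> (\int[P]_x (f x)%:E < +oo)%E.
Proof.
move=> mf f0; split.
  by move=> lf; rewrite -EFin_Ex// ltry.
move=> fin; apply/integrableP; split; first exact/measurable_EFinP.
by under eq_integral do rewrite /= ger0_norm//.
Qed.

Lemma Ex_le_norm f : L1 f -> `|Ex f| <= Ex (fun x => `|f x|).
Proof. by move=> lf; exact: le_normr_Rintegral. Qed.

(** Where [`|f|] exceeds [e] it is at most [e / e `^ p * `|f| `^ p]. Up to the
    factor 2 this is Lyapunov's inequality. *)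
Lemma L1_of_Lp p e f : 1 <= p -> 0 < e -> measurable_fun setT f ->
  L1 (fun x => `|f x| `^ p) -> Ex (fun x => `|f x| `^ p) <= e `^ p ->
  L1 f /\ Ex (fun x => `|f x|) <= 2 * e.
Proof.
move=> p1 e0 mf lfp fpe.
have H x : `|f x| <= e + e / e `^ p * `|f x| `^ p.
  have ep0 : 0 < e `^ p by exact: powR_gt0.
  have [fe|ef] := leP `|f x| e.
    by rewrite ler_wpDr// mulr_ge0 ?powR_ge0// divr_ge0 ?ltW.
  rewrite ler_wpDl ?(ltW e0)// mulrAC ler_pdivlMr//.
  have fx0 : 0 < `|f x| by exact: lt_trans ef.
  have p0 : 0 < p by exact: lt_le_trans p1.
  rewrite -(mulr_powRB1 (ltW e0) p0) -(mulr_powRB1 (ltW fx0) p0) mulrCA.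
  rewrite ler_wpM2l ?(ltW e0)// ler_wpM2l ?(ltW fx0)//.
  by apply: le_powR; rewrite ?subr_ge0 ?(ltW e0) ?(ltW ef).
have lg : L1 (fun x => e + e / e `^ p * `|f x| `^ p).
  by apply: L1D; [exact: L1_cst|exact: L1Z].
split; first exact: L1_le lg H.
have lf := L1_norm (L1_le mf lg H).
apply: le_trans (Ex_le lf lg H) _.
rewrite ExD ?Ex_cst; [|exact: L1_cst|exact: L1Z].
rewrite ExZ// mulr_natl mulr2n lerD2l mulrAC ler_pdivrMr ?powR_gt0//.
by rewrite ler_wpM2l ?(ltW e0).
Qed.

(** Integrate the tangent at the mean. *)
Lemma Ex_jensen_powR q f : 1 < q -> (forall x, 0 <= f x) -> L1 f ->
  L1 (fun x => f x `^ q) -> Ex f `^ q <= Ex (fun x => f x `^ q).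
Proof.
move=> q1 f0 lf lfq; set c := Ex f.
have c0 : 0 <= c by exact: Ex_ge0.
have l1 : L1 (fun x => f x - c) by apply: L1B => //; exact: L1_cst.
have l2 : L1 (fun x => c `^ q + q * c `^ (q - 1) * (f x - c)).
  by apply: L1D; [exact: L1_cst|exact: L1Z].
have := Ex_le l2 lfq (fun x => powR_tangent q1 (f0 x) c0).
rewrite ExD; [|exact: L1_cst|exact: L1Z].
rewrite ExZ// ExB//; last exact: L1_cst.
by rewrite !Ex_cst subrr mulr0 addr0.
Qed.

Lemma L1_powR_le r q f : 0 <= r <= q -> measurable_fun setT f ->
  (forall x, 0 <= f x) ->
  L1 (fun x => f x `^ q) ->
  L1 (fun x => f x `^ r) /\ Ex (fun x => f x `^ r) <= 1 + Ex (fun x => f x `^ q).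
Proof.
move=> /andP[r0 rq] mf f0 lfq.
have H x : f x `^ r <= 1 + f x `^ q.
  have [fx1|fx1] := leP (f x) 1.
    rewrite ler_wpDr ?powR_ge0// -[leRHS](powRr1 ler01).
    by rewrite (le_trans (le_powR r0 (f0 x) fx1))// powR1.
  by rewrite ler_wpDl// ler_powR// ltW.
have lg : L1 (fun x => 1 + f x `^ q) by apply: L1D => //; exact: L1_cst.
have lr : L1 (fun x => f x `^ r).
  apply: L1_le lg _; first exact: measurable_fun_powR.
  by move=> x; rewrite ger0_norm ?powR_ge0.
split => //; apply: le_trans (Ex_le lr lg H) _.
by rewrite ExD ?Ex_cst//; exact: L1_cst.
Qed.

Definition indep f g := forall A B, measurable A -> measurable B ->
  P (f @^-1` A `&` g @^-1` B) = (P (f @^-1` A) * P (g @^-1` B))%E.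

(** The joint law is the product of the laws, and Tonelli's theorem applies. *)
Lemma ge0_integral_indep f g : measurable_fun setT f -> measurable_fun setT g ->
  (forall x, 0 <= f x) -> (forall x, 0 <= g x) -> indep f g ->
  (\int[P]_x (f x * g x)%:E = (\int[P]_x (f x)%:E) * (\int[P]_x (g x)%:E))%E.
Proof.
move=> mf mg f0 g0 fg.
pose Pf := distribution P (HB.pack f (isMeasurableFun.Build _ _ _ _ f mf) : {mfun T >-> R}).
pose Pg := distribution P (HB.pack g (isMeasurableFun.Build _ _ _ _ g mg) : {mfun T >-> R}).
have mfg : measurable_fun setT (fun x => (f x, g x)).
  exact: measurable_fun_pair.
pose Pfg := pushforward P (HB.pack (fun x => (f x, g x)) (isMeasurableFun.Build _ _ _ _ _ mfg) : {mfun T >-> (R * R)%type}).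
have E X : measurable X -> (Pf \x Pg)%E X = Pfg X.
  apply: product_measure_unique => A B mA mB.
  rewrite /Pfg /pushforward /= -fg//; congr (P _).
have mh : measurable_fun setT (fun z : R * R => (`|z.1| * `|z.2|)%:E).
  apply/measurable_EFinP; apply: measurable_funM.
    by apply: measurableT_comp => //; exact: measurable_fst.
  by apply: measurableT_comp => //; exact: measurable_snd.
have -> : (\int[P]_x (f x * g x)%:E = \int[Pfg]_z (`|z.1| * `|z.2|)%:E)%E.
  rewrite ge0_integral_pushforward//.
  by apply: eq_integral => x _ /=; rewrite !ger0_norm.
have -> : (\int[Pfg]_z (`|z.1| * `|z.2|)%:E = \int[Pf \x Pg]_z (`|z.1| * `|z.2|)%:E)%E.
  by apply: eq_measure_integral => A mA _; exact: (esym (E A mA)).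
rewrite fubini_tonelli1//=.
rewrite /fubini_F /=.
have mn : measurable_fun setT (fun y : R => `|y|%:E) by apply/measurable_EFinP; exact: normr_measurable.
have EZ (x : R) : (\int[Pg]_y (`|x| * `|y|)%:E = `|x|%:E * \int[Pg]_y `|y|%:E)%E.
  under eq_integral do rewrite EFinM.
  by rewrite ge0_integralZl//.
under eq_integral do rewrite EZ.
rewrite ge0_integralZr//; last exact: integral_ge0.
rewrite /Pf /Pg !ge0_integral_pushforward//.
by congr (_ * _)%E; apply: eq_integral => x _ /=; rewrite ger0_norm.
Qed.

Lemma indep_comp f g (phi psi : R -> R) : measurable_fun setT phi ->
  measurable_fun setT psi -> indep f g -> indep (phi \o f) (psi \o g).
Proof.
move=> mphi mpsi fg A B mA mB; apply: (fg (phi @^-1` A) (psi @^-1` B)).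
  by rewrite -[X in measurable X]setTI; exact: mphi.
by rewrite -[X in measurable X]setTI; exact: mpsi.
Qed.

Lemma L1M_indep f g : L1 f -> L1 g -> indep f g -> L1 (fun x => f x * g x).
Proof.
move=> lf lg fg; have mf := L1_measurable lf; have mg := L1_measurable lg.
apply/integrableP; split; first exact/measurable_EFinP/measurable_funM.
have mn : measurable_fun setT (@Num.norm _ R) by exact: normr_measurable.
have := @ge0_integral_indep (fun x => `|f x|) (fun x => `|g x|)
  (measurableT_comp mn mf) (measurableT_comp mn mg)
  (fun=> normr_ge0 _) (fun=> normr_ge0 _) (indep_comp mn mn fg).
rewrite -(EFin_Ex (L1_norm lf)) -(EFin_Ex (L1_norm lg)) -EFinM => e.
by under eq_integral do rewrite /= normrM; rewrite e ltry.
Qed.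

Lemma ge0_ExM_indep f g : L1 f -> L1 g -> (forall x, 0 <= f x) ->
  (forall x, 0 <= g x) -> indep f g -> Ex (fun x => f x * g x) = Ex f * Ex g.
Proof.
move=> lf lg f0 g0 fg; apply: EFin_inj; rewrite EFinM !EFin_Ex//; last exact: L1M_indep.
by apply: ge0_integral_indep => //; exact: L1_measurable.
Qed.

Lemma ExM_indep f g : L1 f -> L1 g -> indep f g ->
  Ex (fun x => f x * g x) = Ex f * Ex g.
Proof.
move=> lf lg fg.
pose p (x : R) := Num.max x 0; pose n (x : R) := Num.max (- x) 0.
have mp : measurable_fun setT p by apply: measurable_maxr => //; exact: measurable_id.
have mn : measurable_fun setT n.
  apply: measurable_maxr => //; exact: oppr_measurable.
have p0 x : 0 <= p x by rewrite /p le_max lexx orbT.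
have n0 x : 0 <= n x by rewrite /n le_max lexx orbT.
have pn x : x = p x - n x by rewrite /p /n; case: (leP x 0); case: (leP (- x) 0); lra.
have bd x : p x <= `|x| /\ n x <= `|x|.
  rewrite /p /n !ge_max normr_ge0 ler_norm -normrN ler_norm //.
have L1p h : L1 h -> L1 (p \o h).
  move=> lh; apply: L1_le (L1_norm lh) _.
    by apply: measurableT_comp mp _; exact: L1_measurable.
  by move=> x /=; rewrite ger0_norm//; case: (bd (h x)).
have L1n h : L1 h -> L1 (n \o h).
  move=> lh; apply: L1_le (L1_norm lh) _.
    by apply: measurableT_comp mn _; exact: L1_measurable.
  by move=> x /=; rewrite ger0_norm//; case: (bd (h x)).
have Epn h : L1 h -> Ex h = Ex (p \o h) - Ex (n \o h).
  by move=> lh; rewrite -ExB; [congr Ex; apply/funext => x /=; rewrite -pn|exact: L1p|exact: L1n].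
have ipp := indep_comp mp mp fg; have ipn := indep_comp mp mn fg.
have inp := indep_comp mn mp fg; have inn := indep_comp mn mn fg.
have lpf := L1p _ lf; have lpg := L1p _ lg; have lnf := L1n _ lf; have lng := L1n _ lg.
rewrite (Epn _ lf) (Epn _ lg).
transitivity (Ex (fun x => ((p \o f) x * (p \o g) x + (n \o f) x * (n \o g) x)
   - ((p \o f) x * (n \o g) x + (n \o f) x * (p \o g) x))).
  by congr Ex; apply/funext => x /=; rewrite {1}[f x]pn {1}[g x]pn; ring.
rewrite ExB ?ExD ?ge0_ExM_indep//; try (exact: L1M_indep);
  try (by move=> x; exact: p0); try (by move=> x; exact: n0);
  try (by apply: L1D; exact: L1M_indep).
ring.
Qed.

End Expectation.

(** * Independent offspring and the law of subtrees *)

Definition iid_field (R : realType) (mu : probability nat R)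
    (Q : probability field R) := forall J A, uniq J ->
  Q (cylinder J A) = (\prod_(u <- J) mu (A u))%E.

Section IidField.
Context (R : realType) (mu : probability nat R) (Q : probability field R).
Hypothesis iidQ : iid_field mu Q.
Implicit Types (F G : (seq nat -> nat) -> R) (S : set (seq nat)) (u : seq nat).

Lemma measurable_cylinders S E : cylinders S E -> (measurable : set (set field)) E.
Proof.
by move=> SE; apply: (@cylinders_measurable S); apply: sub_sigma_algebra.
Qed.

Lemma cylindersT S : cylinders S setT.
Proof. by exists [::], (fun=> setT); split => //; apply/seteqP. Qed.

(** Cylinders are stable under intersection, so that uniqueness of measures,
    applied to one factor after the other, reduces the claim to cylinders. *)
Lemma iid_field_indep S1 S2 E1 E2 : (forall u, S1 u -> ~ S2 u) ->
  <<s cylinders S1 >> E1 -> <<s cylinders S2 >> E2 ->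
  Q (E1 `&` E2) = (Q E1 * Q E2)%E.
Proof.
move=> S12.
have H S E (mE : (measurable : set (set field)) E) :
    (forall C, cylinders S C -> Q (C `&` E) = (Q C * Q E)%E) ->
    forall C, <<s cylinders S >> C -> Q (C `&` E) = (Q C * Q E)%E.
  move=> h C sC.
  have fE : (Q E \is a fin_num)%E by exact: fin_num_measure.
  have E0 : 0 <= fine (Q E) by exact: fine_ge0.
  have := @g_sigma_algebra_measure_unique _ R field (cylinders S)
    (@measurable_cylinders S) (fun=> setT) (fun=> cylindersT S).
  have bT : \bigcup_(k in [set: nat]) (fun=> [set: field]) k = setT.
    by rewrite bigcup_const.
  move=> /(_ bT (mrestr Q mE) (mscale (NngNum E0) Q) (@setI_closed_cylinders S)).
  rewrite /mrestr/= /mscale/= fineK// => U.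
  rewrite muleC; apply: U => //.
    by move=> A SA; rewrite /mrestr h// muleC.
  by move=> _; apply: le_lt_trans (probability_le1 Q _) (ltry _); exact: measurableI.
move=> h1 h2; have mE2 := cylinders_measurable h2.
apply: (H _ _ mE2 _ _ h1) => // C1 [J1 [A1 [u1 S1J ->]]].
rewrite setIC muleC; have mC1 : (measurable : set (set field)) (cylinder J1 A1).
  by apply: (@measurable_cylinders S1); exists J1, A1.
apply: (H _ _ mC1 _ _ h2) => // C2 [J2 [A2 [u2 S2J ->]]].
have uJ : uniq (J2 ++ J1).
  rewrite cat_uniq u1 u2 andbT/=; apply/hasPn => u /S1J/S12 nS2.
  by apply/negP => /S2J.
pose B u := if u \in J1 then A1 u else A2 u.
have -> : cylinder J2 A2 `&` cylinder J1 A1 = cylinder (J2 ++ J1) B.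
  apply/seteqP; split => [nu [c2 c1] u|nu c].
    rewrite mem_cat /B; case: ifPn => [/c1//|_]; rewrite orbF; exact: c2.
  split => u uJi; have := c u; rewrite mem_cat uJi ?orbT /B => /(_ isT)//.
    by rewrite ifF//; apply/negP => /S1J/S12; apply; exact: S2J.
  by rewrite uJi.
rewrite !iidQ// big_cat/=; congr (_ * _)%E; apply: eq_big_seq => u uJi.
  by rewrite /B ifF//; apply/negP => /S1J/S12; apply; exact: S2J.
by rewrite /B uJi.
Qed.

Lemma local_indep S1 S2 F G : (forall u, S1 u -> ~ S2 u) ->
  local S1 F -> local S2 G -> indep Q F G.
Proof.
move=> S12 lF lG A B _ _; apply: (iid_field_indep S12); exact: local_preimage.
Qed.

Lemma measurable_subtree u : @measurable_fun _ _ field field setT (subtree u).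
Proof.
apply: (@measurability _ _ field field setT (subtree u) (cylinders setT)) => //.
move=> _ [_ [J [A [_ _ ->]]] <-]; rewrite setTI.
apply: (@cylinders_measurable setT).
have -> : subtree u @^-1` cylinder J A =
    (fun nu => `[< forall v, v \in J -> A v (nu (u ++ v)) >]) @^-1` [set true].
  by apply/seteqP; split => nu /= => [h|/asboolP]; [apply/asboolP|].
apply: local_preimage => nu; exists [seq u ++ v | v <- J]; split => // nu' h.
apply: asbool_equiv_eq; split => H v vJ.
  by rewrite -h ?map_f//; exact: H.
by rewrite h ?map_f//; exact: H.
Qed.

(** It is enough to compare the two laws on cylinders. *)
Lemma pushforward_subtree u E : (measurable : set (set field)) E ->
  Q (subtree u @^-1` E) = Q E.
Proof.
move=> mE.
pose sh : {mfun field >-> field} := HB.pack (subtree u : field -> field)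
  (isMeasurableFun.Build _ _ _ _ (subtree u : field -> field) (@measurable_subtree u)).
have := @measure_unique _ R field (cylinders setT) (fun=> setT) erefl
  (@setI_closed_cylinders _) (fun=> cylindersT _).
have bT : \bigcup_(k in [set: nat]) (fun=> [set: field]) k = setT.
  by rewrite bigcup_const.
move=> /(_ bT (distribution Q sh) Q) U; apply: (U _ _ E mE).
  move=> _ [J [A [uJ _ ->]]]; rewrite /distribution/= /pushforward.
  pose B w := [set k | forall v, v \in J -> w = u ++ v -> A v k].
  transitivity (Q (cylinder [seq u ++ v | v <- J] B)).
    congr (Q _); apply/seteqP; split => [nu h w /mapP[v vJ ->] v' v'J /eqP|nu h v vJ].
      by rewrite eqseq_cat// eqxx/= => /eqP ->; exact: h.
    by apply: (h (u ++ v)); rewrite ?map_f.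
  rewrite iidQ; last first.
    by rewrite map_inj_uniq// => v w /eqP; rewrite eqseq_cat// eqxx => /eqP.
  rewrite big_map iidQ//; apply: eq_big_seq => v vJ; congr (mu _).
  apply/seteqP; split => [k h|k h w wJ /eqP]; first exact: h.
  by rewrite eqseq_cat// eqxx/= => /eqP <-.
by move=> _; apply: le_lt_trans (probability_le1 _ _) (ltry _).
Qed.

Lemma integral_subtree u (F : field -> R) : measurable_fun setT F ->
  (forall nu, 0 <= F nu) ->
  (\int[Q]_nu (F (subtree u nu))%:E = \int[Q]_nu (F nu)%:E)%E.
Proof.
move=> mF F0; have mF' : measurable_fun setT (EFin \o F) by exact/measurable_EFinP.
have := ge0_integral_pushforward (@measurable_subtree u) Q measurableT mF'.
rewrite preimage_setT => <-; last by move=> nu _; rewrite lee_fin.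
apply: eq_measure_integral; first exact: measurable_subtree.
by move=> ? A mA _; exact: pushforward_subtree.
Qed.

Lemma L1_subtree u (F : field -> R) : L1 Q F -> L1 Q (fun nu => F (subtree u nu)).
Proof.
move=> lF; have mF := L1_measurable lF; apply/integrableP; split.
  apply/measurable_EFinP; exact: (measurableT_comp mF (@measurable_subtree u)).
have := integral_subtree u (measurable_fun_norm mF) (fun=> normr_ge0 _).
rewrite /= => ->; by rewrite -(EFin_Ex (L1_norm lF)) ltry.
Qed.

Lemma Ex_subtree u (F : field -> R) : L1 Q F -> Ex Q (fun nu => F (subtree u nu)) = Ex Q F.
Proof.
move=> lF; have lF' := L1_subtree u lF.
have p0 x : 0 <= `|x| + x :> R by have := ler_norm (- x); rewrite normrN; lra.
have l1 := L1D (L1_norm lF) lF; have l2 := L1D (L1_norm lF') lF'.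
have mp := L1_measurable l1.
have H1 : Ex Q (fun nu => `|F (subtree u nu)| + F (subtree u nu)) =
       Ex Q (fun nu => `|F nu| + F nu).
  by apply: EFin_inj; rewrite !EFin_Ex//; apply: (integral_subtree u mp).
have H2 : Ex Q (fun nu => `|F (subtree u nu)|) = Ex Q (fun nu => `|F nu|).
  apply: EFin_inj; rewrite !EFin_Ex//; [|exact: L1_norm|exact: L1_norm].
  exact: (integral_subtree u (measurable_fun_norm (L1_measurable lF))).
by move: H1; rewrite !ExD ?H2//; [lra|exact: L1_norm|exact: L1_norm].
Qed.

(** Conditioning on a countably valued [K]: as [K] and [F v] look at disjoint
    parts of the field, [F v] keeps its law on the event that [K] equals [v], and
    it remains to sum over [v]. *)
Lemma integral_cond (V : countType) S1 S2 (K : (seq nat -> nat) -> V)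
    (F : V -> (seq nat -> nat) -> R) (phi : V -> R) : (forall u, S1 u -> ~ S2 u) ->
  local S1 K -> (forall nu, local S2 (F (K nu))) ->
  (forall nu nu', 0 <= F (K nu) nu') ->
  (forall nu, L1 Q (F (K nu))) -> (forall nu, Ex Q (F (K nu)) = phi (K nu)) ->
  (\int[Q]_nu (F (K nu) nu)%:E = \int[Q]_nu (phi (K nu))%:E)%E.
Proof.
move=> S12 lK lF F0 L1F EF.
pose D n := [set nu | pickle (K nu) = n].
have mD n : (measurable : set (set field)) (D n).
  apply: (@cylinders_measurable S1).
  have -> : D n = K @^-1` [set v | pickle v = n] by [].
  exact: local_preimage.
have tD : trivIset setT D.
  by move=> i j _ _ [nu [<- <-]].
have cD : \bigcup_n D n = setT.
  by apply/seteqP; split => // nu _; exists (pickle (K nu)).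
have mF : measurable_fun setT (fun nu : field => (F (K nu) nu)%:E).
  apply/measurable_EFinP; apply: measurable_local; apply: (@local_bind setT V R K F); first exact: local_setT lK.
  by move=> nu; exact: local_setT (lF nu).
have mphi : measurable_fun setT (fun nu : field => (phi (K nu))%:E).
  by apply/measurable_EFinP; apply: measurable_local; exact: (local_comp _ (local_setT lK)).
have p0 nu : 0 <= phi (K nu) by rewrite -EF; exact: Ex_ge0.
rewrite -cD !ge0_integral_bigcup//; last 4 first.
- exact: measurable_funTS.
- by move=> nu _; rewrite lee_fin.
- exact: measurable_funTS.
- by move=> nu _; rewrite lee_fin.
apply: eq_eseriesr => n _.
have [[nu0 Dn]|nD] := pselect (exists nu, D n nu); last first.
  suff -> : D n = set0 by rewrite !integral_set0.
  by apply/seteqP; split => // nu Dnu; apply: nD; exists nu.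
have KD nu : nu \in D n -> K nu = K nu0.
  by rewrite inE /D/= -Dn; exact: (pcan_inj (@pickleK V)).
transitivity (\int[Q]_(nu in D n) (F (K nu0) nu)%:E)%E.
  by apply: eq_integral => nu /KD ->.
transitivity (\int[Q]_(nu in D n) (phi (K nu0))%:E)%E; last first.
  by apply: eq_integral => nu /KD ->.
rewrite integral_cst// -EF EFin_Ex// integral_mkcond.
transitivity (\int[Q]_nu (\1_(D n) nu * F (K nu0) nu)%:E)%E.
  apply: eq_integral => nu _; rewrite patchE indicE.
  by case: (nu \in D n); rewrite ?mul1r ?mul0r.
have lI : local S1 (\1_(D n) : (seq nat -> nat) -> R).
  have -> : \1_(D n) = (fun nu : seq nat -> nat => (pickle (K nu) == n)%:R : R).
    apply/funext => nu; rewrite indicE; congr (_%:R); congr nat_of_bool.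
    by apply/idP/eqP; rewrite inE.
  move=> nu; have [J [JS hJ]] := lK nu; exists J; split => // nu' /hJ E.
  by rewrite E.
rewrite ge0_integral_indep//.
- rewrite muleC; congr (_ * _)%E.
  by rewrite -[LHS]/(\int[Q]_nu (EFin \o \1_(D n)) nu)%E integral_indic// setIT.
- exact: measurable_local (local_setT (lF nu0)).
- exact: local_indep S12 lI (lF nu0).
Qed.

Lemma Ex_cond (V : countType) S1 S2 (K : (seq nat -> nat) -> V)
    (F : V -> (seq nat -> nat) -> R) (phi : V -> R) : (forall u, S1 u -> ~ S2 u) ->
  local S1 K -> (forall nu, local S2 (F (K nu))) ->
  (forall nu nu', 0 <= F (K nu) nu') ->
  (forall nu, L1 Q (F (K nu))) ->
  (forall nu, Ex Q (F (K nu)) <= phi (K nu)) ->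
  L1 Q (fun nu => phi (K nu)) ->
  L1 Q (fun nu => F (K nu) nu) /\
  Ex Q (fun nu => F (K nu) nu) <= Ex Q (fun nu => phi (K nu)).
Proof.
move=> S12 lK lF F0 L1F EF L1phi.
have mF : measurable_fun setT (fun nu : field => F (K nu) nu).
  apply: measurable_local; apply: (@local_bind setT V R K F); first exact: local_setT lK.
  by move=> nu; exact: local_setT (lF nu).
pose psi (x : V) := Ex Q (F x).
have lpsi : L1 Q (fun nu => psi (K nu)).
  apply: L1_le L1phi _.
    by apply: measurable_local; exact: (local_comp _ (local_setT lK)).
  move=> nu; rewrite ger0_norm; first exact: EF.
  by rewrite /psi; apply: Ex_ge0 => nu'; exact: F0.
have E := integral_cond S12 lK lF F0 L1F (phi := psi) (fun=> erefl).
have lFK : L1 Q (fun nu => F (K nu) nu).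
  apply: (L1_ge0P Q mF _).2 => [nu|]; first exact: F0.
  by rewrite [ltLHS]E -EFin_Ex// ltry.
split => //; have -> : Ex Q (fun nu => F (K nu) nu) = Ex Q (fun nu => psi (K nu)).
  by apply: EFin_inj; rewrite !EFin_Ex.
exact: Ex_le.
Qed.

Lemma Ex_cond_eq (V : countType) S1 S2 (K : (seq nat -> nat) -> V)
    (F : V -> (seq nat -> nat) -> R) (phi : V -> R) : (forall u, S1 u -> ~ S2 u) ->
  local S1 K -> (forall nu, local S2 (F (K nu))) ->
  (forall nu nu', 0 <= F (K nu) nu') ->
  (forall nu, L1 Q (F (K nu))) ->
  (forall nu, Ex Q (F (K nu)) = phi (K nu)) ->
  L1 Q (fun nu => phi (K nu)) ->
  L1 Q (fun nu => F (K nu) nu) /\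
  Ex Q (fun nu => F (K nu) nu) = Ex Q (fun nu => phi (K nu)).
Proof.
move=> S12 lK lF F0 L1F EF L1phi.
have [|lFK _] := Ex_cond S12 lK lF F0 L1F _ L1phi.
  by move=> nu; rewrite EF.
split => //; apply: EFin_inj; rewrite !EFin_Ex//.
exact: integral_cond S12 lK lF F0 L1F EF.
Qed.

End IidField.

(** * Sums over a generation *)

Section Generations.
Variable R : realType.
Implicit Types (nu : seq nat -> nat) (u v : seq nat) (f : seq nat -> R)
  (D : (seq nat -> nat) -> R) (n : nat).

Lemma big_generationS nu n f :
  \sum_(u <- generation nu n.+1) f u =
  \sum_(u <- generation nu n) \sum_(i <- iota 0 (nu u)) f (rcons u i).
Proof.
rewrite /generation iterS -/(generation nu n) big_flatten big_map.
by apply: eq_bigr => u _; rewrite big_map.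
Qed.

Lemma big_generation_root nu n f :
  \sum_(u <- generation nu n.+1) f u =
  \sum_(i <- iota 0 (nu [::]))
     \sum_(v <- generation (subtree [:: i] nu) n) f (i :: v).
Proof.
elim: n f => [|n IH] f.
  rewrite big_generationS big_seq1; apply: eq_bigr => i _.
  by rewrite big_seq1.
rewrite big_generationS IH; apply: eq_bigr => i _.
by rewrite big_generationS.
Qed.

Definition gensum n D nu : R := \sum_(u <- generation nu n) D (subtree u nu).

Definition branch D nu : R := \sum_(i <- iota 0 (nu [::])) D (subtree [:: i] nu).

Lemma gensum0 D nu : gensum 0 D nu = D nu.
Proof. by rewrite /gensum big_seq1 subtree_nil. Qed.

Lemma gensumS n D nu : gensum n.+1 D nu = gensum n (branch D) nu.
Proof.
rewrite /gensum big_generationS; apply: eq_bigr => u _.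
rewrite /branch /subtree cats0; apply: eq_bigr => i _.
by congr D; apply/funext => v; rewrite cat_rcons.
Qed.

Lemma gensumS_root n D nu : gensum n.+1 D nu = branch (gensum n D) nu.
Proof.
rewrite /gensum big_generation_root; apply: eq_bigr => i _.
by apply: eq_bigr => v _; rewrite subtree_cat.
Qed.

Lemma gensumD n D D' nu :
  gensum n (fun nu => D nu + D' nu) nu = gensum n D nu + gensum n D' nu.
Proof. by rewrite /gensum -big_split. Qed.

Lemma gensumZ n c D nu : gensum n (fun nu => c * D nu) nu = c * gensum n D nu.
Proof. by rewrite /gensum -mulr_sumr. Qed.

Lemma gensum1 n nu : gensum n (fun=> 1) nu = (generation_size nu n)%:R.
Proof. by rewrite /gensum big_const_seq count_predT iter_addr_0. Qed.

Lemma size_generation nu n u : u \in generation nu n -> size u = n.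
Proof. by rewrite mem_generation => /andP[_ /eqP]. Qed.

Lemma local_generation n : local [set u | (size u < n)%N] (generation ^~ n).
Proof.
elim: n => [|n IH]; first exact: local_cst.
have lsub V (F : (seq nat -> nat) -> V) : local [set u | (size u < n)%N] F ->
    local [set u | (size u < n.+1)%N] F.
  by apply: local_sub => u /= /ltnW.
have -> : (fun nu => generation nu n.+1) =
    (fun nu => (fun L nu => \big[cat/[::]]_(u <- L) children nu u) (generation nu n) nu).
  by apply/funext => nu; rewrite /generation iterS -/(generation nu n); elim: (generation nu n) => [|u L IHL] /=; rewrite ?big_nil// big_cons -IHL.
apply: (@local_bind _ _ _ (generation ^~ n) (fun L nu => \big[cat/[::]]_(u <- L) children nu u)).
  exact: lsub.
move=> nu; apply: local_big => u /size_generation sz.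
by apply: (@local_comp _ _ _ (fun k => [seq rcons u i | i <- iota 0 k])); apply: local_coord; rewrite /= sz.
Qed.

Lemma below_inj n u v w : size u = n -> size v = n -> below u w -> below v w ->
  u = v.
Proof.
move=> su sv /prefixP[a ->] /prefixP[b].
move=> /eqP; rewrite eqseq_cat ?su ?sv// => /andP[/eqP -> _] //.
Qed.

Lemma below_size u : below u `<=` [set w | (size u <= size w)%N].
Proof. by move=> w /prefixP[a ->]; rewrite /= size_cat leq_addr. Qed.

Definition belows (L : seq (seq nat)) : set (seq nat) := [set w | exists2 u, u \in L & below u w].

Lemma local_sum_below (L : seq (seq nat)) D : local setT D ->
  local (belows L) (fun nu => \sum_(u <- L) D (subtree u nu)).
Proof.
move=> lD; apply: (@local_big _ R +%R 0 _ _ (fun u nu => D (subtree u nu))) => u uL.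
apply: local_sub (local_subtree _ lD) => w uw; by exists u.
Qed.

Lemma local_gensum n D : local setT D -> local setT (gensum n D).
Proof.
move=> lD; apply: (@local_bind setT _ _ (generation ^~ n)
   (fun L nu => \sum_(u <- L) D (subtree u nu))).
  exact: local_sub (@local_generation n).
by move=> nu; exact: local_sub (local_sum_below _ lD).
Qed.

Lemma local_branch D : local setT D -> local setT (branch D).
Proof.
move=> lD; have -> : branch D = gensum 1 D; last exact: local_gensum.
by apply/funext => nu; rewrite gensumS gensum0.
Qed.

Lemma belows_disjoint n u L w : uniq (u :: L) -> {in u :: L, forall v, size v = n} ->
  below u w -> ~ belows L w.
Proof.
move=> /= /andP[uL _] szL uw [v vL vw].
have := below_inj (szL _ (mem_head _ _)) (szL v _) uw vw.
by rewrite inE vL orbT => /(_ isT) E; rewrite E vL in uL.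
Qed.

End Generations.

Section Moments.
Context (R : realType) (mu : probability nat R) (Q : probability field R).
Hypothesis iidQ : iid_field mu Q.
Implicit Types (D : (seq nat -> nat) -> R) (u v : seq nat) (L : seq (seq nat)).

Lemma L1_powRD (p : R) (f g : field -> R) : 0 <= p ->
  measurable_fun setT f -> measurable_fun setT g ->
  L1 Q (fun x => `|f x| `^ p) -> L1 Q (fun x => `|g x| `^ p) ->
  L1 Q (fun x => `|f x + g x| `^ p).
Proof.
move=> p0 mf mg lf lg.
apply: (@L1_le _ _ _ Q _ (fun x => (1 + 1) `^ p * `|f x| `^ p + (1 + 1^-1) `^ p * `|g x| `^ p)).
- by apply: measurable_fun_powR; apply: measurable_fun_norm; exact: measurable_funD.
- by apply: L1D; exact: L1Z.
move=> x; rewrite ger0_norm ?powR_ge0//.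
apply: le_trans (powR_addl_le ltr01 p0 (normr_ge0 _) (normr_ge0 _)).
by apply: le_powR => //; exact: ler_normD.
Qed.

Lemma L1_powR_sum (p : R) L D : 0 < p -> local setT D ->
  L1 Q (fun nu => `|D nu| `^ p) ->
  L1 Q (fun nu => `|\sum_(u <- L) D (subtree u nu)| `^ p).
Proof.
move=> p0 lD lp; elim: L => [|u L IH].
  apply: (@eq_L1 _ _ _ _ _ (fun=> `|(0 : R)| `^ p)); last exact: L1_cst.
  by move=> nu; rewrite big_nil.
apply: (@eq_L1 _ _ _ _ _
  (fun nu : field => `|D (subtree u nu) + \sum_(v <- L) D (subtree v nu)| `^ p)).
  by move=> nu; rewrite big_cons.
apply: (L1_powRD (ltW p0)) => //.
- by apply: measurable_local; apply: local_sub (local_subtree _ lD).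
- by apply: measurable_local; apply: local_sub (local_sum_below _ lD).
- exact: (L1_subtree iidQ u lp).
Qed.

(** When [y] is centred and independent of [x], the first-order term in the
    expansion of [`|x + y| `^ p] averages out, so that each summand adds no more
    than a multiple of its own [p]-th moment. *)
Lemma von_Bahr_Esseen (p : R) n L D : 1 < p <= 2 -> local setT D -> L1 Q D ->
  Ex Q D = 0 -> L1 Q (fun nu => `|D nu| `^ p) ->
  uniq L -> {in L, forall u, size u = n} ->
  Ex Q (fun nu => `|\sum_(u <- L) D (subtree u nu)| `^ p) <=
  2 * p * (size L)%:R * Ex Q (fun nu => `|D nu| `^ p).
Proof.
move=> p12 lD l1D ED lDp; have p0 : 0 < p by lra. have pB : 0 <= p - 1 <= p by lra.
elim: L => [|u L IH] uL szL.
  rewrite (@eq_Ex _ _ _ _ _ (fun=> 0)) => [|nu].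
    by rewrite Ex_cst mulr0 mul0r.
  by rewrite big_nil normr0 powR0// gt_eqF.
have {}IH := IH (proj2 (andP uL)) (fun v vL => szL v (mem_behead (s := u :: L) vL)).
pose S := fun nu => \sum_(v <- L) D (subtree v nu).
pose Du := fun nu => D (subtree u nu).
have lS : L1 Q (fun nu => `|S nu| `^ p) by exact: L1_powR_sum.
have lDu : L1 Q (fun nu => `|Du nu| `^ p) by exact: (L1_subtree iidQ u lDp).
have locS : local setT S by apply: local_sub (local_sum_below _ lD).
have locDu : local setT Du by apply: local_sub (local_subtree _ lD).
have lsp : L1 Q (fun nu => spow p (S nu)).
  have mS : measurable_fun setT (fun nu : field => `|S nu|).
    by apply: measurable_fun_norm; exact: measurable_local.
  have [l _] := L1_powR_le pB mS (fun=> normr_ge0 _) lS.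
  apply: L1_le l _.
    by apply: measurable_local; exact: (local_comp _ locS).
  move=> nu; rewrite /spow normrM normr_sg (ger0_norm (powR_ge0 _ _)).
  by rewrite ler_piMl ?powR_ge0//; case: (S nu != 0).
have ind : indep Q (fun nu => spow p (S nu)) Du.
  apply: (local_indep iidQ (S1 := belows L) (S2 := below u)).
  - by move=> w wL uw; exact: (belows_disjoint uL szL uw wL).
  - by apply: (local_comp _ (local_sum_below _ lD)).
  - exact: local_subtree.
have l1Du : L1 Q Du by exact: (L1_subtree iidQ u l1D).
have EDu : Ex Q Du = 0 by rewrite (Ex_subtree iidQ u l1D).
have lM := L1M_indep lsp l1Du ind.
have E0 : Ex Q (fun nu => spow p (S nu) * Du nu) = 0.
  by rewrite (ExM_indep lsp l1Du ind) EDu mulr0.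
have lS1 : L1 Q (fun nu => `|S nu| `^ p + p * (spow p (S nu) * Du nu)).
  by apply: L1D => //; exact: L1Z.
have lS2 : L1 Q (fun nu => 2 * p * `|Du nu| `^ p) by exact: L1Z.
apply: (@le_trans _ _ (Ex Q (fun nu => `|S nu| `^ p + p * (spow p (S nu) * Du nu) + 2 * p * `|Du nu| `^ p))).
  apply: Ex_le; [exact: L1_powR_sum|exact: L1D|move=> nu].
  rewrite big_cons addrC mulrA; exact: normr_powR_expand.
rewrite ExD// ExD//; last exact: L1Z.
rewrite ExZ// E0 mulr0 addr0 ExZ// (Ex_subtree iidQ u lDp).
by rewrite [size (u :: L)]/= -[(size L).+1%:R]natr1 [2 * p * (_ + _)]mulrDr mulrDl mulr1 lerD2r.
Qed.

Lemma integral_coord u (f : nat -> R) : (forall k, 0 <= f k) ->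
  (\int[Q]_nu (f (nu u))%:E = \int[mu]_k (f k)%:E)%E.
Proof.
move=> f0.
have mc : measurable_fun setT (fun nu : field => nu u).
  by apply: measurable_local; exact: local_coord.
have mf : measurable_fun [set: nat] (EFin \o f) by [].
have := ge0_integral_pushforward mc Q measurableT mf.
rewrite preimage_setT => <-; last by move=> k _; rewrite lee_fin.
apply: eq_measure_integral => A mA _; rewrite /= /pushforward.
have -> : (fun nu : field => nu u) @^-1` A = cylinder [:: u] (fun=> A).
  apply/seteqP; split => [nu h v|nu h]; first by rewrite inE => /eqP ->.
  by apply: h; rewrite mem_head.
by rewrite iidQ// big_seq1.
Qed.

End Moments.

(** * Moments of generation sums and of the martingale *)

Section GaltonWatson.
Context (R : realType) (mu : probability nat R) (Q : probability field R) (m : R).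
Hypothesis iidQ : iid_field mu Q.
Hypothesis m1 : 1 < m.
Hypothesis L1_root : L1 Q (fun nu => (nu [::])%:R).
Hypothesis Ex_root : Ex Q (fun nu => (nu [::])%:R) = m.
Implicit Types (D : (seq nat -> nat) -> R) (u v : seq nat) (L : seq (seq nat)).

Let m0 : 0 < m. Proof. exact: lt_trans m1. Qed.

Lemma L1_sum_subtree L D : L1 Q D ->
  L1 Q (fun nu => \sum_(u <- L) D (subtree u nu)).
Proof.
move=> l; apply: (@L1_sum _ _ _ Q _ L (fun u nu => D (subtree u nu))) => u _.
exact: (L1_subtree iidQ u l).
Qed.

Lemma Ex_sum_subtree L D : L1 Q D ->
  Ex Q (fun nu => \sum_(u <- L) D (subtree u nu)) = (size L)%:R * Ex Q D.
Proof.
move=> l; rewrite (@Ex_sum _ _ _ Q _ L (fun u nu => D (subtree u nu))).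
  under eq_bigr do rewrite (Ex_subtree iidQ _ l).
  by rewrite big_const_seq count_predT iter_addr_0 mulr_natl.
by move=> u _; exact: (L1_subtree iidQ u l).
Qed.

Lemma local_gensum_cond n nu D (f : R -> R) : local setT D ->
  local [set u | (n <= size u)%N]
    (fun nu' => f (\sum_(u <- generation nu n) D (subtree u nu'))).
Proof.
move=> lD; apply: local_comp; apply: local_sub (local_sum_below _ lD).
by move=> w [u /size_generation <-]; exact: below_size.
Qed.

Lemma sizes_disjoint n (u : seq nat) : [set u | (size u < n)%N] u -> ~ [set u | (n <= size u)%N] u.
Proof. by rewrite /= ltnNge => /negP. Qed.

Let Z n : field -> R := fun nu => (generation_size nu n)%:R.

Let gensum_cond n D : local setT D -> L1 Q (Z n) -> (forall nu, 0 <= D nu) ->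
  L1 Q D -> L1 Q (gensum n D) /\ Ex Q (gensum n D) = Ex Q (Z n) * Ex Q D.
Proof.
move=> lD lZ D0 l1D.
have L1phi : L1 Q (fun nu : field => (size (generation nu n))%:R * Ex Q D).
  by apply: (eq_L1 _ (L1Z (Ex Q D) lZ)) => nu; rewrite mulrC.
have [|||||||l e] := @Ex_cond_eq _ _ _ iidQ (seq (seq nat)) [set u | (size u < n)%N]
  [set u | (n <= size u)%N] (generation ^~ n)
  (fun L nu => \sum_(u <- L) D (subtree u nu)) (fun L => (size L)%:R * Ex Q D).
- exact: sizes_disjoint.
- exact: local_generation.
- by move=> nu; exact: (@local_gensum_cond n nu D id).
- by move=> nu nu'; apply: sumr_ge0.
- by move=> nu; exact: L1_sum_subtree.
- by move=> nu; exact: Ex_sum_subtree.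
- exact: L1phi.
split; first exact: l.
by rewrite [LHS]e (eq_Ex _ (g := fun nu : field => Ex Q D * Z n nu)) ?ExZ 1?mulrC// => nu; rewrite mulrC.
Qed.

Lemma branch1 nu : branch (fun=> 1) nu = (nu [::])%:R :> R.
Proof. by rewrite /branch big_const_seq count_predT iter_addr_0 size_iota. Qed.

Lemma L1_generation_size n : L1 Q (Z n) /\ Ex Q (Z n) = m ^+ n.
Proof.
elim: n => [|n [l e]].
  have E : Z 0 =1 fun=> 1 by [].
  by rewrite (eq_Ex _ E) Ex_cst; split => //; apply: (eq_L1 E); exact: L1_cst.
have [] := @gensum_cond n (fun nu => (nu [::])%:R).
- by apply: local_comp; exact: local_coord.
- exact: l.
- by move=> nu; exact: ler0n.
- exact: L1_root.
move=> lg eg.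
have E : Z n.+1 =1 gensum n (fun nu => (nu [::])%:R).
  move=> nu; rewrite /Z -gensum1 gensumS; congr gensum.
  by apply/funext => nu'; exact: branch1.
by rewrite (eq_Ex _ E) eg e Ex_root -exprSr; split => //; exact: (eq_L1 E lg).
Qed.

Lemma ge0_Ex_gensum n D : local setT D -> (forall nu, 0 <= D nu) -> L1 Q D ->
  L1 Q (gensum n D) /\ Ex Q (gensum n D) = m ^+ n * Ex Q D.
Proof.
move=> lD D0 l1; have [lZ eZ] := L1_generation_size n.
by rewrite -eZ; exact: gensum_cond.
Qed.

Lemma Ex_gensum n D : local setT D -> L1 Q D ->
  L1 Q (gensum n D) /\ Ex Q (gensum n D) = m ^+ n * Ex Q D.
Proof.
move=> lD l1.
have lN : local setT (fun nu => `|D nu|) by exact: local_comp.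
have lP : local setT (fun nu => D nu + `|D nu|) by exact: local_comp2.
have l1N := L1_norm l1; have l1P := L1D l1 l1N.
have P0 nu : 0 <= D nu + `|D nu| by have := ler_norm (- D nu); rewrite normrN; lra.
have [la ea] := ge0_Ex_gensum n lP P0 l1P.
have [lb eb] := ge0_Ex_gensum n lN (fun=> normr_ge0 _) l1N.
have E (nu : field) : gensum n D nu = gensum n (fun nu => D nu + `|D nu|) nu - gensum n (fun nu => `|D nu|) nu.
  by rewrite gensumD addrK.
split; first by apply: (eq_L1 E); exact: L1B.
by rewrite (eq_Ex _ E) ExB// ea eb ExD// mulrDr addrK.
Qed.

(** Given the first [n] generations, [gensum n D] is a sum of independent centred
    variables, one for each vertex of generation [n]. *)
Lemma gensum_moment (p : R) n D : 1 < p <= 2 -> local setT D -> L1 Q D ->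
  Ex Q D = 0 -> L1 Q (fun nu => `|D nu| `^ p) ->
  L1 Q (fun nu => `|gensum n D nu| `^ p) /\
  Ex Q (fun nu => `|gensum n D nu| `^ p) <=
     2 * p * m ^+ n * Ex Q (fun nu => `|D nu| `^ p).
Proof.
move=> p12 lD l1D ED lDp; have p0 : 0 < p by lra.
have [lZ eZ] := L1_generation_size n.
have [|||||||l h] := @Ex_cond _ _ _ iidQ (seq (seq nat)) [set u | (size u < n)%N]
  [set u | (n <= size u)%N] (generation ^~ n)
  (fun L nu => `|\sum_(u <- L) D (subtree u nu)| `^ p)
  (fun L => 2 * p * (size L)%:R * Ex Q (fun nu => `|D nu| `^ p)).
- exact: sizes_disjoint.
- exact: local_generation.
- by move=> nu; exact: (@local_gensum_cond n nu D (fun x => `|x| `^ p)).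
- by move=> nu nu'; exact: powR_ge0.
- by move=> nu; exact: (L1_powR_sum iidQ).
- move=> nu; apply: (von_Bahr_Esseen iidQ (n := n)) => //; first exact: generation_uniq.
  by move=> u; exact: size_generation.
- apply: (eq_L1 _ (L1Z (2 * p * Ex Q (fun nu => `|D nu| `^ p)) lZ)) => nu.
  by rewrite /Z mulrAC.
split; first exact: l.
apply: le_trans h _.
rewrite (eq_Ex _ (g := fun nu : field => 2 * p * Ex Q (fun nu => `|D nu| `^ p) * Z n nu)).
  by rewrite ExZ// eZ mulrAC.
by move=> nu; rewrite /Z mulrAC.
Qed.

Section PositiveSums.
Variable D : (seq nat -> nat) -> R.
Hypothesis (locD : local setT D) (D0 : forall nu, 0 <= D nu).

(** For [p <= 1], compare the [p]-th power of the average of the summands with 1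
    plus that average; for [p > 1], use convexity. *)
Lemma sum_subtree_powR_le (p : R) L : 0 <= p -> L1 Q D ->
  L1 Q (fun nu => D nu `^ p) ->
  L1 Q (fun nu => (\sum_(u <- L) D (subtree u nu)) `^ p) /\
  Ex Q (fun nu => (\sum_(u <- L) D (subtree u nu)) `^ p) <=
    (1 + Ex Q D + Ex Q (fun nu => D nu `^ p)) * (size L)%:R `^ p.
Proof.
move=> p0 l1 lp.
have S0 nu : 0 <= \sum_(u <- L) D (subtree u nu) by exact: sumr_ge0.
have ED0 : 0 <= Ex Q D by exact: Ex_ge0.
have EDp0 : 0 <= Ex Q (fun nu => D nu `^ p) by apply: Ex_ge0 => nu; exact: powR_ge0.
have mS : measurable_fun setT (fun nu : field => (\sum_(u <- L) D (subtree u nu)) `^ p).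
  apply: measurable_local; apply: (@local_comp _ _ _ (fun x : R => x `^ p)).
  by apply: local_sub (local_sum_below _ locD).
case: (posnP (size L)) => [/size0nil ->|L0].
  have E : (fun nu : field => (\sum_(u <- [::]) D (subtree u nu)) `^ p) =1 (fun=> 0 `^ p).
    by move=> nu; rewrite big_nil.
  rewrite (eq_Ex _ E) Ex_cst; split; first by apply: (eq_L1 E); exact: L1_cst.
  by rewrite ler_peMl ?powR_ge0//; lra.
have k0 : 0 < (size L)%:R :> R by rewrite ltr0n.
set k := (size L)%:R : R.
have [p1|p1] := leP p 1.
  have H nu : (\sum_(u <- L) D (subtree u nu)) `^ p <=
      k `^ p * (1 + k^-1 * \sum_(u <- L) D (subtree u nu)).
    set s := \sum_(u <- L) _.
    have -> : s = k * (k^-1 * s) by rewrite mulVKf// gt_eqF.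
    have t0 : 0 <= k^-1 * s by rewrite mulr_ge0 ?S0// invr_ge0 ltW.
    rewrite powRM ?(ltW k0)// ler_wpM2l ?powR_ge0// mulKf ?gt_eqF//.
    have [t1|t1] := leP (k^-1 * s) 1.
      by rewrite ler_wpDr// (le_trans (le_powR p0 t0 t1))// powR1.
    by rewrite ler_wpDl// ler1_powR// ltW.
  have lg : L1 Q (fun nu => k `^ p * (1 + k^-1 * \sum_(u <- L) D (subtree u nu))).
    by apply: L1Z; apply: L1D; [exact: L1_cst|apply: L1Z; exact: L1_sum_subtree].
  have lS := L1_le mS lg (fun nu => le_trans (le_of_eq (ger0_norm (powR_ge0 _ _))) (H nu)).
  split => //; apply: le_trans (Ex_le lS lg H) _.
  have lt := L1_sum_subtree L l1.
  rewrite ExZ ?ExD ?Ex_cst ?ExZ//; last 3 first.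
    - exact: L1_cst.
    - exact: L1Z.
    - by apply: L1D; [exact: L1_cst|exact: L1Z].
  rewrite Ex_sum_subtree// mulKf ?gt_eqF// mulrC ler_wpM2r ?powR_ge0//; lra.
have H nu : (\sum_(u <- L) D (subtree u nu)) `^ p <=
    k `^ (p - 1) * \sum_(u <- L) D (subtree u nu) `^ p.
  by apply: powR_sum_le => //; exact: ltW.
have lt := L1_sum_subtree L lp.
have lg := L1Z (k `^ (p - 1)) lt.
have lS := L1_le mS lg (fun nu => le_trans (le_of_eq (ger0_norm (powR_ge0 _ _))) (H nu)).
split => //; apply: le_trans (Ex_le lS lg H) _.
rewrite ExZ// (Ex_sum_subtree L lp) -/k mulrA (mulrC _ k) mulr_powRB1 ?(ltW k0)//; last lra.
rewrite mulrC ler_wpM2r ?powR_ge0//; lra.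
Qed.

(** With [S] for the sum, [S `^ p] is the sum over [u] of
    [D (subtree u nu) * S `^ (p - 1)]. In each term [S] splits into the summand at
    [u] and a remainder independent of it: up to a factor close to 1 the former
    contributes the [p]-th moment of [D], and the latter involves moments of order
    [p - 1] only. *)
Lemma sum_indep_powR_le (p d : R) n L : 1 < p -> 0 < d -> L1 Q D ->
  L1 Q (fun nu => D nu `^ p) -> uniq L -> {in L, forall u, size u = n} ->
  Ex Q (fun nu => (\sum_(u <- L) D (subtree u nu)) `^ p) <=
    (1 + d) `^ (p - 1) * Ex Q (fun nu => D nu `^ p) * (size L)%:R +
    (1 + d^-1) `^ (p - 1) * Ex Q D *
    (1 + Ex Q D + Ex Q (fun nu => D nu `^ (p - 1))) * (size L)%:R `^ p.
Proof.
move=> p1 d0 l1 lp uL szL.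
have p0 : 0 < p by lra. have pB0 : 0 <= p - 1 by lra.
have pB : 0 <= p - 1 <= p by lra.
have [lpB _] := L1_powR_le pB (measurable_local locD) D0 lp.
set A := (1 + d) `^ (p - 1); set B := (1 + d^-1) `^ (p - 1).
set K := 1 + Ex Q D + _.
have A0 : 0 <= A by exact: powR_ge0.
have B0 : 0 <= B by exact: powR_ge0.
have ED0 : 0 <= Ex Q D by exact: Ex_ge0.
have K0 : 0 <= K by rewrite !addr_ge0//; apply: Ex_ge0 => nu; exact: powR_ge0.
pose s u nu : R := \sum_(v <- rem u L) D (subtree v nu).
have s0 u nu : 0 <= s u nu by exact: sumr_ge0.
pose rhs u nu := A * D (subtree u nu) `^ p + B * (D (subtree u nu) * s u nu `^ (p - 1)).
have [lS _] := sum_subtree_powR_le L (ltW p0) l1 lp.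
have H nu : (\sum_(u <- L) D (subtree u nu)) `^ p <= \sum_(u <- L) rhs u nu.
  have S0 : 0 <= \sum_(u <- L) D (subtree u nu) by exact: sumr_ge0.
  rewrite -(mulr_powRB1 S0 p0) mulr_suml big_seq_cond [leRHS]big_seq_cond.
  apply: ler_sum => u; rewrite andbT => uinL; rewrite /rhs.
  rewrite (big_rem u uinL)/= -/(s u nu) -(mulr_powRB1 (D0 _) p0).
  rewrite [B * _]mulrCA [A * _]mulrCA -mulrDr ler_wpM2l//.
  exact: powR_addl_le.
have lrhs : {in L, forall u, L1 Q (rhs u) /\
    Ex Q (rhs u) <= A * Ex Q (fun nu => D nu `^ p) + B * (Ex Q D * (K * (size L)%:R `^ (p - 1)))}.
  move=> u uinL.
  have [ls es] := sum_subtree_powR_le (rem u L) pB0 l1 lpB.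
  have ind : indep Q (fun nu => D (subtree u nu)) (fun nu => s u nu `^ (p - 1)).
    apply: (local_indep iidQ (S1 := below u) (S2 := belows (rem u L))).
    - move=> w; apply: (belows_disjoint (n := n)).
        by rewrite -(perm_uniq (perm_to_rem uinL)).
      by move=> v; rewrite -(perm_mem (perm_to_rem uinL)); exact: szL.
    - exact: local_subtree.
    - by apply: (@local_comp _ _ _ (fun x : R => x `^ (p - 1))); exact: local_sum_below.
  have lDu := L1_subtree iidQ u l1.
  have lM := L1M_indep lDu ls ind.
  have lDup := L1_subtree iidQ u lp.
  split; first by apply: L1D; exact: L1Z.
  rewrite ExD; [|exact: L1Z|exact: L1Z].
  rewrite !ExZ// (ExM_indep lDu ls ind) (Ex_subtree iidQ u l1) (Ex_subtree iidQ u lp).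
  rewrite lerD2l ler_wpM2l// ler_wpM2l//.
  apply: le_trans es _; rewrite ler_wpM2l//.
  by apply: le_powR => //; rewrite ler_nat size_rem// leq_pred.
have l1rhs : {in L, forall u, L1 Q (rhs u)} by move=> u /lrhs[].
apply: le_trans (Ex_le lS (L1_sum l1rhs) H) _.
rewrite Ex_sum//.
apply: (@le_trans _ _ (\sum_(u <- L) (A * Ex Q (fun nu => D nu `^ p) + B * (Ex Q D * (K * (size L)%:R `^ (p - 1)))))).
  by rewrite big_seq_cond [leRHS]big_seq_cond; apply: ler_sum => u; rewrite andbT => /lrhs[].
rewrite big_const_seq count_predT iter_addr_0 -[leLHS]mulr_natr mulrDl.
by rewrite -(mulr_powRB1 (ler0n _ _) p0) lerD2l; apply: le_of_eq; ring.
Qed.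

(** Condition on the number of children of the root. *)
Lemma branch_powR_le (p d : R) : 1 < p -> 0 < d -> L1 Q D ->
  L1 Q (fun nu => D nu `^ p) -> L1 Q (fun nu => (nu [::])%:R `^ p) ->
  L1 Q (fun nu => branch D nu `^ p) /\
  Ex Q (fun nu => branch D nu `^ p) <=
    (1 + d) `^ (p - 1) * Ex Q (fun nu => D nu `^ p) * m +
    (1 + d^-1) `^ (p - 1) * Ex Q D *
    (1 + Ex Q D + Ex Q (fun nu => D nu `^ (p - 1))) *
    Ex Q (fun nu => (nu [::])%:R `^ p).
Proof.
move=> p1 d0 l1 lp lNp.
set a := (1 + d) `^ (p - 1) * _; set b := (1 + d^-1) `^ (p - 1) * _ * _.
have lphi : L1 Q (fun nu => a * (nu [::])%:R + b * (nu [::])%:R `^ p).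
  by apply: L1D; exact: L1Z.
have E (nu : field) : branch D nu = \sum_(u <- [seq [:: i] | i <- iota 0 (nu [::])]) D (subtree u nu).
  by rewrite big_map.
have [|||||||l h] := @Ex_cond _ _ _ iidQ nat [set u | (size u < 1)%N]
  [set u | (1 <= size u)%N] (fun nu => nu [::])
  (fun k nu => (\sum_(u <- [seq [:: i] | i <- iota 0 k]) D (subtree u nu)) `^ p)
  (fun k => a * k%:R + b * k%:R `^ p).
- exact: sizes_disjoint.
- exact: local_coord.
- move=> nu; apply: (@local_comp _ _ _ (fun x : R => x `^ p)).
  apply: local_sub (local_sum_below _ locD) => w [_ /mapP[i _ ->]].
  exact: below_size.
- by move=> nu nu'; exact: powR_ge0.
- have p0 : 0 <= p by lra.
  by move=> nu; have [] := @sum_subtree_powR_le p [seq [:: i] | i <- iota 0 (nu [::])] p0 l1 lp.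
- move=> nu.
  have := @sum_indep_powR_le p d 1 [seq [:: i] | i <- iota 0 (nu [::])] p1 d0 l1 lp.
  rewrite size_map size_iota; apply.
    by rewrite map_inj_uniq ?iota_uniq// => i j [].
  by move=> u /mapP[i _ ->].
- exact: lphi.
split.
  by apply: (eq_L1 _ l) => nu; rewrite E.
rewrite (eq_Ex _ (g := fun nu : field => (\sum_(u <- [seq [:: i] | i <- iota 0 (nu [::])]) D (subtree u nu)) `^ p)).
  by apply: le_trans h _; rewrite ExD; [|exact: L1Z|exact: L1Z]; rewrite !ExZ// Ex_root.
by move=> nu; rewrite E.
Qed.

End PositiveSums.

Definition Wn n nu : R := (generation_size nu n)%:R / m ^+ n.

Lemma Wn_ge0 n nu : 0 <= Wn n nu.
Proof. by rewrite divr_ge0// exprn_ge0// ltW. Qed.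

Lemma local_Wn n : local setT (Wn n).
Proof.
apply: (@local_comp _ _ _ (fun L => (size L)%:R / m ^+ n)).
exact: local_sub (@local_generation n).
Qed.

Lemma L1_Wn n : L1 Q (Wn n).
Proof.
have [l _] := L1_generation_size n.
by apply: (eq_L1 _ (L1Z (m ^+ n)^-1 l)) => nu; rewrite mulrC.
Qed.

Lemma Ex_Wn n : Ex Q (Wn n) = 1.
Proof.
have [l e] := L1_generation_size n.
rewrite (eq_Ex _ (g := fun nu : field => (m ^+ n)^-1 * Z n nu)) ?ExZ ?e ?mulVf//.
  by rewrite expf_neq0// gt_eqF.
by move=> nu; rewrite mulrC.
Qed.

Lemma branchZ c D nu : branch (fun nu => c * D nu) nu = c * branch D nu.
Proof. by rewrite /branch -mulr_sumr. Qed.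

Lemma WnS n nu : Wn n.+1 nu = m^-1 * branch (Wn n) nu.
Proof.
rewrite /Wn -gensum1 gensumS_root.
have -> : gensum n (fun=> 1) = (fun nu => m ^+ n * Wn n nu).
  by apply/funext => nu'; rewrite gensum1 mulrC divfK// expf_neq0// gt_eqF.
rewrite branchZ exprS; set x := branch _ _.
have mn : m != 0 by rewrite gt_eqF.
by field; rewrite ?expf_neq0 ?mn.
Qed.

Variable q : R.
Hypothesis q1 : 1 < q.
Hypothesis L1_root_q : L1 Q (fun nu => (nu [::])%:R `^ q).

Lemma L1_root_powR (p : R) : 0 <= p <= q -> L1 Q (fun nu => (nu [::])%:R `^ p).
Proof.
move=> pq.
by have [] := L1_powR_le pq (L1_measurable L1_root) (fun=> ler0n _ _) L1_root_q.
Qed.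

Lemma affine_bound (x : nat -> R) a b : 0 <= a < 1 -> 0 <= b -> 0 <= x 0 ->
  (forall n, x n.+1 <= a * x n + b) -> forall n, x n <= x 0 + b / (1 - a).
Proof.
move=> /andP[a0 a1] b0 x0 H; have c0 : 0 < 1 - a by lra.
have E : b = (1 - a) * (b / (1 - a)) by rewrite mulrC divfK ?gt_eqF.
have d0 : 0 <= b / (1 - a) by rewrite divr_ge0// ltW.
elim => [|n IH]; first lra.
apply: le_trans (H n) _; move: E IH d0; set y := b / _ => E IH d0; rewrite E.
have := ler_wpM2l a0 IH; have : a * x 0 <= x 0 by rewrite ler_piMl// ltW.
nra.
Qed.

(** Induction on the integer part of the exponent: the leading term of
    [branch_powR_le] is contracted by a factor close to [m `^ (1 - p)] from one
    generation to the next, and the others only involve moments of order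
    [p - 1]. *)
Lemma Wn_moment (p : R) : 0 <= p <= q -> exists C, forall n,
  L1 Q (fun nu => Wn n nu `^ p) /\ Ex Q (fun nu => Wn n nu `^ p) <= C.
Proof.
suff H k : forall p, 0 <= p <= q -> p <= k.+1%:R -> exists C, forall n,
    L1 Q (fun nu => Wn n nu `^ p) /\ Ex Q (fun nu => Wn n nu `^ p) <= C.
  move=> /andP[p0 pq]; apply: (H (Num.truncn p)); first by rewrite p0.
  by rewrite ltW// truncnS_gt.
have base r : 0 <= r <= 1 -> exists C, forall n,
    L1 Q (fun nu => Wn n nu `^ r) /\ Ex Q (fun nu => Wn n nu `^ r) <= C.
  move=> r01; exists (1 + 1) => n.
  have E (nu : field) : Wn n nu `^ 1 = Wn n nu by rewrite powRr1 ?Wn_ge0.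
  have l1 : L1 Q (fun nu => Wn n nu `^ 1) by exact: (eq_L1 E (L1_Wn n)).
  have [l h] := L1_powR_le r01 (measurable_local (local_Wn n)) (Wn_ge0 n) l1.
  by split => //; move: h; rewrite (eq_Ex _ E) Ex_Wn.
elim: k => [|k IH] r rq rk; first by apply: base; lra.
have [r1|r1] := leP r 1; first by apply: base; lra.
have rB1 : 0 <= r - 1 <= q by lra.
have rB2 : r - 1 <= k.+1%:R by move: rk; rewrite -[k.+2%:R]natr1; lra.
have [C hC] := IH _ rB1 rB2.
have m1c : 1 < m by exact: m1.
(* any [d > 0] with [1 + d < m] makes the recursion contract *)
pose d := (m - 1) / 2.
have d0 : 0 < d by rewrite /d; lra.
have lNr : L1 Q (fun nu => (nu [::])%:R `^ r).
  by apply: L1_root_powR; lra.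
have rB : 0 < r - 1 by lra.
have C0 : 0 <= C.
  by have [_] := hC 0; apply: le_trans; apply: Ex_ge0 => nu; exact: powR_ge0.
set eN := Ex Q (fun nu => (nu [::])%:R `^ r).
have eN0 : 0 <= eN by apply: Ex_ge0 => nu; exact: powR_ge0.
pose B := (1 + d^-1) `^ (r - 1).
have B0 : 0 <= B by exact: powR_ge0.
pose a := m^-1 `^ r * ((1 + d) `^ (r - 1) * m).
pose b := m^-1 `^ r * (B * (2 + C) * eN).
have im0 : 0 < m^-1 by rewrite invr_gt0.
have r0 : 0 < r by lra.
have d1 : 0 <= 1 + d by lra.
have aE : a = (m^-1 * (1 + d)) `^ (r - 1).
  rewrite /a -(mulr_powRB1 (ltW im0) r0) (powRM _ (ltW im0) d1).
  set x := m^-1 `^ _; set y := (1 + d) `^ _.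
  by field; rewrite gt_eqF.
have a1 : 0 <= a < 1.
  rewrite aE powR_ge0/=.
  suff : (m^-1 * (1 + d)) `^ (r - 1) < 1 `^ (r - 1) by rewrite powR1.
  apply: gt0_ltr_powR => //; rewrite ?nnegrE//.
    by rewrite mulr_ge0 ?(ltW im0).
  by rewrite ltr_pdivrMl// mulr1 /d; lra.
have b0 : 0 <= b by rewrite /b !mulr_ge0 ?powR_ge0//; lra.
have step n : L1 Q (fun nu => Wn n nu `^ r) ->
    L1 Q (fun nu => Wn n.+1 nu `^ r) /\
    Ex Q (fun nu => Wn n.+1 nu `^ r) <= a * Ex Q (fun nu => Wn n nu `^ r) + b.
  move=> ln; have [lb hb] := branch_powR_le (local_Wn n) (Wn_ge0 n) r1 d0 (L1_Wn n) ln lNr.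
  have E (nu : field) : Wn n.+1 nu `^ r = m^-1 `^ r * branch (Wn n) nu `^ r.
    by rewrite WnS powRM ?(ltW im0)//; apply: sumr_ge0 => i _; exact: Wn_ge0.
  split; first by apply: (eq_L1 E); exact: L1Z.
  rewrite (eq_Ex _ E) ExZ//.
  apply: le_trans (ler_wpM2l (powR_ge0 _ _) hb) _.
  rewrite mulrDr; apply: lerD; first by rewrite /a; apply: le_of_eq; ring.
  rewrite /b ler_wpM2l ?powR_ge0// ler_wpM2r// -mulrA ler_wpM2l//.
  have [_ hCn] := hC n; rewrite Ex_Wn mul1r.
  exact: (lerD (lexx (1 + 1)) hCn).
have lW n : L1 Q (fun nu => Wn n nu `^ r).
  elim: n => [|n IHn]; last by have [] := step n IHn.
  apply: (eq_L1 (g := fun=> (1 / m ^+ 0) `^ r)) => //; exact: L1_cst.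
exists (Ex Q (fun nu => Wn 0 nu `^ r) + b / (1 - a)) => n; split => //.
apply: (affine_bound (x := fun n => Ex Q (fun nu => Wn n nu `^ r)) a1 b0).
  by apply: Ex_ge0 => nu; exact: powR_ge0.
by move=> k'; have [] := step k' (lW k').
Qed.

End GaltonWatson.

(** * Almost sure convergence and convergence of moments *)

Section Convergence.
Context (R : realType) d (T : measurableType d) (P : probability T R).
Implicit Types (X Y : nat -> T -> R) (f g W : T -> R).

Lemma ae_imply (A B : T -> Prop) : (forall x, A x -> B x) ->
  {ae P, forall x, A x} -> {ae P, forall x, B x}.
Proof. by move=> AB; apply: filterS. Qed.

Lemma ae_and (A B : T -> Prop) : {ae P, forall x, A x} ->
  {ae P, forall x, B x} -> {ae P, forall x, A x /\ B x}.
Proof. by move=> hA hB; apply: filterS2 hA hB. Qed.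

Lemma ae_forall (A : nat -> T -> Prop) : (forall n, {ae P, forall x, A n x}) ->
  {ae P, forall x, forall n, A n x}.
Proof. by move=> hA; apply: ae_foralln. Qed.

(** By monotone convergence the sum of the series has a finite expectation. *)
Lemma ae_cvg_series X (M : R) : (forall n x, 0 <= X n x) -> (forall n, L1 P (X n)) ->
  (forall n, \sum_(0 <= k < n) Ex P (X k) <= M) ->
  {ae P, forall x, cvgn (series (X ^~ x))}.
Proof.
move=> X0 lX bX.
pose f x := (\sum_(0 <= n <oo) (X n x)%:E)%E.
have mX n : measurable_fun setT (fun x => (X n x)%:E).
  by apply/measurable_EFinP; exact: L1_measurable (lX n).
have mf : measurable_fun setT f.
  by apply: ge0_emeasurable_sum => // n x _ _; rewrite lee_fin.
have f0 x : (0 <= f x)%E by apply: nneseries_ge0 => n _ _; rewrite lee_fin.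
have lf : P.-integrable setT f.
  apply/integrableP; split => //.
  under eq_integral do rewrite gee0_abs//.
  rewrite integral_nneseries//; last by move=> n x _; rewrite lee_fin.
  apply: (@le_lt_trans _ _ M%:E); last exact: ltry.
  apply: lime_le.
    by apply: is_cvg_nneseries => n _ _; apply: integral_ge0 => x _; rewrite lee_fin.
  apply: nearW => n; under eq_bigr do rewrite -EFin_Ex//.
  by rewrite sumEFin lee_fin.
apply: filterS (integrable_ae measurableT lf) => x /(_ I) fx.
apply: nondecreasing_is_cvgn.
  by apply: nondecreasing_series => n _ _.
exists (fine (f x)) => _ [n _ <-]; rewrite -lee_fin fineK// /series/=.
rewrite -sumEFin; apply: nneseries_lim_ge => k _ _; by rewrite lee_fin.
Qed.

Lemma Ex_fatou X f (c : R) : (forall n, measurable_fun setT (X n)) ->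
  measurable_fun setT f -> (forall n x, 0 <= X n x) -> (forall x, 0 <= f x) ->
  {ae P, forall x, X n x @[n --> \oo] --> f x} ->
  (\forall n \near \oo, L1 P (X n) /\ Ex P (X n) <= c) ->
  L1 P f /\ Ex P f <= c.
Proof.
move=> mX mf X0 f0 Xf Xc.
have mEX n : measurable_fun setT (fun x => (X n x)%:E) by exact/measurable_EFinP.
have H : (\int[P]_x (f x)%:E <= c%:E)%E.
  have := fatou P measurableT mEX (fun n x _ => X0 n x).
  have -> : (\int[P]_x limn_einf (fun n => (X n x)%:E) = \int[P]_x (f x)%:E)%E.
    apply: ge0_ae_eq_integral => //.
    - apply: (@emeasurable_fun_cvg _ _ _ _ (fun n x => einfs (fun n => (X n x)%:E) n)) => //.
        exact: measurable_fun_einfs.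
      by move=> x _; rewrite limn_einf_lim; exact: is_cvg_einfs.
    - exact/measurable_EFinP.
    - move=> x _; rewrite limn_einf_lim; apply: lime_ge.
        exact: is_cvg_einfs.
      by apply: nearW => n; apply: le_ereal_inf_tmp => _ [k _ <-]; rewrite lee_fin.
    - by move=> x _; rewrite lee_fin.
    apply: filterS Xf => x Xx _.
    have h : (X n x)%:E @[n --> \oo] --> (f x)%:E by apply: cvg_EFin => //; exact: nearW.
    by rewrite is_cvg_limn_einfE; [exact/cvg_lim|apply/cvg_ex; exists (f x)%:E].
  move=> /le_trans; apply.
  rewrite limn_einf_lim; apply: lime_le; first exact: is_cvg_einfs.
  case: Xc => N _ hN; apply: nearW => n.
  apply: (@le_trans _ _ (\int[P]_x (X (maxn n N) x)%:E)%E).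
    apply: ereal_inf_lbound; by exists (maxn n N) => //=; rewrite leq_maxl.
  by have [l h] := hN (maxn n N) (leq_maxr n N); rewrite -EFin_Ex// lee_fin.
have lf : L1 P f by apply: (L1_ge0P P mf f0).2; exact: le_lt_trans H (ltry _).
by split => //; rewrite -lee_fin EFin_Ex.
Qed.

(** Convergence is the Cauchy criterion, with countably many quantifiers. *)
Lemma measurable_cvgn X : (forall n, measurable_fun setT (X n)) ->
  measurable [set x | cvgn (X ^~ x)].
Proof.
move=> mX.
have -> : [set x | cvgn (X ^~ x)] =
  \bigcap_(k : nat) \bigcup_(N : nat) \bigcap_(i : nat) \bigcap_(j : nat)
    [set x | `|X (N + i)%N x - X (N + j)%N x| <= k.+1%:R^-1].
  apply/seteqP; split => x /=.
    move=> /cauchy_cvgP/cauchy_ballP Xc k _.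
    have k0 : 0 < k.+1%:R^-1 :> R by rewrite invr_gt0.
    have [[A B] /= [[N _ NA] [M _ MB]] AB] := Xc _ k0.
    exists (maxn N M) => // i _ j _; apply/ltW.
    have := AB (X (maxn N M + i)%N x, X (maxn N M + j)%N x).
    rewrite /= -ball_normE; apply; split.
      apply: (NA (maxn N M + i)%N) => /=.
      by rewrite (leq_trans (leq_maxl N M))// leq_addr.
    apply: (MB (maxn N M + j)%N) => /=.
    by rewrite (leq_trans (leq_maxr N M))// leq_addr.
  move=> H; apply/cauchy_cvgP/cauchy_ballP => e e0.
  have [k _ ke] := near_infty_natSinv_lt (PosNum e0).
  have {}ke := ke k (leqnn k).
  have [N _ HN] := H k I.
  pose A := [set y | exists i, y = X (N + i)%N x].
  exists (A, A) => /=.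
    split; exists N => // n /= Nn; exists (n - N)%N; by rewrite subnKC.
  move=> [y z] /= [[i ->] [j ->]]; rewrite -ball_normE /=.
  exact: le_lt_trans (HN i I j I) ke.
apply: bigcapT_measurable => k; apply: bigcupT_measurable => N.
apply: bigcapT_measurable => i; apply: bigcapT_measurable => j.
have mn : measurable_fun setT (fun x => `|X (N + i)%N x - X (N + j)%N x|).
  by apply: measurable_fun_norm; exact: measurable_funB.
by apply: (@measurable_set_ler _ _ _ _ (fun=> k.+1%:R^-1)).
Qed.

Lemma measurable_limn X : (forall n, measurable_fun setT (X n)) ->
  measurable_fun setT (fun x => limn (X ^~ x)).
Proof.
move=> mX; set C := [set x | cvgn (X ^~ x)].
have mC : measurable C by exact: measurable_cvgn.
apply: (@measurable_fun_cvg _ _ _ setT (fun n x => X n x * \1_C x)).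
  by move=> n; apply: measurable_funM => //; exact: measurable_indic.
move=> x _; rewrite indicE; case: (boolP (x \in C)) => [|/negP].
  rewrite inE => Xc; under eq_fun do rewrite mulr1; exact: Xc.
rewrite inE => nXc; under eq_fun do rewrite mulr0.
by rewrite dvgP//; exact: cvg_cst.
Qed.

(** The increments are almost surely absolutely summable. *)
Lemma geometric_increments_ae X (c rho : R) : (forall n, L1 P (X n)) ->
  0 < c -> 0 < rho < 1 ->
  (forall n, Ex P (fun x => `|X n.+1 x - X n x|) <= c * rho ^+ n) ->
  {ae P, forall x, cvgn (X ^~ x)}.
Proof.
move=> lX c0 /andP[r0 r1] H.
have lD n : L1 P (fun x => `|X n.+1 x - X n x|) by apply: L1_norm; exact: L1B.
have b n : \sum_(0 <= k < n) Ex P (fun x => `|X k.+1 x - X k x|) <= c / (1 - rho).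
  apply: (@le_trans _ _ (series (geometric c rho) n)).
    by rewrite /series/=; apply: ler_sum => k _; exact: H.
  by apply: geometric_le_lim => //; [exact: ltW|rewrite ger0_norm// ltW].
apply: filterS (ae_cvg_series (fun n x => normr_ge0 _) lD b) => x hx.
have : cvgn (series (telescope (X ^~ x))) by exact: normed_cvg.
rewrite telescopeK => h.
have -> : X ^~ x = (fun n => (X n x - X 0 x) + X 0 x) by apply/funext => n; rewrite subrK.
by apply: is_cvgD => //; exact: is_cvg_cst.
Qed.

Lemma Ex_norm_triangle f g W : L1 P f -> L1 P g -> L1 P W ->
  Ex P (fun x => `|f x - g x|) <= Ex P (fun x => `|f x - W x|) + Ex P (fun x => `|W x - g x|).
Proof.
move=> lf lg lW.
have l1 : L1 P (fun x => `|f x - W x|) by apply: L1_norm; exact: L1B.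
have l2 : L1 P (fun x => `|W x - g x|) by apply: L1_norm; exact: L1B.
rewrite -ExD//; apply: Ex_le; [by apply: L1_norm; exact: L1B|exact: L1D|].
by move=> x; rewrite -{1}(subrK (W x) (f x)) -addrA ler_normD.
Qed.

(** The triangle inequality bounds [X n - X (n + k)] uniformly in [k], and Fatou's
    lemma lets [k] go to infinity. *)
Lemma geometric_increments_L1 X (c rho : R) : (forall n, L1 P (X n)) ->
  0 < c -> 0 < rho < 1 ->
  (forall n, Ex P (fun x => `|X n.+1 x - X n x|) <= c * rho ^+ n) ->
  let W := fun x => limn (X ^~ x) in
  L1 P W /\ forall n, Ex P (fun x => `|X n x - W x|) <= c / (1 - rho) * rho ^+ n.
Proof.
move=> lX c0 r01 H W; have /andP[r0 r1] := r01.
have ae := geometric_increments_ae lX c0 r01 H.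
have mX n : measurable_fun setT (X n) by exact: L1_measurable.
have mW : measurable_fun setT W by exact: measurable_limn.
have d0 : 0 < 1 - rho by rewrite subr_gt0.
have b n k : Ex P (fun x => `|X n x - X (n + k)%N x|) <= c / (1 - rho) * rho ^+ n.
  apply: (@le_trans _ _ (c * rho ^+ n / (1 - rho) * (1 - rho ^+ k))).
    elim: k => [|k IH].
      rewrite expr0 subrr mulr0 (eq_Ex _ (g := fun=> 0)) ?Ex_cst// => x.
      by rewrite addn0 subrr normr0.
    apply: le_trans (Ex_norm_triangle (lX n) (lX _) (lX (n + k)%N)) _.
    have s : Ex P (fun x => `|X (n + k)%N x - X (n + k.+1)%N x|) <= c * rho ^+ (n + k).
      apply: le_trans (H (n + k)%N); apply: le_of_eq; apply: eq_Ex => x.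
      by rewrite addnS distrC.
    apply: le_trans (lerD IH s) _.
    apply: le_of_eq; rewrite exprD [rho ^+ k.+1]exprS; field.
    by rewrite gt_eqF.
  rewrite [c * rho ^+ n / _]mulrAC -[leRHS]mulr1 ler_wpM2l//.
    by rewrite mulr_ge0 ?exprn_ge0 ?divr_ge0 ?(ltW c0) ?(ltW d0) ?(ltW r0).
  by rewrite lerBlDr lerDl exprn_ge0// ltW.
have F n : L1 P (fun x => `|X n x - W x|) /\
    Ex P (fun x => `|X n x - W x|) <= c / (1 - rho) * rho ^+ n.
  apply: (@Ex_fatou (fun k x => `|X n x - X (n + k)%N x|)) => //.
  - by move=> k; apply: measurable_fun_norm; exact: measurable_funB.
  - by apply: measurable_fun_norm; exact: measurable_funB.
  - apply: filterS ae => x Xx; apply: cvg_norm; apply: cvgB; first exact: cvg_cst.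
    have -> : (fun k => X (n + k)%N x) = [sequence X (k + n)%N x]_k.
      by apply/funext => k; rewrite addnC.
    by move: Xx; rewrite -(@cvg_shiftn n).
  - by apply: nearW => k; split; [apply: L1_norm; exact: L1B|exact: b].
split; last by move=> n; case: (F n).
have [l0 _] := F 0.
apply: (L1_le mW (L1D (L1_norm (lX 0)) l0)) => x.
by have := ler_normD (X 0 x) (W x - X 0 x); rewrite subrKC distrC.
Qed.

(** With [D] the positive part of [W `^ q - Y n `^ q], superadditivity of the power
    gives [`|Y n - W| `^ q <= Y n `^ q - W `^ q + 2 * D], and the difference on the
    right has a nonpositive mean. Finally [D] is at most [W `^ q] where [W > K], and
    elsewhere a multiple of [`|Y n - W|], the power being Lipschitz on bounded
    sets. *)
Lemma L1_cvg_Lq Y W (q : R) : 1 < q -> (forall n x, 0 <= Y n x) ->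
  (forall x, 0 <= W x) -> (forall n, L1 P (Y n)) -> L1 P W ->
  (forall n, L1 P (fun x => Y n x `^ q)) -> L1 P (fun x => W x `^ q) ->
  (forall n, Ex P (fun x => Y n x `^ q) <= Ex P (fun x => W x `^ q)) ->
  Ex P (fun x => `|Y n x - W x|) @[n --> \oo] --> 0 ->
  (forall n, L1 P (fun x => `|Y n x - W x| `^ q)) /\
  Ex P (fun x => `|Y n x - W x| `^ q) @[n --> \oo] --> 0.
Proof.
move=> q1 Y0 W0 lY lW lYq lWq YW cYW.
have q0 : 0 < q by lra. have q0' : 0 <= q by lra. have q1' : 1 <= q by lra.
pose D n x := Num.max (W x `^ q - Y n x `^ q) 0.
have mY n : measurable_fun setT (Y n) by exact: L1_measurable (lY n).
have mW : measurable_fun setT W by exact: L1_measurable lW.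
have lWY n : L1 P (fun x => W x `^ q - Y n x `^ q) by exact: L1B.
have lD n : L1 P (D n).
  apply: L1_le (L1_norm (lWY n)) _.
    apply: measurable_maxr; last exact: measurable_cst.
    exact: L1_measurable (lWY n).
  by move=> x; rewrite /D; case: (leP (W x `^ q - Y n x `^ q) 0) => h; rewrite ?normr0 ?normr_ge0 ?lexx.
have H n x : `|Y n x - W x| `^ q <= Y n x `^ q - W x `^ q + 2 * D n x.
  rewrite /D; case: (leP (W x `^ q - Y n x `^ q) 0) => h; have [YWx|WYx] := leP (Y n x) (W x).
  - have := le_powR q0' (Y0 n x) YWx.
    have E : W x - Y n x = - (Y n x - W x) by ring.
    have d0 : 0 <= W x - Y n x by rewrite subr_ge0.
    have := powR_superadditive q1' (Y0 n x) d0.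
    rewrite subrKC E => h1 h2; rewrite -normrN ger0_norm -?E//.
    rewrite mulr0 addr0 E; lra.
  - have d0 : 0 <= Y n x - W x by rewrite subr_ge0 ltW.
    rewrite ger0_norm// mulr0 addr0.
    by have := powR_superadditive q1' (W0 x) d0; rewrite subrKC; lra.
  - have E : W x - Y n x = - (Y n x - W x) by ring.
    have d0 : 0 <= W x - Y n x by rewrite subr_ge0.
    have := powR_superadditive q1' (Y0 n x) d0.
    rewrite subrKC => h1; rewrite -normrN -E ger0_norm//; lra.
  - by have := le_powR q0' (W0 x) (ltW WYx); lra.
have lq n : L1 P (fun x => `|Y n x - W x| `^ q).
  apply: (L1_le _ (L1D (L1B (lYq n) lWq) (L1Z 2 (lD n)))).
    by apply: measurable_fun_powR; apply: measurable_fun_norm; exact: measurable_funB.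
  by move=> x; rewrite ger0_norm ?powR_ge0//; exact: H.
split => //.
have bq n : Ex P (fun x => `|Y n x - W x| `^ q) <= 2 * Ex P (D n).
  apply: le_trans (Ex_le (lq n) (L1D (L1B (lYq n) lWq) (L1Z 2 (lD n))) (H n)) _.
  rewrite ExD ?ExB ?ExZ//; [|exact: L1B|exact: L1Z].
  by rewrite gerDr subr_le0.
pose tail (K : nat) x := W x `^ q * (K%:R < W x)%R%:R.
have mt K : measurable_fun setT (tail K).
  apply: measurable_funM; first exact: measurable_fun_powR.
  have -> : (fun x => (K%:R < W x)%R%:R) = (\1_[set x | K%:R < W x] : T -> R).
    apply/funext => x; rewrite indicE; congr (_%:R); congr nat_of_bool.
    by apply/idP/idP; rewrite inE.
  apply: measurable_indic.
  by apply: (@measurable_set_ltr _ _ _ (fun=> K%:R)).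
have lt K : L1 P (tail K).
  apply: (L1_le (mt K) lWq) => x; rewrite /tail ger0_norm ?mulr_ge0 ?powR_ge0//.
  by rewrite ler_piMr ?powR_ge0//; case: (_ < _).
have ct : Ex P (tail K) @[K --> \oo] --> 0.
  have := @dominated_cvg _ _ _ P setT measurableT (fun K x => (tail K x)%:E)
    (fun=> 0%E) (fun x => (W x `^ q)%:E).
  rewrite integral0 => h.
  have {}h : (\int[P]_x (tail K x)%:E)%E @[K --> \oo] --> 0%E.
    apply: h => //.
    - by move=> K; exact/measurable_EFinP.
    - move=> x _; apply: cvg_EFin; first exact: nearW.
      apply: cvg_near_cst; exists (Num.truncn (W x)).+1 => // K /= hK.
      rewrite /tail ltNge; suff -> : W x <= K%:R by rewrite mulr0.
      by apply/ltW/(lt_le_trans (truncnS_gt _)); rewrite ler_nat.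
    - by move=> K x _; rewrite lee_fin ger0_norm ?mulr_ge0 ?powR_ge0// ler_piMr ?powR_ge0//; case: (_ < _).
  by apply/fine_cvg; rewrite /=.
have bD n (K : nat) : Ex P (D n) <= Ex P (tail K) + q * K%:R `^ (q - 1) * Ex P (fun x => `|Y n x - W x|).
  have lYW : L1 P (fun x => `|Y n x - W x|) by apply: L1_norm; exact: L1B.
  rewrite -ExZ// -ExD//; last exact: L1Z.
  apply: Ex_le => //; first by apply: L1D => //; exact: L1Z.
  have K0 : 0 <= q * K%:R `^ (q - 1) by rewrite mulr_ge0 ?powR_ge0.
  move=> x; rewrite /D /tail; have [h|h] := ltP K%:R (W x).
    rewrite mulr1 ge_max; have := powR_ge0 (Y n x) q; have := powR_ge0 (W x) q.
    have := mulr_ge0 K0 (normr_ge0 (Y n x - W x)); lra.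
  rewrite mulr0 add0r ge_max mulr_ge0// andbT.
  have := powR_tangent q1 (Y0 n x) (W0 x) => h1.
  apply: (@le_trans _ _ (q * W x `^ (q - 1) * `|Y n x - W x|)).
    have := ler_norm (- (Y n x - W x)); rewrite normrN => h2.
    have qW : 0 <= q * W x `^ (q - 1) by rewrite mulr_ge0 ?powR_ge0.
    by have := ler_wpM2l qW h2; lra.
  rewrite ler_wpM2r// ler_wpM2l//; apply: le_powR => //; lra.
apply/cvgrPdist_le => e e0.
have e4 : 0 < e / 4 by lra.
have [K _ hK] := (cvgrPdist_le _ _).1 ct _ e4.
have := hK K (leqnn K); rewrite /= sub0r normrN => {}hK.
have K1 : 0 < q * K%:R `^ (q - 1) + 1 by rewrite ltr_wpDl// mulr_ge0 ?powR_ge0.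
have e5 : 0 < e / 4 / (q * K%:R `^ (q - 1) + 1) by rewrite divr_gt0.
have h5 := (cvgrPdist_le _ _).1 cYW _ e5.
case: h5 => N0 _ h5; exists N0 => // n Nn; have := h5 n Nn; rewrite /= !sub0r !normrN => hn.
rewrite ger0_norm; last by apply: Ex_ge0 => x; exact: powR_ge0.
apply: le_trans (bq n) _.
have h1 := bD n K; have h2 := le_trans (ler_norm _) hK; have h3 := le_trans (ler_norm _) hn.
have K0 : 0 <= q * K%:R `^ (q - 1) by rewrite mulr_ge0 ?powR_ge0.
have h4 : q * K%:R `^ (q - 1) * Ex P (fun x => `|Y n x - W x|) <= e / 4.
  apply: le_trans (ler_wpM2l K0 h3) _.
  rewrite mulrCA ler_piMr ?(ltW e4)// ler_pdivrMr// mul1r lerDl//.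
lra.
Qed.

End Convergence.

(** * The limit of the martingale *)

Lemma powR_exprn (R : realType) (x p : R) n : 0 <= x -> (x ^+ n) `^ p = (x `^ p) ^+ n.
Proof.
move=> x0; elim: n => [|n IH]; first by rewrite !expr0 powR1.
by rewrite !exprS powRM ?exprn_ge0// IH.
Qed.

Lemma cvg_powR (R : realType) (u : nat -> R) (l q : R) : 1 < q ->
  (forall n, 0 <= u n) -> 0 <= l -> u n @[n --> \oo] --> l ->
  u n `^ q @[n --> \oo] --> l `^ q.
Proof.
move=> q1 u0 l0 ul; have qB : 0 <= q - 1 by lra.
set M := q * (l + 1) `^ (q - 1).
have M0 : 0 <= M by rewrite mulr_ge0 ?powR_ge0//; lra.
have lip x y : 0 <= x -> 0 <= y <= l + 1 -> y `^ q - x `^ q <= M * `|y - x|.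
  move=> x0 /andP[y0 yl]; have := powR_tangent q1 x0 y0 => h.
  have h1 : q * y `^ (q - 1) <= M by rewrite ler_wpM2l ?le_powR//; lra.
  have h2 : 0 <= q * y `^ (q - 1) by rewrite mulr_ge0 ?powR_ge0//; lra.
  have h3 := ler_wpM2l h2 (ler_norm (y - x)).
  have h4 := ler_wpM2r (normr_ge0 (y - x)) h1; lra.
apply/cvgrPdist_le => e e0; have M1 : 0 < M + 1 by lra.
have d0 : 0 < Num.min 1 (e / (M + 1)) by rewrite lt_min ltr01 divr_gt0.
have [k _ hk] := (cvgrPdist_le _ _).1 ul _ d0.
exists k => // n /= kn; have := hk n kn; rewrite /= le_min => /andP[h1 h2].
have ul1 : 0 <= u n <= l + 1.
  by rewrite u0/=; have := ler_norm (- (l - u n)); rewrite normrN; lra.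
have ll1 : 0 <= l <= l + 1 by lra.
have : M * `|l - u n| <= e.
  apply: le_trans (ler_wpM2l M0 h2) _.
  by rewrite mulrCA ler_piMr ?(ltW e0)// ler_pdivrMr// mul1r lerDl.
have := lip _ _ (u0 n) ll1; have := lip _ _ l0 ul1.
rewrite (distrC (u n)) ler_norml; lra.
Qed.

Section MartingaleLimit.
Context (R : realType) (mu : probability nat R) (Q : probability field R) (m : R).
Hypothesis iidQ : iid_field mu Q.
Hypothesis m1 : 1 < m.
Hypothesis L1_root : L1 Q (fun nu => (nu [::])%:R).
Hypothesis Ex_root : Ex Q (fun nu => (nu [::])%:R) = m.
Variable q : R.
Hypothesis q1 : 1 < q.
Hypothesis L1_root_q : L1 Q (fun nu => (nu [::])%:R `^ q).
Implicit Types (D : (seq nat -> nat) -> R).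

Let m0 : 0 < m. Proof. exact: lt_trans m1. Qed.

(** The gain in [L^p] norm when the average over the subtrees hanging from one
    generation is replaced by that over the next: the [p]-th moment of a sum of
    about [m] independent centred copies grows by the factor [m], while that of
    the average is divided by [m `^ p]. *)
Definition decay (p : R) : R := m^-1 `^ ((p - 1) / p).

Lemma decay_itv p : 1 < p -> 0 < decay p < 1.
Proof.
move=> p1; have im0 : 0 < m^-1 by rewrite invr_gt0.
rewrite powR_gt0//=.
suff : decay p < 1 `^ ((p - 1) / p) by rewrite powR1.
apply: gt0_ltr_powR; rewrite ?nnegrE ?(ltW im0)//.
  by rewrite divr_gt0//; lra.
by rewrite invf_lt1.
Qed.

(** From the [p]-th moment in [gensum_moment] to a first moment. *)
Lemma gensum_L1 (p e : R) n D : 1 < p <= 2 -> 0 < e -> local setT D -> L1 Q D ->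
  Ex Q D = 0 -> L1 Q (fun nu => `|D nu| `^ p) ->
  Ex Q (fun nu => `|D nu| `^ p) <= e `^ p ->
  L1 Q (fun nu => m ^- n * gensum n D nu) /\
  Ex Q (fun nu => `|m ^- n * gensum n D nu|) <=
    2 * (2 * p) `^ p^-1 * decay p ^+ n * e.
Proof.
move=> p12 e0 lD l1 ED lp De; have p1 : 1 < p by case/andP: p12.
have p0 : 0 < p by lra. have pn0 : p != 0 by rewrite gt_eqF.
have im0 : 0 < m^-1 by rewrite invr_gt0.
have [lg hg] := gensum_moment iidQ L1_root Ex_root n p12 lD l1 ED lp.
have p2 : 0 < 2 * p by rewrite mulr_gt0.
have p20 := ltW p2.
have d0 : 0 < decay p by case/andP: (decay_itv p1).
have dp : decay p `^ p = m^-1 `^ (p - 1) by rewrite /decay -powRrM divfK.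
have E (nu : field) : `|m ^- n * gensum n D nu| `^ p =
    (m^-1 `^ p) ^+ n * `|gensum n D nu| `^ p.
  rewrite normrM powRM ?normr_ge0// -exprVn ger0_norm ?exprn_ge0 ?(ltW im0)//.
  by rewrite powR_exprn ?(ltW im0).
have e1 : 0 < (2 * p) `^ p^-1 * decay p ^+ n * e.
  by apply: mulr_gt0 e0; apply: mulr_gt0; [exact: powR_gt0|exact: exprn_gt0].
have mg : measurable_fun setT (fun nu : field => m ^- n * gensum n D nu).
  by apply: measurable_local; apply: (@local_comp _ _ _ (fun x => m ^- n * x)); exact: local_gensum.
have [||l h] := L1_of_Lp (P := Q) (ltW p1) e1 mg.
- by apply: (eq_L1 E); exact: L1Z.
- rewrite (eq_Ex _ E) ExZ//.
  apply: le_trans (ler_wpM2l _ hg) _; first by rewrite exprn_ge0 ?powR_ge0.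
  apply: (@le_trans _ _ (2 * p * (m^-1 `^ (p - 1)) ^+ n * e `^ p)).
    rewrite -(mulr_powRB1 (ltW im0) p0) exprMn.
    set x := (m^-1 `^ (p - 1)) ^+ n.
    have -> : m^-1 ^+ n * x * (2 * p * m ^+ n * Ex Q (fun nu => `|D nu| `^ p)) =
       (m^-1 * m) ^+ n * (2 * p * x * Ex Q (fun nu => `|D nu| `^ p)).
      by rewrite exprMn; ring.
    rewrite mulVf ?gt_eqF// expr1n mul1r ler_wpM2l// mulr_ge0// exprn_ge0//.
    exact: powR_ge0.
  have Ap : ((2 * p) `^ p^-1) `^ p = 2 * p by rewrite -powRrM mulVf// powRr1.
  apply: le_of_eq; rewrite -[in LHS]Ap; have := powR_ge0 (2 * p) p^-1.
  set A := _ `^ p^-1 => A0.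
  rewrite !powRM ?mulr_ge0 ?exprn_ge0 ?(ltW e0) ?(ltW d0)//.
  by rewrite powR_exprn ?(ltW d0)// dp.
split => //; apply: le_trans h _; by rewrite !mulrA.
Qed.

Lemma local_root : local setT (fun nu => (nu [::])%:R : R).
Proof. by apply: (@local_comp _ _ _ (fun k : nat => k%:R : R)); exact: local_coord. Qed.

(** The increments of the martingale are generation sums of the centred, normalized
    number of children, so that [gensum_L1] applies to them. *)
Lemma WnB n nu : Wn m n.+1 nu - Wn m n nu =
  m ^- n * gensum n (fun nu => m^-1 * (nu [::])%:R + (-1)) nu.
Proof.
rewrite gensumD gensumZ.
have -> : gensum n (fun=> -1) nu = - (generation_size nu n)%:R :> R.
  by rewrite -gensum1 -[RHS]mulN1r -gensumZ; congr gensum; apply/funext => x; rewrite mulr1.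
have -> : gensum n (fun nu => (nu [::])%:R) nu = (generation_size nu n.+1)%:R :> R.
  by rewrite -gensum1 gensumS; congr gensum; apply/funext => x; rewrite branch1.
rewrite /Wn exprS; have mn : m != 0 by rewrite gt_eqF.
by field; rewrite ?expf_neq0 ?mn.
Qed.

Lemma Wn_increments : exists c rho, [/\ 0 < c, 0 < rho < 1 & forall n,
  Ex Q (fun nu => `|Wn m n.+1 nu - Wn m n nu|) <= c * rho ^+ n].
Proof.
have q1' : 1 < q by exact: q1.
pose p : R := Num.min q 2.
have p12 : 1 < p <= 2 by rewrite /p lt_min ge_min lexx q1' orbT/=; lra.
have p1 : 1 < p by case/andP: p12.
have pq : 0 <= p <= q by rewrite /p ge_min lexx andbT; move: p1; rewrite -/p; lra.
pose D := fun nu : field => m^-1 * (nu [::])%:R + (-1) : R.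
have lD : local setT D.
  by apply: (@local_comp _ _ _ (fun x => m^-1 * x + (-1))); exact: local_root.
have l1 : L1 Q D by apply: L1D; [exact: L1Z|exact: L1_cst].
have ED : Ex Q D = 0.
  by rewrite ExD ?ExZ ?Ex_cst ?Ex_root ?mulVf ?subrr ?gt_eqF//; [exact: L1Z|exact: L1_cst].
have lp : L1 Q (fun nu => `|D nu| `^ p).
  apply: L1_powRD; first lra.
  - exact: L1_measurable (L1Z _ L1_root).
  - exact: measurable_cst.
  - apply: (eq_L1 _ (L1Z (m^-1 `^ p) (L1_root_powR L1_root L1_root_q pq))) => nu.
    have im0 : 0 <= m^-1 by rewrite invr_ge0 ltW.
    by rewrite ger0_norm ?mulr_ge0// powRM.
  - exact: L1_cst.
pose e : R := (1 + Ex Q (fun nu => `|D nu| `^ p)) `^ p^-1.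
have EDp : 0 <= Ex Q (fun nu => `|D nu| `^ p) by apply: Ex_ge0 => nu; exact: powR_ge0.
have e0 : 0 < e by rewrite powR_gt0//; lra.
have De : Ex Q (fun nu => `|D nu| `^ p) <= e `^ p.
  have pn0 : p != 0 by rewrite gt_eqF//; lra.
  by rewrite /e -powRrM mulVf// powRr1; lra.
exists (2 * (2 * p) `^ p^-1 * e), (decay p); split.
- by rewrite !mulr_gt0 ?powR_gt0//; lra.
- exact: decay_itv.
move=> n; have [_ h] := gensum_L1 n p12 e0 lD l1 ED lp De.
rewrite mulrAC; apply: le_trans h; apply: le_of_eq; apply: eq_Ex => nu.
by rewrite WnB.
Qed.

Definition Winf nu : R := limn (Wn m ^~ nu).

Lemma Wn_cvg_ae : {ae Q, forall nu, cvgn (Wn m ^~ nu)}.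
Proof.
have [c [rho [c0 r01 H]]] := Wn_increments.
exact: (geometric_increments_ae (L1_Wn iidQ L1_root Ex_root) c0 r01 H).
Qed.

Lemma Wn_cvg_L1 : L1 Q Winf /\ Ex Q (fun nu => `|Wn m n nu - Winf nu|) @[n --> \oo] --> 0.
Proof.
have [c [rho [c0 r01 H]]] := Wn_increments.
have [l h] := geometric_increments_L1 (L1_Wn iidQ L1_root Ex_root) c0 r01 H.
split; first exact: l.
have r1 : `|rho| < 1 by case/andP: r01 => r0 r1; rewrite ger0_norm// ltW.
apply: (@squeeze_cvgr _ _ _ _ (fun=> 0) (geometric (c / (1 - rho)) rho)).
- by apply: nearW => n; rewrite h andbT; apply: Ex_ge0 => nu.
- exact: cvg_cst.
- exact: cvg_geometric.
Qed.

Lemma measurable_Winf : measurable_fun setT (Winf : field -> R).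
Proof. by have [l _] := Wn_cvg_L1; exact: L1_measurable l. Qed.

Lemma Winf_ge0 nu : 0 <= Winf nu.
Proof.
rewrite /Winf; have [h|h] := pselect (cvgn (Wn m ^~ nu)).
  by apply: limr_ge => //; apply: nearW => n; exact: (Wn_ge0 m1).
by rewrite dvgP.
Qed.

Lemma L1_Winf_q : L1 Q (fun nu => Winf nu `^ q).
Proof.
have qq : 0 <= q <= q by rewrite lexx andbT; apply/ltW/(lt_trans _ q1).
have [C hC] := Wn_moment iidQ m1 L1_root Ex_root L1_root_q qq.
have [] := @Ex_fatou _ _ _ Q (fun n nu => Wn m n nu `^ q) (fun nu => Winf nu `^ q) C => //.
- by move=> n; apply: L1_measurable; have [l _] := hC n; exact: l.
- by apply: measurable_fun_powR; exact: measurable_Winf.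
- by move=> n nu; exact: powR_ge0.
- by move=> nu; exact: powR_ge0.
- apply: ae_imply Wn_cvg_ae => nu h.
  by apply: cvg_powR => //; [move=> n; exact: Wn_ge0|exact: Winf_ge0].
- by apply: nearW => n; exact: hC.
Qed.

(** The martingale property, tested against bounded functions of the first
    generations. *)
Lemma Wn_martingale n k (h : R -> R) M : (forall x, 0 <= h x <= M) ->
  L1 Q (fun nu => h (Wn m n nu) * Wn m (n + k)%N nu) /\
  Ex Q (fun nu => h (Wn m n nu) * Wn m (n + k)%N nu) =
  Ex Q (fun nu => h (Wn m n nu) * Wn m n nu).
Proof.
move=> hM.
have lh j : L1 Q (fun nu => h (Wn m n nu) * Wn m j nu).
  apply: (@L1_le _ _ _ Q _ (fun nu => M * Wn m j nu)).
  - apply: measurable_local; apply: local_comp2; last exact: local_Wn.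
    by apply: local_comp; exact: local_Wn.
  - by apply: L1Z; exact: (L1_Wn iidQ L1_root Ex_root).
  - move=> nu; have /andP[h0 h1] := hM (Wn m n nu).
    rewrite ger0_norm; first by apply: ler_wpM2r => //; exact: (Wn_ge0 m1).
    by apply: mulr_ge0 => //; exact: (Wn_ge0 m1).
split => //; elim: k => [|k IH]; first by rewrite addn0.
rewrite -IH addnS; set j := (n + k)%N.
pose hh (L : seq (seq nat)) := h ((size L)%:R / m ^+ n).
pose F (K : seq (seq nat) * seq (seq nat)) (nu : field) : R :=
  hh K.1 * (m ^- j.+1 * \sum_(u <- K.2) (subtree u nu [::])%:R).
pose phi (K : seq (seq nat) * seq (seq nat)) : R := hh K.1 * ((size K.2)%:R / m ^+ j).
have hh0 L : 0 <= hh L by case/andP: (hM ((size L)%:R / m ^+ n)).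
have [|||||||_ e] := @Ex_cond_eq _ _ _ iidQ _ [set u | (size u < j)%N]
  [set u | (j <= size u)%N] (fun nu => (generation nu n, generation nu j)) F phi.
- exact: sizes_disjoint.
- apply: local_comp2; last exact: local_generation.
  apply: local_sub (@local_generation n) => u /= /leq_trans; apply.
  exact: leq_addr.
- move=> nu; apply: (@local_gensum_cond _ j nu (fun nu => (nu [::])%:R) (fun x => hh (generation nu n) * (m ^- j.+1 * x))).
  exact: local_root.
- move=> nu nu'; rewrite /F mulr_ge0// mulr_ge0 ?invr_ge0 ?exprn_ge0 ?(ltW m0)//.
  by apply: sumr_ge0.
- by move=> nu; apply: L1Z; apply: L1Z; exact: (L1_sum_subtree iidQ _ L1_root).
- move=> nu; have l := L1_sum_subtree iidQ (generation nu j) L1_root.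
  rewrite ExZ; last exact: L1Z.
  rewrite ExZ// (Ex_sum_subtree iidQ _ L1_root) Ex_root /phi /=; congr (_ * _).
  have mn : m != 0 by rewrite gt_eqF.
  by rewrite exprS; field; rewrite ?expf_neq0 ?mn.
- exact: (lh j).
rewrite -[RHS]e; apply: eq_Ex => nu; congr (_ * _).
rewrite /Wn mulrC; congr (_ * _).
by rewrite -gensum1 gensumS; apply: eq_bigr => u _; rewrite branch1.
Qed.

(** Let [k] go to infinity in [Wn_martingale]. *)
Lemma Wn_Winf_test n (h : R -> R) M : (forall x, 0 <= h x <= M) ->
  measurable_fun setT h ->
  L1 Q (fun nu => h (Wn m n nu) * Winf nu) /\
  Ex Q (fun nu => h (Wn m n nu) * Winf nu) =
  Ex Q (fun nu => h (Wn m n nu) * Wn m n nu).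
Proof.
move=> hM mh; have [lW cW] := Wn_cvg_L1.
have lWn := L1_Wn iidQ L1_root Ex_root.
have mhW : measurable_fun setT (fun nu : field => h (Wn m n nu)).
  by apply: measurable_local; apply: local_comp; exact: local_Wn.
have M0 : 0 <= M by case/andP: (hM 0); exact: le_trans.
have lh : L1 Q (fun nu => h (Wn m n nu) * Winf nu).
  apply: (L1_le _ (L1Z M lW)).
    by apply: measurable_funM => //; exact: measurable_Winf.
  move=> nu; have /andP[h0 h1] := hM (Wn m n nu).
  by rewrite ger0_norm ?mulr_ge0 ?Winf_ge0// ler_wpM2r ?Winf_ge0.
split => //; apply/eqP; rewrite -subr_eq0 -normr_le0.
apply/ler_addgt0Pr => e e0; rewrite add0r.
have M1 : 0 < M + 1 by lra.
have e1 : 0 < e / (M + 1) by rewrite divr_gt0.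
have [k0 _ hk] := (cvgrPdist_le _ _).1 cW _ e1.
have := hk (n + k0)%N (leq_addl _ _); rewrite /= sub0r normrN => {}hk.
have [lk ek] := Wn_martingale n k0 hM.
rewrite -ek -ExB//; apply: le_trans (Ex_le_norm (L1B lh lk)) _.
have lN : L1 Q (fun nu => `|Wn m (n + k0)%N nu - Winf nu|) by apply: L1_norm; exact: L1B.
apply: le_trans (Ex_le (L1_norm (L1B lh lk)) (L1Z M lN) _) _.
  move=> nu; rewrite -mulrBr normrM distrC ler_wpM2r//.
  by have /andP[h0 h1] := hM (Wn m n nu); rewrite ger0_norm.
rewrite ExZ//; have := le_trans (ler_norm _) hk => h1.
apply: le_trans (ler_wpM2l M0 h1) _.
by rewrite mulrCA ler_piMr ?(ltW e0)// ler_pdivrMr// mul1r lerDl.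
Qed.

(** Take the tangent to the power at [Num.min (Wn m n nu) K%:R]: its slope is a
    bounded function of [Wn m n nu], against which [Wn m n nu] and [Winf nu] have
    the same mean. Fatou's lemma removes the truncation at [K]. *)
Lemma Ex_Wn_powR_le n : Ex Q (fun nu => Wn m n nu `^ q) <= Ex Q (fun nu => Winf nu `^ q).
Proof.
have q1' : 1 < q by exact: q1.
have q0 : 0 < q by lra. have qB0 : 0 <= q - 1 by lra.
pose c (K : nat) nu := Num.min (Wn m n nu) K%:R.
have c0 K nu : 0 <= c K nu by rewrite /c le_min (Wn_ge0 m1) ?ler0n.
have lc K : local setT (c K).
  by apply: (@local_comp _ _ _ (fun x => Num.min x K%:R)); exact: local_Wn.
have cK K nu : c K nu <= K%:R by rewrite /c ge_min lexx orbT.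
have cW K nu : c K nu <= Wn m n nu by rewrite /c ge_min lexx.
have lcq K : L1 Q (fun nu => c K nu `^ q).
  apply: (@L1_le _ _ _ Q _ (fun=> K%:R `^ q)); [|exact: L1_cst|].
    by apply: measurable_fun_powR; exact: measurable_local.
  by move=> nu; rewrite ger0_norm ?powR_ge0// le_powR// ltW.
have lWn := L1_Wn iidQ L1_root Ex_root.
have b K : Ex Q (fun nu => c K nu `^ q) <= Ex Q (fun nu => Winf nu `^ q).
  pose h x : R := Num.max 0 (Num.min x K%:R) `^ (q - 1).
  have hE nu : h (Wn m n nu) = c K nu `^ (q - 1) by rewrite /h max_r; [|exact: c0].
  have hM x : 0 <= h x <= K%:R `^ (q - 1).
    rewrite /h powR_ge0/= le_powR// ?le_max ?lexx//.
    by rewrite ge_max ler0n ge_min lexx orbT.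
  have mh : measurable_fun setT h.
    apply: measurable_fun_powR; apply: measurable_maxr; first exact: measurable_cst.
    by apply: measurable_minr; [exact: measurable_id|exact: measurable_cst].
  have [l1 e1] := Wn_Winf_test n hM mh.
  have [l2 _] := Wn_martingale n 0 hM; rewrite addn0 in l2.
  have lB := L1Z q (L1B l1 l2).
  have -> : Ex Q (fun nu => c K nu `^ q) = Ex Q (fun nu => c K nu `^ q +
     q * (h (Wn m n nu) * Winf nu - h (Wn m n nu) * Wn m n nu)).
    by rewrite ExD// ExZ ?ExB// ?e1 ?subrr ?mulr0 ?addr0//; exact: L1B.
  apply: Ex_le; [exact: L1D|exact: L1_Winf_q|].
  move=> nu; have := powR_tangent q1' (Winf_ge0 nu) (c0 K nu).
  rewrite hE => t; apply: le_trans t.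
  have := mulr_ge0 (ltW q0) (mulr_ge0 (powR_ge0 (c K nu) (q - 1)) (_ : 0 <= Wn m n nu - c K nu)).
  by rewrite subr_ge0 => /(_ (cW K nu)); lra.
have [] // := @Ex_fatou _ _ _ Q (fun K nu => c K nu `^ q) (fun nu => Wn m n nu `^ q) (Ex Q (fun nu => Winf nu `^ q)).
- by move=> K; exact: L1_measurable (lcq K).
- by apply: measurable_fun_powR; apply: measurable_local; exact: local_Wn.
- by move=> K nu; exact: powR_ge0.
- by move=> nu; exact: powR_ge0.
- apply: aeW => nu; apply: cvg_near_cst.
  exists (Num.truncn (Wn m n nu)).+1 => // K /= hK.
  rewrite /c min_l//; apply/ltW/(lt_le_trans (truncnS_gt _)).
  by rewrite ler_nat.
- by apply: nearW => K.
Qed.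

End MartingaleLimit.

(** * Concave response functions *)

Section ConcaveFunctions.
Context (R : realType) (g : R -> R).

Lemma concave_onP : concave_on_nonneg g -> forall t x y, 0 <= t <= 1 -> 0 <= x -> 0 <= y ->
  t * g x + (1 - t) * g y <= g (t * x + (1 - t) * y).
Proof.
move=> cg t x y /andP[t0 t1] x0 y0.
have xD : (x : R^o) \in (`[0, +oo[%classic : set R^o) by rewrite inE/= in_itv/= x0.
have yD : (y : R^o) \in (`[0, +oo[%classic : set R^o) by rewrite inE/= in_itv/= y0.
have h : - g (t * x + (1 - t) * y) <= t * - g x + (1 - t) * - g y.
  exact: (cg (Itv01 t0 t1) x y xD yD).
lra.
Qed.

Hypothesis g_ge0 : forall x, 0 <= x -> 0 <= g x.
Hypothesis cg : forall t x y, 0 <= t <= 1 -> 0 <= x -> 0 <= y ->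
  t * g x + (1 - t) * g y <= g (t * x + (1 - t) * y).

(** Concavity between 0 and [y], together with [0 <= g 0]. *)
Lemma concave_ratio x y : 0 < x -> x <= y -> g y * x <= g x * y.
Proof.
move=> x0 xy; have y0 : 0 < y by exact: lt_le_trans xy.
have t01 : 0 <= x / y <= 1 by rewrite divr_ge0 ?(ltW x0) ?(ltW y0)//= ler_pdivrMr ?mul1r.
have := cg t01 (ltW y0) (lexx 0); rewrite mulr0 addr0 divfK ?gt_eqF// => h.
have h0 : 0 <= (1 - x / y) * g 0 by rewrite mulr_ge0 ?g_ge0//; lra.
have h1 : x / y * g y <= g x by lra.
have := ler_wpM2r (ltW y0) h1.
by rewrite mulrAC divfK ?gt_eqF// mulrC.
Qed.

(** Were [g] to decrease somewhere, concavity would make it negative far away. *)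
Lemma concave_nondecreasing x y : 0 <= x -> x <= y -> g x <= g y.
Proof.
move=> x0; rewrite le_eqVlt => /orP[/eqP->//|xy].
apply/ler_addgt0Pr => e e0.
have gx0 := g_ge0 x0.
(* so far away that the chord from [x] to [z] loses at most [e] between [x] and [y] *)
pose z := y + (y - x) * (g x + 1) / e.
have d0 : 0 < (y - x) * (g x + 1) / e by rewrite divr_gt0// mulr_gt0; lra.
have zy : y < z by rewrite /z; lra.
have zx0 : 0 < z - x by lra.
pose t := (z - y) / (z - x).
have t01 : 0 <= t <= 1 by rewrite /t divr_ge0 ?ler_pdivrMr//; lra.
have z0 : 0 <= z by lra.
have := cg t01 x0 z0.
have -> : t * x + (1 - t) * z = y by rewrite /t; field; rewrite gt_eqF.
have tz : 0 <= (1 - t) * g z by rewrite mulr_ge0 ?g_ge0//; lra.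
suff : (1 - t) * g x <= e by lra.
have -> : 1 - t = (y - x) / (z - x) by rewrite /t; field; rewrite gt_eqF.
rewrite mulrAC ler_pdivrMr//.
have h : (y - x) * (g x + 1) = e * (z - y).
  by rewrite /z; field; rewrite gt_eqF.
nra.
Qed.

End ConcaveFunctions.

(** The properties of [g] from which everything follows, with [gM] standing for
    the value at infinity. That [g x / x] is nonincreasing is what remains of
    concavity, and [resp_small] says how fast [g x / x] tends to 1 at 0. *)
Record response (R : realType) (theta : R) (g : R -> R) (gM gC : R) : Prop := Response {
  resp_ge0 : forall x, 0 <= x -> 0 <= g x;
  resp0 : g 0 = 0;
  resp_gt0 : forall x, 0 < x -> 0 < g x;
  resp_mono : forall x y, 0 <= x -> x <= y -> g x <= g y;
  resp_ratio : forall x y, 0 < x -> x <= y -> g y * x <= g x * y;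
  resp_le : forall x, 0 <= x -> g x <= x;
  resp_lt : forall x, 0 < x -> g x < x;
  resp_top : forall x, 0 <= x -> g x <= gM;
  resp_top_gt0 : 0 < gM;
  resp_C : 0 < gC;
  resp_small : forall x, 0 <= x -> x - g x <= gC * x `^ (1 + theta) }.

Section ResponseOfBounds.
Context (R : realType) (s k1 k2 : R) (g : R -> R).
Hypothesis s0 : 0 < s.
Hypotheses (k10 : 0 < k1) (k20 : 0 < k2).
Hypothesis g_ge0 : forall x, 0 <= x -> 0 <= g x.
Hypothesis cg : concave_on_nonneg g.
Hypothesis bg : [bounded g x | x in `[0, +oo[%classic].
Hypothesis gb : forall x, 0 < x ->
     x / (1 + k1 * x `^ s) `^ (s^-1) <= g x
       <= x / (1 + k2 * x `^ s) `^ (s^-1).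

Lemma bernoulli_powR (y a : R) : 0 <= y -> 0 <= a -> 1 - a * y <= (1 + y) `^ (- a).
Proof.
move=> y0 a0; rewrite /powR gt_eqF; last by lra.
apply: le_trans (expR_ge1Dx _); rewrite mulNr lerD2l lerN2 ler_wpM2l//.
by apply: le_trans (le_ln1Dx _) _ => //; lra.
Qed.

(** For [resp_small], Bernoulli's inequality applies to the lower bound when
    [x <= 1], and [x - g x <= x] suffices beyond. *)
Lemma response_of_bounds theta : 0 < theta <= s ->
  response theta g (extend_pinfty g +oo%E) (1 + k1 / s).
Proof.
have s0' : 0 < s by exact: s0.
have k10' : 0 < k1 by exact: k10.
have k20' : 0 < k2 by exact: k20.
have is0 : 0 < s^-1 by rewrite invr_gt0.
move=> /andP[th0 ths].
have c := concave_onP cg.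
have mono := concave_nondecreasing g_ge0 c.
have den k x : 0 < k -> 0 < x -> 1 < (1 + k * x `^ s) `^ s^-1.
  move=> kk0 x0; have h : 0 < k * x `^ s by rewrite mulr_gt0 ?powR_gt0.
  suff : 1 `^ s^-1 < (1 + k * x `^ s) `^ s^-1 by rewrite powR1.
  by apply: gt0_ltr_powR; rewrite ?nnegrE//; lra.
have lt x : 0 < x -> g x < x.
  move=> x0; have /andP[_ h] := gb x0; apply: le_lt_trans h _.
  have h := den k2 x k20' x0.
  by rewrite ltr_pdivrMr ?ltr_pMr//; exact: lt_trans h.
have gt0 x : 0 < x -> 0 < g x.
  move=> x0; have /andP[h _] := gb x0; apply: lt_le_trans h.
  by rewrite divr_gt0// (lt_trans _ (den k1 x k10' x0)).
have g00 : g 0 = 0.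
  apply/eqP; rewrite eq_le g_ge0// andbT; apply/ler_addgt0Pr => e e0.
  pose x := Num.min 2^-1 (e / 2).
  have x0 : 0 < x by rewrite /x lt_min; apply/andP; split; lra.
  have x2 : x <= 2^-1 by rewrite /x ge_min lexx.
  have xe : x <= e / 2 by rewrite /x ge_min lexx orbT.
  have x01 : 0 <= x <= 1 by lra.
  have := c x 1 0 x01 ler01 (lexx 0); rewrite mulr1 mulr0 addr0 => h.
  have h1 := lt x x0; have h2 := gt0 1 ltr01; have h3 := g_ge0 (lexx 0).
  have h4 : 0 <= x * g 1 by rewrite mulr_ge0// ltW.
  nra.
have [M [_ hM]] := bg.
have bM x : 0 <= x -> g x <= M + 1.
  have M1 : M < M + 1 by rewrite ltrDl.
  move=> x0; have := hM (M + 1) M1 x.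
  by rewrite /= in_itv/= x0 => /(_ isT); exact: le_trans (ler_norm _).
pose gp x := g (Num.max x 0).
have gpn : {homo gp : x y / x <= y}.
  move=> x y xy; apply: mono; first by rewrite le_max lexx orbT.
  by rewrite ge_max !le_max xy lexx orbT.
have ubp : has_ubound (range gp).
  by exists (M + 1) => _ [x _ <-]; apply: bM; rewrite le_max lexx orbT.
have cv : gp x @[x --> +oo] --> sup (range gp) by exact: nondecreasing_cvgr.
have cv' : g x @[x --> +oo] --> sup (range gp).
  apply: cvg_trans cv; apply: near_eq_cvg; near=> x.
  rewrite /gp max_l//; near: x; exact: nbhs_pinfty_ge.
have eM : extend_pinfty g +oo%E = sup (range gp) by rewrite /=; exact/cvg_lim.
have top x : 0 <= x -> g x <= extend_pinfty g +oo%E.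
  move=> x0; rewrite eM; apply: ub_le_sup => //; exists x => //.
  by rewrite /gp max_l.
split => //.
- move=> x y; exact: concave_ratio.
- by move=> x; rewrite le_eqVlt => /orP[/eqP<-|/lt/ltW//]; rewrite g00.
- exact: lt_le_trans (gt0 1 ltr01) (top 1 ler01).
- by rewrite addr_gt0// divr_gt0.
move=> x; rewrite le_eqVlt => /orP[/eqP<-|x0].
  by rewrite g00 subrr mulr_ge0 ?powR_ge0// addr_ge0// divr_ge0// ltW.
have k1s : 0 < k1 / s by rewrite divr_gt0.
have P0 : 0 < x `^ (1 + theta) by exact: powR_gt0.
have [x1|x1] := leP 1 x.
  have : x <= x `^ (1 + theta) by apply: le1r_powR => //; lra.
  have := gt0 x x0; nra.
have /andP[h _] := gb x0.
have xs0 : 0 <= k1 * x `^ s by rewrite mulr_ge0 ?powR_ge0// ltW.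
have := bernoulli_powR xs0 (ltW is0); rewrite powRN => b.
have b' := ler_wpM2l (ltW x0) b.
have E : x * (1 - s^-1 * (k1 * x `^ s)) = x - k1 / s * (x * x `^ s) by ring.
rewrite E in b'.
have xx : x * x `^ s <= x `^ (1 + theta).
  have -> : x * x `^ s = x `^ (1 + s).
    rewrite -[RHS](mulr_powRB1 (ltW x0)); last lra.
    by rewrite [1 + s]addrC addrK.
  by apply: ger_powR; [rewrite x0 ltW|rewrite lerD2l].
have := ler_wpM2l (ltW k1s) xx; lra.
Unshelve. all: by end_near. Qed.

End ResponseOfBounds.

(** * The recursion and the convex order *)

(** The value at the root of the tree truncated at height [n.+1]. The boundary value
    is infinite, so that the recursion starts at height 1, where every child
    responds with the limit [gM] of [g]. *)
Fixpoint root_value (R : realType) (g : R -> R) (gM r : R) (n : nat) (nu : seq nat -> nat) : R :=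
  if n is n'.+1 then r * branch (fun nu => g (root_value g gM r n' nu)) nu
  else r * gM * (nu [::])%:R.

Section ConvexOrder.
Context (R : realType) (mu : probability nat R) (Q : probability field R) (m : R).
Hypothesis iidQ : iid_field mu Q.
Hypothesis m1 : 1 < m.
Hypothesis L1_root : L1 Q (fun nu => (nu [::])%:R).
Hypothesis Ex_root : Ex Q (fun nu => (nu [::])%:R) = m.
Variable q : R.
Hypothesis q1 : 1 < q.
Hypothesis L1_root_q : L1 Q (fun nu => (nu [::])%:R `^ q).
Variables (g : R -> R) (theta gM gC : R).
Hypothesis gP : response theta g gM gC.
Implicit Types (D X C : (seq nat -> nat) -> R) (S : set (seq nat)) (u v : seq nat).

Let m0 : 0 < m. Proof. exact: lt_trans m1. Qed.
Let q0 : 0 < q. Proof. exact: lt_trans q1. Qed.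

Lemma ge0_L1_powRD (f h : field -> R) : (forall x, 0 <= f x) -> (forall x, 0 <= h x) ->
  measurable_fun setT f -> measurable_fun setT h ->
  L1 Q (fun x => f x `^ q) -> L1 Q (fun x => h x `^ q) ->
  L1 Q (fun x => (f x + h x) `^ q).
Proof.
move=> f0 h0 mf mh lf lh.
apply: (eq_L1 (g := fun x => `|f x + h x| `^ q)) => [x|].
  by rewrite ger0_norm// addr_ge0.
apply: L1_powRD => //; first exact: ltW.
  by apply: (eq_L1 _ lf) => x; rewrite ger0_norm.
by apply: (eq_L1 _ lh) => x; rewrite ger0_norm.
Qed.

Lemma L1_powR_le_fun (f h : field -> R) : (forall x, 0 <= f x <= h x) ->
  measurable_fun setT f -> L1 Q (fun x => h x `^ q) -> L1 Q (fun x => f x `^ q).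
Proof.
move=> fh mf lh; apply: (L1_le (measurable_fun_powR _ mf) lh) => x.
have /andP[f0 fx] := fh x.
by rewrite ger0_norm ?powR_ge0// le_powR// ltW.
Qed.

(** As [g x / x] is nonincreasing, [g X / E (g X)] and [X / E X] cross only once as
    functions of [X], the former being the larger one before the crossing. They
    have the same mean, so that comparing both with the tangent to the power at
    the crossing value [y0] orders their [q]-th moments. Adding an independent [C]
    shifts the point at which the tangent is taken, and nothing else. *)
Lemma concave_convex_order X C S u beta : local setT X -> (forall nu, 0 <= X nu) ->
  L1 Q X -> L1 Q (fun nu => X nu `^ q) -> 0 < Ex Q X -> 0 < Ex Q (fun nu => g (X nu)) ->
  local S C -> (forall v, S v -> ~ below u v) -> (forall nu, 0 <= C nu) ->
  measurable_fun setT (C : field -> R) ->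
  L1 Q (fun nu => C nu `^ q) -> 0 <= beta ->
  Ex Q (fun nu => (C nu + beta * (g (X (subtree u nu)) / Ex Q (fun nu => g (X nu)))) `^ q) <=
  Ex Q (fun nu => (C nu + beta * (X (subtree u nu) / Ex Q X)) `^ q).
Proof.
move=> lX X0 l1X lqX; set a := Ex Q X; set b := Ex Q _ => a0 b0 lC Su C0 mC lqC beta0.
have q1' : 1 < q by exact: q1.
have q0' : 0 < q by exact: q0.
have qB0 : 0 <= q - 1 by lra. have qq : 0 <= q - 1 <= q by lra.
pose l x := beta * (x / a); pose h x := beta * (g x / b).
have l0 x : 0 <= x -> 0 <= l x by move=> x0; rewrite /l mulr_ge0// divr_ge0// ltW.
have h0 x : 0 <= x -> 0 <= h x.
  by move=> x0; rewrite /h mulr_ge0// divr_ge0 ?(resp_ge0 gP)// ltW.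
have hle x : 0 <= x -> h x <= beta * (gM / b).
  by move=> x0; rewrite /h ler_wpM2l// ler_wpM2r ?(resp_top gP)// invr_ge0 ltW.
(* the values of [h] before the crossing; 0 keeps the set nonempty *)
pose A := [set z | z = 0 \/ exists x, [/\ 0 <= x, l x < h x & z = h x]].
have supA : has_sup A.
  split; first by exists 0; left.
  exists (beta * (gM / b)) => z [->|[x [x0 _ ->]]]; last exact: hle.
  by rewrite mulr_ge0// divr_ge0 ?(ltW b0)// ltW// (resp_top_gt0 gP).
pose y0 := sup A.
have y00 : 0 <= y0 by apply: ub_le_sup; [exact: supA.2|left].
have up x : 0 <= x -> l x < h x -> h x <= y0.
  by move=> x0 lh; apply: ub_le_sup; [exact: supA.2|right; exists x].
have down x : 0 <= x -> h x < l x -> y0 <= h x.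
  move=> x0 hl; apply: ge_sup; first exact: supA.1.
  move=> z [->|[x' [x'0 lh' ->]]]; first exact: h0.
  have beta1 : 0 < beta.
    rewrite lt_neqAle beta0 andbT; apply/eqP => E.
    by move: lh'; rewrite /l /h -E !mul0r ltxx.
  rewrite /h ler_wpM2l// ler_wpM2r ?invr_ge0 ?(ltW b0)//.
  apply: (resp_mono gP) => //; rewrite leNgt; apply/negP => xx'.
  have x1 : 0 < x.
    rewrite lt_neqAle x0 andbT; apply/eqP => E.
    by move: hl; rewrite /l /h -E (resp0 gP) !mul0r !mulr0 ltxx.
  have := resp_ratio gP x1 (ltW xx').
  move: lh' hl; rewrite /l /h !ltr_pM2l// ltr_pdivrMr// mulrAC ltr_pdivlMr//.
  move=> h1; rewrite ltr_pdivrMr// mulrAC ltr_pdivlMr// => h2 h3.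
  have x'1 : 0 < x' by exact: lt_trans xx'.
  (* [x' b < a g x'] and [a g x < x b] contradict the ratio monotonicity *)
  have h4 : x' * b * x < g x' * a * x by rewrite ltr_pM2r.
  have h5 : g x * a * x' < x * b * x' by rewrite ltr_pM2r.
  have h6 : g x' * x * a <= g x * x' * a by rewrite ler_pM2r.
  lra.
pose Xu nu := X (subtree u nu).
have lXu : local (below u) Xu by exact: local_subtree.
have l1Xu : L1 Q Xu by exact: (L1_subtree iidQ u l1X).
have lqXu : L1 Q (fun nu => Xu nu `^ q) by exact: (L1_subtree iidQ u lqX).
have mXu : measurable_fun setT (Xu : field -> R) by exact: L1_measurable l1Xu.
have mlX : measurable_fun setT (fun nu : field => l (Xu nu)).
  by apply: measurable_local; apply: local_comp; exact: local_setT lXu.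
have mhX : measurable_fun setT (fun nu : field => h (Xu nu)).
  by apply: measurable_local; apply: local_comp; exact: local_setT lXu.
have lhX : local (below u) (fun nu => l (Xu nu) - h (Xu nu)).
  exact: (local_comp (fun x => l x - h x)).
have L1l : L1 Q (fun nu => l (Xu nu)).
  by apply: (eq_L1 _ (L1Z (beta / a) l1Xu)) => nu; rewrite /l mulrA mulrAC.
have mgX : measurable_fun setT (fun nu : field => g (X nu)).
  by apply: measurable_local; exact: local_comp.
have L1g : L1 Q (fun nu => g (X nu)).
  by apply: (L1_le mgX l1X) => nu; rewrite ger0_norm ?(resp_ge0 gP) ?(resp_le gP).
have L1gu : L1 Q (fun nu => g (Xu nu)) by exact: (L1_subtree iidQ u L1g).
have L1h : L1 Q (fun nu => h (Xu nu)).
  by apply: (eq_L1 _ (L1Z (beta / b) L1gu)) => nu; rewrite /h mulrA mulrAC.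
have El : Ex Q (fun nu => l (Xu nu)) = beta.
  rewrite (eq_Ex _ (g := fun nu : field => beta / a * Xu nu)); last first.
    by move=> nu; rewrite /l mulrA mulrAC.
  by rewrite ExZ// (Ex_subtree iidQ u l1X) divfK// gt_eqF.
have Eh : Ex Q (fun nu => h (Xu nu)) = beta.
  rewrite (eq_Ex _ (g := fun nu : field => beta / b * g (Xu nu))); last first.
    by move=> nu; rewrite /h mulrA mulrAC.
  by rewrite ExZ// (Ex_subtree iidQ u L1g) divfK// gt_eqF.
have Ll : L1 Q (fun nu => (C nu + l (Xu nu)) `^ q).
  apply: ge0_L1_powRD => //; first by move=> nu; apply: l0; exact: X0.
  apply: (eq_L1 _ (L1Z ((beta / a) `^ q) lqXu)) => nu.
  by rewrite -powRM ?divr_ge0 ?(ltW a0) ?X0// /l mulrA mulrAC.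
have Lhq : L1 Q (fun nu => h (Xu nu) `^ q).
  apply: (@L1_le _ _ _ Q _ (fun=> (beta * (gM / b)) `^ q)); [exact: measurable_fun_powR|exact: L1_cst|].
  by move=> nu; rewrite ger0_norm ?powR_ge0// le_powR ?(ltW q0')// ?h0 ?hle//; exact: X0.
have Lh : L1 Q (fun nu => (C nu + h (Xu nu)) `^ q).
  by apply: ge0_L1_powRD => // nu; apply: h0; exact: X0.
have LCy : L1 Q (fun nu => (C nu + y0) `^ (q - 1)).
  have Lq : L1 Q (fun nu => (C nu + y0) `^ q).
    by apply: ge0_L1_powRD => //; exact: L1_cst.
  have mCy : measurable_fun setT (fun nu : field => C nu + y0) by exact: measurable_funD.
  by have [] := L1_powR_le qq mCy (fun nu => addr_ge0 (C0 nu) y00) Lq.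
have ind : indep Q (fun nu => (C nu + y0) `^ (q - 1)) (fun nu => l (Xu nu) - h (Xu nu)).
  apply: (local_indep iidQ Su) => //.
  exact: (local_comp (fun x => (x + y0) `^ (q - 1))).
have L1d := L1B L1l L1h.
have LM := L1M_indep LCy L1d ind.
have EM : Ex Q (fun nu => (C nu + y0) `^ (q - 1) * (l (Xu nu) - h (Xu nu))) = 0.
  by rewrite ExM_indep// ExB// El Eh subrr mulr0.
have -> : Ex Q (fun nu => (C nu + beta * (g (X (subtree u nu)) / b)) `^ q) =
   Ex Q (fun nu => (C nu + h (Xu nu)) `^ q + q * ((C nu + y0) `^ (q - 1) * (l (Xu nu) - h (Xu nu)))).
  by rewrite (ExD Lh (L1Z q LM)) (ExZ q LM) EM mulr0 addr0.
apply: Ex_le; [by apply: L1D => //; exact: L1Z|exact: Ll|].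
move=> nu; have Xu0 : 0 <= Xu nu by exact: X0.
rewrite -/(l (Xu nu)).
have t := powR_tangent q1' (addr_ge0 (C0 nu) (l0 _ Xu0)) (addr_ge0 (C0 nu) (h0 _ Xu0)).
apply: le_trans t; rewrite lerD2l -mulrA ler_wpM2l ?(ltW q0')//.
have -> : C nu + l (Xu nu) - (C nu + h (Xu nu)) = l (Xu nu) - h (Xu nu) by ring.
have [lh|hl|->] := ltgtP (l (Xu nu)) (h (Xu nu)); last by rewrite subrr !mulr0.
  apply: ler_wnM2r; first by rewrite subr_le0 ltW.
  by apply: le_powR => //; [exact: addr_ge0 (C0 nu) (h0 _ Xu0)|rewrite lerD2l up].
apply: ler_wpM2r; first by rewrite subr_ge0 ltW.
by apply: le_powR => //; [exact: addr_ge0|rewrite lerD2l down].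
Qed.

Lemma Ex_cond_compare (V : countType) S1 S2 (K : (seq nat -> nat) -> V)
    (F F' : V -> (seq nat -> nat) -> R) : (forall w, S1 w -> ~ S2 w) ->
  local S1 K -> (forall nu, local S2 (F (K nu))) -> (forall nu, local S2 (F' (K nu))) ->
  (forall nu nu', 0 <= F (K nu) nu') -> (forall nu nu', 0 <= F' (K nu) nu') ->
  (forall nu, L1 Q (F (K nu))) -> (forall nu, L1 Q (F' (K nu))) ->
  (forall nu, Ex Q (F (K nu)) <= Ex Q (F' (K nu))) ->
  L1 Q (fun nu => F' (K nu) nu) ->
  Ex Q (fun nu => F (K nu) nu) <= Ex Q (fun nu => F' (K nu) nu).
Proof.
move=> S12 lK lF lF' F0 F'0 L1F L1F' FF' L1'.
pose phi (k : V) := Ex Q (F' k).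
have E := integral_cond iidQ S12 lK lF' F'0 L1F' (phi := phi) (fun=> erefl).
have lphi : L1 Q (fun nu => phi (K nu)).
  apply: (L1_ge0P Q _ _).2.
  - by apply: measurable_local; exact: local_comp (local_setT lK).
  - by move=> nu; rewrite /phi; apply: Ex_ge0 => nu'; exact: F'0.
  - by rewrite -[ltLHS]E -(EFin_Ex L1') ltry.
have [_ h] := Ex_cond iidQ S12 lK lF F0 L1F FF' lphi.
apply: le_trans h _; apply: le_of_eq.
by apply: EFin_inj; rewrite !EFin_Ex.
Qed.

Section FixedR.
Variable r : R.
Hypothesis r0 : 0 < r.

Notation rv := (root_value g gM r).
Definition mean_value n := Ex Q (rv n).
Definition mean_response n := Ex Q (fun nu => g (rv n nu)).

Lemma root_value_ge0 n nu : 0 <= rv n nu.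
Proof.
elim: n nu => [|n IH] nu /=; first by rewrite !mulr_ge0 ?(ltW r0) ?(ltW (resp_top_gt0 gP)).
by rewrite mulr_ge0 ?(ltW r0)//; apply: sumr_ge0 => i _; exact: (resp_ge0 gP).
Qed.

Lemma local_root_value n : local setT (rv n).
Proof.
elim: n => [|n IH] /=.
  by apply: (@local_comp _ _ _ (fun x : R => r * gM * x)); exact: local_root.
apply: (@local_comp _ _ _ (fun x : R => r * x)); apply: local_branch.
exact: local_comp.
Qed.

(** Truncating one generation further replaces infinite boundary values by finite
    ones. *)
Lemma root_value_antitone n nu : rv n.+1 nu <= rv n nu.
Proof.
elim: n nu => [|n IH] nu.
  rewrite /= -mulrA ler_wpM2l ?(ltW r0)// /branch.
  apply: (@le_trans _ _ (\sum_(i <- iota 0 (nu [::])) gM)).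
    by apply: ler_sum => i _; apply: (resp_top gP); exact: root_value_ge0 0 _.
  by rewrite big_const_seq count_predT iter_addr_0 size_iota mulr_natr.
rewrite [leLHS]/= [leRHS]/= ler_wpM2l ?(ltW r0)//.
by apply: ler_sum => i _; apply: (resp_mono gP); [exact: root_value_ge0 n.+1 _|exact: IH].
Qed.

Lemma root_value_le0 n nu : rv n nu <= rv 0 nu.
Proof. by elim: n => // n IH; apply: le_trans (root_value_antitone n nu) IH. Qed.

Lemma L1_root_value n : L1 Q (rv n).
Proof.
apply: (L1_le (measurable_local (local_root_value n)) (L1Z (r * gM) L1_root)) => nu.
by rewrite ger0_norm ?root_value_ge0//; exact: root_value_le0.
Qed.

Lemma L1_root_value_q n : L1 Q (fun nu => rv n nu `^ q).
Proof.
apply: (L1_powR_le_fun (h := rv 0)).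
- by move=> nu; rewrite root_value_ge0 root_value_le0.
- exact: measurable_local (local_root_value n).
- have c0 : 0 <= r * gM by rewrite mulr_ge0 ?(ltW r0) ?(ltW (resp_top_gt0 gP)).
  by apply: (eq_L1 _ (L1Z ((r * gM) `^ q) L1_root_q)) => nu; rewrite /= powRM.
Qed.

Lemma L1_response n : L1 Q (fun nu => g (rv n nu)).
Proof.
apply: (L1_le _ (L1_root_value n)); first by apply: measurable_local; apply: local_comp; exact: local_root_value.
by move=> nu; rewrite ger0_norm ?(resp_ge0 gP) ?(resp_le gP) ?root_value_ge0.
Qed.

Lemma mean_valueS n : mean_value n.+1 = r * m * mean_response n.
Proof.
have lg : local setT (fun nu => g (rv n nu)) by apply: local_comp; exact: local_root_value.
have [l e] := Ex_gensum iidQ L1_root Ex_root 1 lg (L1_response n).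
have E (nu : field) : branch (fun nu => g (rv n nu)) nu = gensum 1 (fun nu => g (rv n nu)) nu.
  by rewrite gensumS gensum0.
rewrite /mean_value (eq_Ex _ (g := fun nu : field => r * gensum 1 (fun nu => g (rv n nu)) nu)).
  by rewrite ExZ// e expr1 mulrA.
by move=> nu; rewrite /= E.
Qed.

Lemma mean_value0 : mean_value 0 = r * gM * m.
Proof. by rewrite /mean_value /= ExZ// Ex_root. Qed.

Definition normalized_value n nu := rv n nu / mean_value n.

(** [normalized_value n] is below the martingale in the convex order, as far as
    [q]-th powers can tell. Adding a nonnegative [C] that does not look at the
    subtree at [u] makes the statement stable under independent sums. *)
Definition convex_dominated n := forall S C u beta, local S C ->
  (forall v, S v -> ~ below u v) -> (forall nu, 0 <= C nu) ->
  L1 Q (fun nu => C nu `^ q) -> 0 <= beta ->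
  Ex Q (fun nu => (C nu + beta * normalized_value n (subtree u nu)) `^ q) <=
  Ex Q (fun nu => (C nu + beta * Wn m n.+1 (subtree u nu)) `^ q).

Lemma normalized_ge0 n nu : 0 <= normalized_value n nu.
Proof. by rewrite divr_ge0 ?root_value_ge0//; apply: Ex_ge0 => x; exact: root_value_ge0. Qed.

Lemma L1_normalized_q n : L1 Q (fun nu => normalized_value n nu `^ q).
Proof.
have a0 : 0 <= (mean_value n)^-1.
  by rewrite invr_ge0; apply: Ex_ge0 => x; exact: root_value_ge0.
apply: (eq_L1 _ (L1Z ((mean_value n)^-1 `^ q) (L1_root_value_q n))) => nu.
by rewrite -powRM ?root_value_ge0// mulrC.
Qed.

Lemma L1_Wn_q n : L1 Q (fun nu => Wn m n nu `^ q).
Proof.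
have qq : 0 <= q <= q by rewrite lexx (ltW q0).
have [C hC] := Wn_moment iidQ m1 L1_root Ex_root L1_root_q qq.
by have [] := hC n.
Qed.

Definition normalized_response n nu := g (rv n nu) / mean_response n.

Lemma local_normalized_response n : local setT (normalized_response n).
Proof.
apply: (@local_comp _ _ _ (fun x => g x / mean_response n)); exact: local_root_value.
Qed.

Let mean_response_ge0 n : 0 <= mean_response n.
Proof. by apply: Ex_ge0 => nu; rewrite (resp_ge0 gP) ?root_value_ge0. Qed.

Lemma normalized_response_ge0 n nu : 0 <= normalized_response n nu.
Proof. by rewrite divr_ge0 ?(resp_ge0 gP) ?root_value_ge0. Qed.

Lemma L1_normalized_response_q n : L1 Q (fun nu => normalized_response n nu `^ q).
Proof.
apply: (L1_powR_le_fun (h := fun=> gM / mean_response n)).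
- move=> nu; rewrite normalized_response_ge0 ler_wpM2r ?invr_ge0//.
  by rewrite (resp_top gP) ?root_value_ge0.
- exact: measurable_local (local_normalized_response n).
- exact: L1_cst.
Qed.

Lemma L1_powR_add_sum S C L D beta : local S C -> (forall nu, 0 <= C nu) ->
  L1 Q (fun nu => C nu `^ q) -> local setT D -> (forall nu, 0 <= D nu) ->
  L1 Q (fun nu => D nu `^ q) -> 0 <= beta ->
  L1 Q (fun nu => (C nu + beta * \sum_(v <- L) D (subtree v nu)) `^ q).
Proof.
move=> lC C0 lqC lD D0 lqD b0.
have lS : local setT (fun nu => beta * \sum_(v <- L) D (subtree v nu)).
  apply: (@local_comp _ _ _ (fun x : R => beta * x)); exact: local_setT (local_sum_below _ lD).
have S0 nu : 0 <= \sum_(v <- L) D (subtree v nu) by exact: sumr_ge0.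
apply: ge0_L1_powRD => //.
- by move=> nu; rewrite mulr_ge0.
- exact: measurable_local (local_setT lC).
- exact: measurable_local.
have lD' : L1 Q (fun nu => `|D nu| `^ q) by apply: (eq_L1 _ lqD) => nu; rewrite ger0_norm.
apply: (eq_L1 _ (L1Z (beta `^ q) (L1_powR_sum iidQ L q0 lD lD'))) => nu.
by rewrite ger0_norm// powRM.
Qed.

(** Replace the summands one at a time, counting all the others as part of the
    independent term [C]. *)
Lemma response_sum_dominated n : 0 < mean_value n -> 0 < mean_response n ->
  convex_dominated n -> forall k L S C beta, uniq L -> {in L, forall v, size v = k} ->
  local S C -> (forall v, S v -> ~ belows L v) -> (forall nu, 0 <= C nu) ->
  L1 Q (fun nu => C nu `^ q) -> 0 <= beta ->
  Ex Q (fun nu => (C nu + beta * \sum_(v <- L) normalized_response n (subtree v nu)) `^ q) <=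
  Ex Q (fun nu => (C nu + beta * \sum_(v <- L) Wn m n.+1 (subtree v nu)) `^ q).
Proof.
move=> a0 b0 CO k; elim=> [|v L IH] S C beta uL szL lC SL C0 lqC beta0.
  by apply: le_of_eq; apply: eq_Ex => nu; rewrite !big_nil.
have lG := local_normalized_response n. have G0 := normalized_response_ge0 n.
have lqG := L1_normalized_response_q n.
pose C1 nu := C nu + beta * \sum_(w <- L) normalized_response n (subtree w nu).
have C10 nu : 0 <= C1 nu by rewrite addr_ge0// mulr_ge0//; apply: sumr_ge0.
have lC1 : local (S `|` belows L) C1.
  apply: local_comp2; first by apply: local_sub lC => w; left.
  apply: (@local_comp _ _ _ (fun x : R => beta * x)).
  by apply: local_sub (local_sum_below _ lG) => w; right.
have lqC1 : L1 Q (fun nu => C1 nu `^ q) by exact: (L1_powR_add_sum L lC).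
have SC1 w : (S `|` belows L) w -> ~ below v w.
  move=> [Sw|Lw] vw.
    by apply: (SL w Sw); exists v => //; rewrite mem_head.
  exact: (belows_disjoint uL szL vw Lw).
pose C2 nu := C nu + beta * Wn m n.+1 (subtree v nu).
have W0 := Wn_ge0 m1.
have C20 nu : 0 <= C2 nu by rewrite addr_ge0// mulr_ge0.
have lW := @local_Wn R m n.+1.
have lC2 : local (S `|` below v) C2.
  apply: local_comp2; first by apply: local_sub lC => w; left.
  apply: (@local_comp _ _ _ (fun x : R => beta * x)).
  by apply: local_sub (local_subtree v lW) => w; right.
have lqC2 : L1 Q (fun nu => C2 nu `^ q).
  have := L1_powR_add_sum [:: v] lC C0 lqC lW (W0 n.+1) (L1_Wn_q n.+1) beta0.
  by apply: eq_L1 => nu; rewrite big_seq1.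
have SC2 w : (S `|` below v) w -> ~ belows L w.
  move=> [Sw|vw] Lw; last exact: (belows_disjoint uL szL vw Lw).
  by case: Lw => w' w'L; apply: contra_not (SL w Sw) => ww'; exists w' => //; rewrite inE w'L orbT.
have szL' : {in L, forall w, size w = k} by move=> w wL; apply: szL; rewrite inE wL orbT.
have uL' : uniq L by case/andP: uL.
apply: le_trans (le_trans (y := Ex Q (fun nu => (C1 nu + beta * normalized_value n (subtree v nu)) `^ q)) _
  (CO _ _ v beta lC1 SC1 C10 lqC1 beta0)) _.
  apply: le_trans (concave_convex_order (local_root_value n) (root_value_ge0 n) (L1_root_value n) (L1_root_value_q n) a0 b0 lC1 SC1 C10 (measurable_local (local_setT lC1)) lqC1 beta0).
  apply: le_of_eq; apply: eq_Ex => nu; rewrite big_cons /C1; congr (_ `^ _).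
  by rewrite mulrDr addrAC addrA.
apply: le_trans (le_trans _ (IH _ C2 beta uL' szL' lC2 SC2 C20 lqC2 beta0)) _.
  by apply: le_of_eq; apply: eq_Ex => nu; rewrite /C1 /C2 addrAC.
by apply: le_of_eq; apply: eq_Ex => nu; rewrite big_cons /C2 mulrDr addrA.
Qed.

Lemma normalizedS n nu : 0 < mean_response n ->
  normalized_value n.+1 nu = m^-1 * branch (normalized_response n) nu.
Proof.
move=> b0; rewrite /normalized_value mean_valueS /normalized_response /=.
have -> : branch (fun nu => g (rv n nu) / mean_response n) nu =
   (mean_response n)^-1 * branch (fun nu => g (rv n nu)) nu.
  by rewrite -branchZ; congr branch; apply/funext => x; rewrite mulrC.
have rn : r != 0 by rewrite gt_eqF. have mn : m != 0 by rewrite gt_eqF.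
by field; rewrite rn mn gt_eqF.
Qed.

Lemma branch_subtree u D nu : branch D (subtree u nu) =
  \sum_(v <- [seq rcons u i | i <- iota 0 (nu u)]) D (subtree v nu).
Proof.
rewrite big_map /branch /subtree cats0; apply: eq_bigr => i _.
by congr D; apply/funext => v; rewrite cat_rcons.
Qed.

Lemma convex_dominated0 : convex_dominated 0.
Proof.
move=> S C u beta lC Su C0 lqC beta0; apply: le_of_eq; apply: eq_Ex => nu.
congr ((_ + _ * _) `^ _).
rewrite /normalized_value mean_value0 WnS// /=.
have -> : Wn m 0 = (fun=> 1) by apply/funext => x; rewrite /Wn expr0 divr1.
rewrite branch1.
have rn : r != 0 by rewrite gt_eqF. have mn : m != 0 by rewrite gt_eqF.
by field; rewrite rn mn gt_eqF// (resp_top_gt0 gP).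
Qed.

(** Condition on the number of children of [u]. *)
Lemma convex_dominatedS n : 0 < mean_value n -> 0 < mean_response n ->
  convex_dominated n -> convex_dominated n.+1.
Proof.
move=> a0 b0 CO S C u beta lC Su C0 lqC beta0.
pose ch k := [seq rcons u i | i <- iota 0 k].
have im0 : 0 < m^-1 by rewrite invr_gt0.
have bm0 : 0 <= beta * m^-1 by rewrite mulr_ge0// ltW.
pose F D (k : nat) (nu : seq nat -> nat) := (C nu + beta * m^-1 * \sum_(v <- ch k) D (subtree v nu)) `^ q.
have lG := local_normalized_response n. have G0 := normalized_response_ge0 n.
have lqG := L1_normalized_response_q n.
have lW := @local_Wn R m n.+1. have W0 := Wn_ge0 m1 n.+1. have lqW := L1_Wn_q n.+1.
have ch_below k : belows (ch k) `<=` [set v | below u v /\ v <> u].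
  move=> w [_ /mapP[i _ ->]] /prefixP[x ->]; split.
    by apply/prefixP; exists (i :: x); rewrite cat_rcons.
  by move=> /(congr1 size); rewrite size_cat size_rcons => /eqP; rewrite -{2}[size u]addn0 addSnnS eqn_add2l.
have uu : below u u by exact: prefix_refl.
have locF D k : local setT D -> local [set v | v <> u] (F D k).
  move=> lD; apply: (@local_comp _ _ _ (fun x : R => x `^ q)); apply: local_comp2.
    by apply: local_sub lC => v Sv E; apply: (Su v Sv); rewrite E.
  apply: (@local_comp _ _ _ (fun x : R => beta * m^-1 * x)).
  by apply: local_sub (local_sum_below _ lD) => v /ch_below[].
have L1F D k : local setT D -> (forall nu, 0 <= D nu) -> L1 Q (fun nu => D nu `^ q) -> L1 Q (F D k).
  by move=> lD D0 lqD; exact: (L1_powR_add_sum _ lC).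
have -> : Ex Q (fun nu => (C nu + beta * normalized_value n.+1 (subtree u nu)) `^ q) =
    Ex Q (fun nu => F (normalized_response n) (nu u) nu).
  by apply: eq_Ex => nu; rewrite normalizedS// branch_subtree mulrA.
have E (nu : field) : (C nu + beta * Wn m n.+2 (subtree u nu)) `^ q = F (Wn m n.+1) (nu u) nu.
  by rewrite WnS// branch_subtree mulrA.
rewrite (eq_Ex _ E).
apply: (@Ex_cond_compare _ [set v | v = u] [set v | v <> u] (fun nu => nu u)
  (F (normalized_response n)) (F (Wn m n.+1))).
- by move=> w /= -> /(_ erefl).
- exact: local_coord.
- by move=> nu; exact: locF.
- by move=> nu; exact: locF.
- by move=> nu nu'; exact: powR_ge0.
- by move=> nu nu'; exact: powR_ge0.
- by move=> nu; exact: L1F.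
- by move=> nu; exact: L1F.
- move=> nu; apply: (response_sum_dominated a0 b0 CO (k := (size u).+1) (S := S)) => //.
  + by rewrite map_inj_uniq ?iota_uniq// => i j /rcons_inj[].
  + by move=> v /mapP[i _ ->]; rewrite size_rcons.
  + by move=> v Sv /ch_below[uv _]; exact: (Su v Sv uv).
- have := L1_powR_add_sum [:: u] lC C0 lqC (@local_Wn R m n.+2) (Wn_ge0 m1 n.+2) (L1_Wn_q n.+2) beta0.
  by apply: eq_L1 => nu; rewrite big_seq1 E.
Qed.

End FixedR.

End ConvexOrder.

(** * Approximation by the martingale *)

Section Approximation.
Context (R : realType) (mu : probability nat R) (Q : probability field R) (m : R).
Hypothesis iidQ : iid_field mu Q.
Hypothesis m1 : 1 < m.
Hypothesis L1_root : L1 Q (fun nu => (nu [::])%:R).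
Hypothesis Ex_root : Ex Q (fun nu => (nu [::])%:R) = m.
Variables p q : R.
Hypothesis q1 : 1 < q.
Hypothesis p12 : 1 < p <= 2.
Hypothesis pq : p < q.
Hypothesis L1_root_q : L1 Q (fun nu => (nu [::])%:R `^ q).
Notation theta := (q / p - 1).
Variables (g : R -> R) (gM gC : R).
Hypothesis gP : response theta g gM gC.

Let m0 : 0 < m. Proof. exact: lt_trans m1. Qed.
Let q0 : 0 < q. Proof. exact: lt_trans q1. Qed.
Let p1 : 1 < p. Proof. by case/andP: p12. Qed.
Let p0 : 0 < p. Proof. exact: lt_trans p1. Qed.
Let theta0 : 0 < theta. Proof. by rewrite subr_gt0 ltr_pdivlMr// mul1r. Qed.

Definition Winf_moment := Ex Q (fun nu => Winf m nu `^ q).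

Lemma Winf_moment_ge1 : 1 <= Winf_moment.
Proof.
apply: le_trans (Ex_Wn_powR_le iidQ m1 L1_root Ex_root q1 L1_root_q 0).
have E (nu : field) : Wn m 0 nu `^ q = 1 :> R by rewrite /Wn expr0 divr1 powR1.
by rewrite (eq_Ex _ E) Ex_cst.
Qed.

Let CW0 : 0 < Winf_moment. Proof. exact: lt_le_trans Winf_moment_ge1. Qed.

(** A variable with normalized [q]-th moment at most [Winf_moment] carries at most half of
    its mean above [spread] times that mean. *)
Definition spread := (2 * Winf_moment) `^ (q - 1)^-1.

Let spread0 : 0 < spread. Proof. by rewrite powR_gt0// mulr_gt0. Qed.

Section FixedR.
Variable r : R.
Hypothesis r0 : 0 < r.

Notation rv := (root_value g gM r).
Notation a := (mean_value Q g gM r).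
Notation b := (mean_response Q g gM r).
Notation Y := (normalized_value Q g gM r).
Notation G := (normalized_response Q g gM r).

Lemma normalized_moment n : convex_dominated Q m q g gM r n -> Ex Q (fun nu => Y n nu `^ q) <= Winf_moment.
Proof.
move=> CO.
have lq0 : L1 Q (fun nu : field => (0 : R) `^ q) by exact: L1_cst.
have -> : Ex Q (fun nu => Y n nu `^ q) = Ex Q (fun nu => (0 + 1 * Y n (subtree [::] nu)) `^ q).
  by apply: eq_Ex => nu; rewrite add0r mul1r.
apply: le_trans (CO set0 (fun=> 0) [::] 1 (local_cst _ _) (fun v => False_ind _) (fun=> lexx 0) lq0 ler01) _.
apply: le_trans (Ex_Wn_powR_le iidQ m1 L1_root Ex_root q1 L1_root_q n.+1).
by apply: le_of_eq; apply: eq_Ex => nu /=; rewrite add0r mul1r.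
Qed.

Lemma value_moment n : 0 < a n -> convex_dominated Q m q g gM r n ->
  Ex Q (fun nu => rv n nu `^ q) <= Winf_moment * a n `^ q.
Proof.
move=> an /normalized_moment; have E (nu : field) : rv n nu `^ q = a n `^ q * Y n nu `^ q.
  rewrite -powRM ?(ltW an) ?(normalized_ge0 Q gP r0)//.
  by rewrite /normalized_value mulrC divfK// gt_eqF.
rewrite (eq_Ex _ E) ExZ ?(L1_normalized_q q1 L1_root_q gP r0)// => h.
by rewrite mulrC ler_wpM2r ?powR_ge0.
Qed.

(** A variable whose [q]-th moment is controlled by its mean puts a fixed share
    of that mean below a multiple of it, where [g] is bounded below linearly. *)
Lemma mean_response_lower A n : 0 < a n -> a n <= A -> convex_dominated Q m q g gM r n ->
  g (A * spread) / (2 * (A * spread)) * a n <= b n.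
Proof.
move=> an aA CO; have A0 : 0 < A by exact: lt_le_trans aA.
have q1' : 1 < q by exact: q1. have qB0 : 0 < q - 1 by lra.
set K := A * spread; have K0 : 0 < K by rewrite mulr_gt0.
have gK0 : 0 < g K by exact: resp_gt0 gP _ K0.
set c := g K / K; have c0 : 0 < c by rewrite divr_gt0.
have lx := L1_root_value L1_root gP r0 n. have lq := L1_root_value_q q1 L1_root_q gP r0 n.
have H nu : c * (rv n nu - K `^ (1 - q) * rv n nu `^ q) <= g (rv n nu).
  have x0 := root_value_ge0 gP r0 n nu; move: x0; set x := rv n nu => x0.
  have [->|xn0] := eqVneq x 0; first by rewrite powR0 ?gt_eqF// mulr0 subr0 mulr0 (resp0 gP).
  have x1 : 0 < x by rewrite lt_neqAle eq_sym xn0.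
  have [xK|Kx] := leP x K.
    have h1 := resp_ratio gP x1 xK.
    have h2 : c * x <= g x by rewrite /c mulrAC ler_pdivrMr.
    by apply: le_trans h2; rewrite ler_wpM2l ?(ltW c0)// gerBl mulr_ge0 ?powR_ge0.
  apply: (@le_trans _ _ (0 : R)); last exact: resp_ge0 gP _ x0.
  rewrite pmulr_rle0// subr_le0 -(mulr_powRB1 x0 q0) mulrCA ler_peMr//.
  have -> : 1 - q = - (q - 1) by ring.
  rewrite powRN ler_pdivlMl ?powR_gt0// mulr1 le_powR// ?ltW//.
have := Ex_le (L1Z c (L1B lx (L1Z (K `^ (1 - q)) lq))) (L1_response L1_root gP r0 n) H.
rewrite ExZ ?ExB ?ExZ//; [|exact: L1Z|by apply: L1B => //; exact: L1Z].
rewrite -/(a n) -/(b n) => h; apply: le_trans h.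
have -> : g K / (2 * K) * a n = c * (a n / 2) by rewrite /c; field; rewrite gt_eqF.
rewrite ler_wpM2l ?(ltW c0)//.
suff : K `^ (1 - q) * Ex Q (fun nu => rv n nu `^ q) <= a n / 2 by lra.
apply: le_trans (ler_wpM2l (powR_ge0 _ _) (value_moment an CO)) _.
have -> : 1 - q = - (q - 1) by ring.
rewrite powRN ler_pdivrMl ?powR_gt0// -(mulr_powRB1 (ltW an) q0).
have -> : K `^ (q - 1) = A `^ (q - 1) * (2 * Winf_moment).
  rewrite /K powRM ?(ltW A0) ?(ltW spread0)// /spread -powRrM mulVf ?gt_eqF// powRr1//.
  by rewrite mulr_ge0 ?(ltW CW0).
have aA' : a n `^ (q - 1) <= A `^ (q - 1) by apply: le_powR; rewrite ?(ltW an) ?(ltW qB0).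
have CWn : 0 < Winf_moment * a n by rewrite mulr_gt0.
have := ler_wpM2l (ltW CWn) aA'.
have -> : A `^ (q - 1) * (2 * Winf_moment) * (a n / 2) = Winf_moment * a n * A `^ (q - 1) by field.
by rewrite mulrA.
Qed.

(** The lower bound on the mean response rests on domination, and domination at the
    next height on the positivity of that mean. *)
Lemma mean_value_gt0_dominated n : 0 < a n /\ convex_dominated Q m q g gM r n.
Proof.
elim: n => [|n [an CO]].
  split; first by rewrite (mean_value0 L1_root Ex_root) !mulr_gt0 ?(resp_top_gt0 gP).
  exact: (convex_dominated0 m1 L1_root Ex_root gP r0).
have bn : 0 < b n.
  apply: lt_le_trans (mean_response_lower an (lexx _) CO).
  have h : 0 < a n * spread by rewrite mulr_gt0.
  by rewrite mulr_gt0// divr_gt0 ?(resp_gt0 gP)// mulr_gt0.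
split; first by rewrite (mean_valueS iidQ L1_root Ex_root gP r0) !mulr_gt0.
exact: (convex_dominatedS iidQ m1 L1_root Ex_root q1 L1_root_q gP r0 an bn CO).
Qed.

Lemma mean_value_gt0 n : 0 < a n.
Proof. by have [] := mean_value_gt0_dominated n. Qed.

Lemma dominated n : convex_dominated Q m q g gM r n.
Proof. by have [] := mean_value_gt0_dominated n. Qed.

Lemma mean_response_gt0 n : 0 < b n.
Proof.
have := mean_value_gt0 n.+1; rewrite (mean_valueS iidQ L1_root Ex_root gP r0).
by rewrite pmulr_rgt0// mulr_gt0.
Qed.

Lemma mean_response_le n : b n <= a n.
Proof.
apply: (Ex_le (L1_response L1_root gP r0 n) (L1_root_value L1_root gP r0 n)) => nu.
by apply: (resp_le gP); exact: (root_value_ge0 gP r0 n nu).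
Qed.

Lemma normalized_L1 n : L1 Q (Y n) /\ Ex Q (Y n) = 1.
Proof.
have lx := L1_root_value L1_root gP r0 n.
have E (nu : field) : Y n nu = (a n)^-1 * rv n nu by rewrite mulrC.
split; first by apply: (eq_L1 E); exact: L1Z.
by rewrite (eq_Ex _ E) ExZ// mulVf// gt_eqF// mean_value_gt0.
Qed.

Lemma normalized_response_L1 n : L1 Q (G n) /\ Ex Q (G n) = 1.
Proof.
have lx := L1_response L1_root gP r0 n.
have E (nu : field) : G n nu = (b n)^-1 * g (rv n nu) by rewrite mulrC.
split; first by apply: (eq_L1 E); exact: L1Z.
by rewrite (eq_Ex _ E) ExZ// mulVf// gt_eqF// mean_response_gt0.
Qed.

Definition error n nu : R := Y n nu - G n nu.

Lemma local_error n : local setT (error n).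
Proof.
apply: (@local_comp _ _ _ (fun x => x / a n - g x / b n)); exact: local_root_value.
Qed.

Lemma L1_error n : L1 Q (error n).
Proof.
by apply: L1B; [have [] := normalized_L1 n|have [] := normalized_response_L1 n].
Qed.

Lemma Ex_error n : Ex Q (error n) = 0.
Proof.
have [lY eY] := normalized_L1 n; have [lG eG] := normalized_response_L1 n.
by rewrite ExB// eY eG subrr.
Qed.

Definition error_const := ((1 + 1) `^ p * (gC `^ p * Winf_moment * (2 + Winf_moment))) `^ p^-1.

Lemma error_const_gt0 : 0 < error_const.
Proof.
have c1 := Winf_moment_ge1; rewrite powR_gt0// !mulr_gt0 ?powR_gt0 ?(resp_C gP) ?CW0//; lra.
Qed.

Lemma error_const_powR : error_const `^ p = (1 + 1) `^ p * (gC `^ p * Winf_moment * (2 + Winf_moment)).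
Proof.
have c1 := Winf_moment_ge1; rewrite /error_const -powRrM mulVf ?gt_eqF// powRr1//.
by rewrite !mulr_ge0 ?powR_ge0 ?(ltW CW0)//; lra.
Qed.

(** Up to a multiple of [G], the error is [(X - g X) / a] with [X] the value at the
    root, hence of order [X `^ (1 + theta) / a]. For [theta = q / p - 1] the [p]-th
    power of this involves exactly the [q]-th moment of [X]. *)
Lemma error_moment n : L1 Q (fun nu => `|error n nu| `^ p) /\
  Ex Q (fun nu => `|error n nu| `^ p) <= (error_const * a n `^ theta) `^ p.
Proof.
have an := mean_value_gt0 n; have bn := mean_response_gt0 n.
have p1' : 1 < p by exact: p1. have p0' : 0 < p by exact: p0.
have q1' : 1 < q by exact: q1.
have C1 := Winf_moment_ge1; have gC0 := resp_C gP.
have lx := L1_root_value L1_root gP r0 n; have lg := L1_response L1_root gP r0 n.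
have lq := L1_root_value_q q1 L1_root_q gP r0 n.
have x0 nu := root_value_ge0 gP r0 n nu.
pose h nu := (rv n nu - g (rv n nu)) / a n.
have h0 nu : 0 <= h nu by rewrite divr_ge0 ?(ltW an)// subr_ge0 (resp_le gP).
have loch : local setT h.
  by apply: (@local_comp _ _ _ (fun x => (x - g x) / a n)); exact: local_root_value.
have L1h : L1 Q h.
  by apply: (eq_L1 _ (L1Z (a n)^-1 (L1B lx lg))) => nu; rewrite mulrC.
have eh : Ex Q h = (a n - b n) / a n.
  rewrite (eq_Ex _ (g := fun nu : field => (a n)^-1 * (rv n nu - g (rv n nu)))); last by move=> nu; rewrite mulrC.
  by rewrite ExZ ?ExB//; [rewrite mulrC|exact: L1B].
have hp nu : h nu `^ p <= (gC `^ p / a n `^ p) * rv n nu `^ q.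
  have e : rv n nu `^ q = (rv n nu `^ (1 + theta)) `^ p.
    by rewrite -powRrM; congr (_ `^ _); field; rewrite gt_eqF.
  rewrite e mulrAC -powRM ?powR_ge0 ?(ltW gC0)//.
  have -> : (gC * rv n nu `^ (1 + theta)) `^ p / a n `^ p = (gC * rv n nu `^ (1 + theta) / a n) `^ p.
    rewrite [RHS]powRM ?invr_ge0 ?(ltW an)//; last by rewrite mulr_ge0 ?powR_ge0 ?(ltW gC0).
    by rewrite -[(a n)^-1]powR_inv1 ?(ltW an)// -powRrM mulN1r powRN.
  apply: le_powR => //; first exact: ltW.
  by rewrite ler_wpM2r ?invr_ge0 ?(ltW an)// (resp_small gP).
have lhp : L1 Q (fun nu => h nu `^ p).
  apply: (L1_le _ (L1Z (gC `^ p / a n `^ p) lq)).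
    by apply: measurable_fun_powR; exact: measurable_local.
  by move=> nu; rewrite ger0_norm ?powR_ge0.
set B := gC `^ p * Winf_moment * (a n `^ theta) `^ p.
have ehp : Ex Q (fun nu => h nu `^ p) <= B.
  apply: le_trans (Ex_le lhp (L1Z _ lq) hp) _; rewrite ExZ//.
  apply: le_trans (ler_wpM2l _ (value_moment an (dominated n))) _.
    by rewrite divr_ge0 ?powR_ge0.
  apply: le_of_eq; rewrite /B -powRrM.
  have -> : theta * p = q - p by field; rewrite gt_eqF.
  have qp : q != p by rewrite gt_eqF.
  rewrite powRB ?(negbTE qp)//.
  by field; rewrite gt_eqF// powR_gt0.
have B0 : 0 <= B by rewrite !mulr_ge0 ?powR_ge0 ?(ltW CW0).
have G0 := normalized_response_ge0 Q gP r0 n.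
have locG := local_normalized_response Q g gM r n.
have lGq := L1_normalized_response_q Q q1 gP r0 n.
have EGq : Ex Q (fun nu => G n nu `^ q) <= Winf_moment.
  have lq0 : L1 Q (fun nu : field => (0 : R) `^ q) by exact: L1_cst.
  have -> : Ex Q (fun nu => G n nu `^ q) = Ex Q (fun nu => (0 + 1 * G n (subtree [::] nu)) `^ q).
    by apply: eq_Ex => nu; rewrite add0r mul1r.
  apply: le_trans (concave_convex_order iidQ q1 gP (local_root_value g gM r n) x0 lx lq an bn
    (local_cst set0 0) (fun v => False_ind _) (fun=> lexx 0) (measurable_cst _) lq0 ler01 (u := [::])) _.
  apply: le_trans (normalized_moment (dominated n)).
  by apply: le_of_eq; apply: eq_Ex => nu /=; rewrite add0r mul1r.
have pq' : 0 <= p <= q by rewrite (ltW p0) (ltW pq).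
have [lGp EGp] := L1_powR_le pq' (measurable_local locG) G0 lGq.
set t := (a n - b n) / a n.
have t0 : 0 <= t by rewrite /t -eh; exact: Ex_ge0.
have tp : t `^ p <= B by rewrite /t -eh; apply: le_trans ehp; exact: Ex_jensen_powR.
have H nu : `|error n nu| `^ p <= (1 + 1) `^ p * h nu `^ p + (1 + 1) `^ p * (t `^ p * G n nu `^ p).
  have -> : error n nu = h nu - t * G n nu.
    rewrite /error /h /t /normalized_value /normalized_response.
    by field; rewrite !gt_eqF.
  rewrite -[t `^ p * _]powRM//.
  have := @powR_addl_le R 1 p (h nu) (t * G n nu) ltr01 (ltW p0) (h0 nu) (mulr_ge0 t0 (G0 nu)).
  rewrite invr1 => hh; apply: le_trans hh.
  apply: le_powR => //; first exact: ltW.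
  apply: le_trans (ler_normB _ _) _.
  by rewrite !ger0_norm// mulr_ge0.
have lrhs : L1 Q (fun nu => (1 + 1) `^ p * h nu `^ p + (1 + 1) `^ p * (t `^ p * G n nu `^ p)).
  by apply: L1D; apply: L1Z => //; exact: L1Z.
have lerr : L1 Q (fun nu => `|error n nu| `^ p).
  apply: (L1_le _ lrhs).
    apply: measurable_fun_powR; apply: measurable_fun_norm.
    exact: measurable_local (local_error n).
  by move=> nu; rewrite ger0_norm ?powR_ge0.
split => //; apply: le_trans (Ex_le lerr lrhs H) _.
rewrite ExD; [|exact: L1Z|by apply: L1Z; exact: L1Z].
rewrite ExZ// ExZ ?ExZ//; last exact: L1Z.
have two0 : 0 <= (1 + 1) `^ p :> R by exact: powR_ge0.
have CW1 : 0 <= 1 + Winf_moment by rewrite addr_ge0// ltW.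
have EGp' : Ex Q (fun nu => G n nu `^ p) <= 1 + Winf_moment by apply: le_trans EGp _; rewrite lerD2l.
have eG0 : 0 <= Ex Q (fun nu => G n nu `^ p) by apply: Ex_ge0 => nu; exact: powR_ge0.
have tG := ler_pM (powR_ge0 t p) eG0 tp EGp'.
apply: le_trans (lerD (ler_wpM2l two0 ehp) (ler_wpM2l two0 tG)) _.
rewrite (powRM _ (ltW error_const_gt0) (powR_ge0 _ _)) error_const_powR.
by apply: le_of_eq; rewrite /B; clear; ring.
Qed.

(** Unrolling the recursion down to the leaves: [Y n] differs from the
    martingale only by averages of the centred errors. *)
Lemma normalized_decomposition n nu :
  Y n nu - Wn m n.+1 nu = - \sum_(0 <= k < n) m ^- (n - k) * gensum (n - k) (error k) nu.
Proof.
elim: n nu => [|n IH] nu.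
  rewrite big_geq// oppr0; apply/eqP; rewrite subr_eq0; apply/eqP.
  rewrite WnS// /normalized_value (mean_value0 L1_root Ex_root) /=.
  have -> : Wn m 0 = (fun=> 1) by apply/funext => x; rewrite /Wn expr0 divr1.
  rewrite branch1.
  have rn : r != 0 by rewrite gt_eqF. have mn : m != 0 by rewrite gt_eqF.
  by field; rewrite rn mn gt_eqF// (resp_top_gt0 gP).
rewrite (normalizedS iidQ m1 L1_root Ex_root gP r0 _ (mean_response_gt0 n)) WnS//.
rewrite big_nat_recr//= subSn// subnn.
have E : forall nu, G n nu - Wn m n.+1 nu =
    - (error n nu + \sum_(0 <= k < n) m ^- (n - k) * gensum (n - k) (error k) nu).
  by move=> x; have h := IH x; rewrite opprD -h /error; ring.
rewrite -mulrBr -[branch _ nu - branch _ nu]sumrB.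
have -> : \sum_(i <- iota 0 (nu [::])) (G n (subtree [:: i] nu) - Wn m n.+1 (subtree [:: i] nu)) =
  - \sum_(i <- iota 0 (nu [::])) (error n (subtree [:: i] nu) +
     \sum_(0 <= k < n) m ^- (n - k) * gensum (n - k) (error k) (subtree [:: i] nu)).
  by rewrite -sumrN; apply: eq_bigr => i _; rewrite E.
rewrite mulrN big_split/= mulrDr addrC; congr (- (_ + _)).
  by rewrite gensumS gensum0 expr1.
rewrite exchange_big/= mulr_sumr; apply: eq_big_nat => k /andP[_ kn].
rewrite subSn ?(ltnW kn)// gensumS_root -mulr_sumr mulrA; congr (_ * _).
by rewrite exprS invfM.
Qed.

(** The same constant serves all parameters [r], which may thus vary with the
    height. *)
Definition approx_const := 2 * (2 * p) `^ p^-1 * error_const.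

Lemma normalized_approx n :
  Ex Q (fun nu => `|Y n nu - Wn m n.+1 nu|) <=
  approx_const * \sum_(0 <= k < n) decay m p ^+ (n - k) * a k `^ theta.
Proof.
have B k : L1 Q (fun nu => m ^- (n - k) * gensum (n - k) (error k) nu) /\
  Ex Q (fun nu => `|m ^- (n - k) * gensum (n - k) (error k) nu|) <=
    approx_const * (decay m p ^+ (n - k) * a k `^ theta).
  have [le he] := error_moment k.
  have e0 : 0 < error_const * a k `^ theta.
    by rewrite mulr_gt0 ?error_const_gt0 ?powR_gt0 ?mean_value_gt0.
  have [l h] := gensum_L1 iidQ m1 L1_root Ex_root (n - k) p12 e0 (local_error k) (L1_error k) (Ex_error k) le he.
  split => //; apply: le_trans h _; apply: le_of_eq; rewrite /approx_const; ring.
have lN k : L1 Q (fun nu => `|m ^- (n - k) * gensum (n - k) (error k) nu|).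
  by apply: L1_norm; case: (B k).
have lS : L1 Q (fun nu => \sum_(0 <= k < n) `|m ^- (n - k) * gensum (n - k) (error k) nu|).
  by apply: L1_sum => k _; exact: lN.
have l1 : L1 Q (fun nu => `|Y n nu - Wn m n.+1 nu|).
  apply: L1_norm; apply: L1B; first by have [] := normalized_L1 n.
  exact: (L1_Wn iidQ L1_root Ex_root).
apply: le_trans (Ex_le l1 lS _) _.
  by move=> nu; rewrite normalized_decomposition normrN ler_norm_sum.
rewrite Ex_sum; last by move=> k _; exact: lN.
by rewrite mulr_sumr; apply: ler_sum => k _; case: (B k).
Qed.

End FixedR.

(** As long as the mean is not small, a fixed share of it comes from values at which
    [g x] is less than [x] by a fixed factor, so that one step contracts it even
    when [m * r] slightly exceeds 1. *)
Lemma mean_value_small (e : R) : 0 < e -> exists eta K, 0 < eta <= 1 /\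
  forall r n, 0 < r -> m * r <= 1 + eta -> (K <= n)%N -> mean_value Q g gM r n <= e.
Proof.
move=> e0; pose e2 := e / 6; have e20 : 0 < e2 by rewrite /e2; lra.
(* below [2 * e2] one step reaches at most [4 * e2], and above it contracts by [1 - c ^+ 2] *)
pose c := (e2 - g e2) / (2 * e2).
have ge2 := resp_lt gP e20; have ge20 := resp_gt0 gP e20.
have c0 : 0 < c by rewrite /c divr_gt0//; lra.
have c1 : c < 1 by rewrite /c ltr_pdivrMr; lra.
have gam : 0 < 1 - c ^+ 2 < 1 by nra.
have gM0 := resp_top_gt0 gP.
have cv : geometric (2 * gM) (1 - c ^+ 2) n @[n --> \oo] --> 0.
  by apply: cvg_geometric; rewrite ger0_norm; lra.
have e3 : 0 < e / 3 by lra.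
have [K _ hK] := (cvgrPdist_le _ _).1 cv _ e3.
exists c, K; split; first lra.
move=> r n r0 mr Kn.
have step k : mean_value Q g gM r k.+1 <= 4 * e2 \/
    mean_value Q g gM r k.+1 <= (1 - c ^+ 2) * mean_value Q g gM r k.
  have ak := mean_value_gt0 r0 k.
  have b0 := mean_response_gt0 r0 k; have ba := mean_response_le r0 k.
  rewrite (mean_valueS iidQ L1_root Ex_root gP r0) [r * m]mulrC.
  have [ae|ae] := ltP (mean_value Q g gM r k) (2 * e2); [left|right].
    have := ler_wpM2r (ltW b0) mr; nra.
  have H nu : g (root_value g gM r k nu) <= root_value g gM r k nu + (- (e2 - g e2) / e2) * root_value g gM r k nu + (e2 - g e2).
    have x0 := root_value_ge0 gP r0 k nu; move: x0; set x := root_value g gM r k nu => x0.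
    have [xe|ex] := leP e2 x.
      have h := resp_ratio gP e20 xe.
      have -> : x + - (e2 - g e2) / e2 * x + (e2 - g e2) = g e2 * x / e2 + (e2 - g e2).
        by field; rewrite gt_eqF.
      apply: (@le_trans _ _ (g e2 * x / e2)); last lra.
      by rewrite ler_pdivlMr.
    have -> : x + - (e2 - g e2) / e2 * x + (e2 - g e2) = x + (e2 - g e2) * ((e2 - x) / e2).
      by field; rewrite gt_eqF.
    apply: le_trans (resp_le gP x0) _; rewrite lerDl mulr_ge0 ?divr_ge0//; lra.
  have lx := L1_root_value L1_root gP r0 k.
  have := Ex_le (L1_response L1_root gP r0 k) (L1D (L1D lx (L1Z _ lx)) (L1_cst Q _)) H.
  rewrite ExD; [|by apply: L1D => //; exact: L1Z|exact: L1_cst].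
  rewrite ExD//; last exact: L1Z.
  rewrite ExZ// Ex_cst.
  rewrite -/(mean_value Q g gM r k) -/(mean_response Q g gM r k).
  set ak' := mean_value Q g gM r k in ak ae ba *; set bk := mean_response Q g gM r k in b0 ba *.
  have -> : ak' + - (e2 - g e2) / e2 * ak' + (e2 - g e2) = ak' * (1 - c) + c * (2 * e2 - ak').
    by rewrite /c; field; rewrite gt_eqF.
  move=> hb; have hb' : bk <= ak' * (1 - c) by nra.
  have h1 := ler_wpM2r (ltW b0) mr.
  have h2 : (1 + c) * bk <= (1 + c) * (ak' * (1 - c)) by rewrite ler_wpM2l//; lra.
  by apply: le_trans h1 (le_trans h2 _); apply: le_of_eq; ring.
have bound k : mean_value Q g gM r k <= 4 * e2 + geometric (2 * gM) (1 - c ^+ 2) k.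
  elim: k => [|k IH].
    rewrite (mean_value0 L1_root Ex_root) /= expr0 mulr1.
    have -> : r * gM * m = m * r * gM by ring.
    have := ler_wpM2r (ltW gM0) mr; nra.
  have gk : 0 <= geometric (2 * gM) (1 - c ^+ 2) k by rewrite geometric_ge0//; lra.
  have eS : geometric (2 * gM) (1 - c ^+ 2) k.+1 = (1 - c ^+ 2) * geometric (2 * gM) (1 - c ^+ 2) k.
    by rewrite /= exprS; ring.
  case: (step k) => h; rewrite eS; nra.
have := hK n Kn; rewrite /= sub0r normrN ger0_norm => [h|]; last first.
  by rewrite mulr_ge0 ?exprn_ge0//; lra.
by have := bound n; rewrite /= /e2; lra.
Qed.

(** * Convergence in mean *)
Lemma geometric_convolutionS (rho : R) (u : nat -> R) n :
  \sum_(0 <= k < n.+1) rho ^+ (n.+1 - k) * u k =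
  rho * (\sum_(0 <= k < n) rho ^+ (n - k) * u k + u n).
Proof.
rewrite big_nat_recr//= subSnn expr1 mulrDr mulr_sumr; congr (_ + _).
by apply: eq_big_nat => k /andP[_ kn]; rewrite subSn ?(ltnW kn)// exprS mulrA.
Qed.

(** The terms before [K] are damped by [rho ^+ (n - K)]. *)
Lemma geometric_convolution_le (rho A e : R) (u : nat -> R) K n :
  0 <= rho < 1 -> 0 <= A -> 0 <= e -> (forall k, 0 <= u k <= A) ->
  (forall k, (K <= k)%N -> u k <= e) ->
  \sum_(0 <= k < n) rho ^+ (n - k) * u k <= (A * rho ^+ (n - K) + e) / (1 - rho).
Proof.
move=> rho01 A0 e0 uA ue; have r1 : 0 < 1 - rho by lra.
rewrite ler_pdivlMr//; elim: n => [|n IH].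
  by rewrite big_geq// mul0r sub0n expr0; lra.
rewrite geometric_convolutionS.
move: IH; set S := \sum_(_ <= _ < _) _ => IH.
have /andP[u0 uA'] := uA n.
have [Kn|nK] := leqP K n.
  have un := ue n Kn; rewrite subSn// exprS.
  have P0 : 0 <= rho ^+ (n - K) by rewrite exprn_ge0//; lra.
  move: IH P0; set Z := rho ^+ _ => IH Z0.
  have h : rho * (S * (1 - rho)) <= rho * (A * Z + e) by rewrite ler_wpM2l//; lra.
  have h3 : rho * u n <= e by apply: le_trans un; rewrite ler_piMl//; lra.
  have h2 : rho * u n * (1 - rho) <= e * (1 - rho) by rewrite ler_wpM2r// ltW.
  lra.
rewrite -subn_eq0 in nK; move: IH; rewrite (eqP nK).
have -> : (n - K = 0)%N by apply/eqP; rewrite subn_eq0 ltnW// -subn_eq0.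
rewrite expr0 => IH.
have h : rho * (S * (1 - rho)) <= rho * (A * 1 + e) by rewrite ler_wpM2l//; lra.
have h3 : rho * u n <= A by apply: le_trans uA'; rewrite ler_piMl//; lra.
have h2 : rho * u n * (1 - rho) <= A * (1 - rho) by rewrite ler_wpM2r// ltW.
have h4 : rho * e <= e by rewrite ler_piMl//; lra.
lra.
Qed.

Lemma approx_const_gt0 : 0 < approx_const.
Proof.
have p0' : 0 < p by exact: p0.
have ec := error_const_gt0.
rewrite /approx_const; apply: mulr_gt0 ec; apply: mulr_gt0 => //.
by apply: powR_gt0; rewrite mulr_gt0.
Qed.

Lemma mean_value_antitone r n : 0 < r -> mean_value Q g gM r n.+1 <= mean_value Q g gM r n.
Proof.
move=> r0; apply: (Ex_le (L1_root_value L1_root gP r0 n.+1) (L1_root_value L1_root gP r0 n)) => nu.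
exact: (root_value_antitone gP r0).
Qed.

Lemma mean_value_le0 r n : 0 < r -> mean_value Q g gM r n <= mean_value Q g gM r 0.
Proof. by move=> r0; elim: n => // n; apply: le_trans (mean_value_antitone n r0). Qed.

Section Sequence.
Variable t : nat -> R.
Hypothesis t0 : forall n, 0 < t n.
Hypothesis mt : forall eta, 0 < eta -> \forall n \near \oo, m * t n <= 1 + eta.
Notation Y n := (normalized_value Q g gM (t n) n).

(** In the bound of [normalized_approx] the means are uniformly bounded, and
    uniformly small after a fixed height. *)
Lemma normalized_cvg_martingale :
  Ex Q (fun nu => `|Y n nu - Wn m n.+1 nu|) @[n --> \oo] --> 0.
Proof.
have C0 := approx_const_gt0; set C := approx_const in C0.
have /andP[r0 r1] := decay_itv m1 p1; set rho := decay m p in r0 r1.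
have gM0 := resp_top_gt0 gP.
apply/cvgrPdist_le => e e0.
pose D := e * (1 - rho) / (2 * C).
have r1' : 0 < 1 - rho by lra.
have D0 : 0 < D by rewrite /D divr_gt0// mulr_gt0.
have d0 : 0 < D `^ theta^-1 by exact: powR_gt0.
have [eta [K [eta01 hK]]] := mean_value_small d0.
have cv : geometric ((2 * gM) `^ theta) rho n @[n --> \oo] --> 0.
  by apply: cvg_geometric; rewrite ger0_norm; lra.
have [K2 _ hK2] := (cvgrPdist_le _ _).1 cv _ D0.
have eta0 : 0 < eta by case/andP: eta01.
near=> n.
have mtn : m * t n <= 1 + eta by near: n; exact: mt.
have nK : (K + K2 <= n)%N by near: n; exact: nbhs_infty_ge.
have an k : 0 < mean_value Q g gM (t n) k := mean_value_gt0 (t0 n) k.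
have ub k : mean_value Q g gM (t n) k <= 2 * gM.
  apply: le_trans (mean_value_le0 k (t0 n)) _.
  rewrite (mean_value0 L1_root Ex_root).
  have -> : t n * gM * m = m * t n * gM by ring.
  have := ler_wpM2r (ltW gM0) mtn; nra.
have th0 := ltW theta0.
rewrite sub0r normrN ger0_norm; last by apply: Ex_ge0 => nu.
apply: le_trans (normalized_approx (t0 n) n) _.
have h : \sum_(0 <= k < n) rho ^+ (n - k) * mean_value Q g gM (t n) k `^ theta <=
   ((2 * gM) `^ theta * rho ^+ (n - K) + D) / (1 - rho).
  apply: geometric_convolution_le.
  - by rewrite (ltW r0).
  - exact: powR_ge0.
  - exact: ltW.
  - by move=> k; rewrite powR_ge0 le_powR// ltW.
  - move=> k Kk; have -> : D = (D `^ theta^-1) `^ theta.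
      by rewrite -powRrM mulVf ?gt_eqF// powRr1// ltW.
    by apply: le_powR => //; [exact: ltW|exact: hK].
apply: le_trans (ler_wpM2l (ltW C0) h) _.
have h2 : (2 * gM) `^ theta * rho ^+ (n - K) <= D.
  have := hK2 (n - K)%N; rewrite /= sub0r normrN ger0_norm; last first.
    by rewrite mulr_ge0 ?powR_ge0 ?exprn_ge0// ltW.
  by apply; rewrite leq_subRL// (leq_trans _ nK)// leq_addr.
have -> : e = C * ((D + D) / (1 - rho)).
  by rewrite /D; field; rewrite !gt_eqF.
by rewrite ler_wpM2l ?(ltW C0)// ler_wpM2r ?invr_ge0 ?(ltW r1')// lerD2r.
Unshelve. all: by end_near. Qed.

Lemma normalized_cvg_L1 : Ex Q (fun nu => `|Y n nu - Winf m nu|) @[n --> \oo] --> 0.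
Proof.
have [lW cW] := Wn_cvg_L1 iidQ m1 L1_root Ex_root q1 L1_root_q.
have cW' : Ex Q (fun nu => `|Wn m n.+1 nu - Winf m nu|) @[n --> \oo] --> 0.
  by move: cW; rewrite -cvg_shiftS.
have cS : Ex Q (fun nu => `|Y n nu - Wn m n.+1 nu|) + Ex Q (fun nu => `|Wn m n.+1 nu - Winf m nu|)
    @[n --> \oo] --> 0 + 0 by apply: cvgD => //; exact: normalized_cvg_martingale.
rewrite addr0 in cS; apply: (squeeze_cvgr (f := fun=> 0) _ _ cS); last exact: cvg_cst.
apply: nearW => n; rewrite Ex_ge0//=; apply: Ex_norm_triangle => //.
- by have [] := normalized_L1 (t0 n) n.
- exact: (L1_Wn iidQ L1_root Ex_root).
Qed.

Lemma normalized_cvg_Lq :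
  L1 Q (fun nu => Winf m nu `^ q) /\
  (forall n, L1 Q (fun nu => `|Y n nu - Winf m nu| `^ q)) /\
  Ex Q (fun nu => `|Y n nu - Winf m nu| `^ q) @[n --> \oo] --> 0.
Proof.
have lq := L1_Winf_q iidQ m1 L1_root Ex_root q1 L1_root_q; split; first exact: lq.
apply: (L1_cvg_Lq q1).
- by move=> n nu; exact: (normalized_ge0 Q gP (t0 n)).
- exact: Winf_ge0.
- by move=> n; have [] := normalized_L1 (t0 n) n.
- by have [] := Wn_cvg_L1 iidQ m1 L1_root Ex_root q1 L1_root_q.
- by move=> n; exact: (L1_normalized_q q1 L1_root_q gP (t0 n)).
- exact: lq.
- move=> n; apply: (normalized_moment).
  exact: (dominated (t0 n)).
- exact: normalized_cvg_L1.
Qed.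

End Sequence.

Lemma Wn_cvg_Lq : (forall n, L1 Q (fun nu => `|Wn m n nu - Winf m nu| `^ q)) /\
  Ex Q (fun nu => `|Wn m n nu - Winf m nu| `^ q) @[n --> \oo] --> 0.
Proof.
have [lW cW] := Wn_cvg_L1 iidQ m1 L1_root Ex_root q1 L1_root_q.
apply: (L1_cvg_Lq q1).
- exact: Wn_ge0.
- exact: Winf_ge0.
- exact: (L1_Wn iidQ L1_root Ex_root).
- exact: lW.
- exact: (L1_Wn_q iidQ m1 L1_root Ex_root q1 L1_root_q).
- exact: (L1_Winf_q iidQ m1 L1_root Ex_root q1 L1_root_q).
- exact: (Ex_Wn_powR_le iidQ m1 L1_root Ex_root q1 L1_root_q).
- exact: cW.
Qed.

(** * Almost sure convergence *)
(** A nonincreasing path [x] compared with a deterministic nonincreasing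
    sequence [a] is controlled, up to the factor [lam], by its values at the
    first and last times at which [a] sits between two consecutive powers of
    [lam]. *)
Lemma level_sandwich (a x : nat -> R) (lam w : R) (l : nat -> nat) :
  1 < lam -> (forall n, 0 < a n) -> (forall n, a n.+1 <= a n) ->
  (forall n, 0 <= x n) -> (forall n, x n.+1 <= x n) ->
  (forall k, a (l k) <= lam ^- k /\ forall j, (j < l k)%N -> lam ^- k < a j) ->
  x (l k) / a (l k) @[k --> \oo] --> w ->
  x (l k).-1 / a (l k).-1 @[k --> \oo] --> w ->
  forall e, 0 < e -> \forall n \near \oo, lam^-1 * (w - e) <= x n / a n <= lam * (w + e).
Proof.
move=> lam1 a0 adec x0 xdec hl cl cu e e0.
have lam0 : 0 < lam by exact: lt_trans lam1.
have amono i j : (i <= j)%N -> a j <= a i.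
  by move=> /subnK <-; elim: (j - i)%N => // k IH; rewrite addSn; exact: le_trans IH.
have xmono i j : (i <= j)%N -> x j <= x i.
  by move=> /subnK <-; elim: (j - i)%N => // k IH; rewrite addSn; exact: le_trans IH.
have [K1 _ h1] := (cvgrPdist_le _ _).1 cl _ e0.
have [K2 _ h2] := (cvgrPdist_le _ _).1 cu _ e0.
pose K := maxn K1 K2.
near=> n.
have nK : (l K <= n)%N by near: n; exact: nbhs_infty_ge.
have ex : exists k, (K <= k)%N && (n < l k)%N.
  have cv : geometric 1 lam^-1 k @[k --> \oo] --> 0.
    by apply: cvg_geometric; rewrite ger0_norm ?invf_lt1// invr_ge0 ltW.
  have [K3 _ h3] := (cvgrPdist_lt _ _).1 cv _ (a0 n).
  exists (maxn K K3); rewrite leq_maxl/= ltnNge; apply/negP => le.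
  have := h3 (maxn K K3) (leq_maxr _ _); rewrite /= sub0r normrN mul1r ger0_norm; last first.
    by rewrite exprn_ge0// invr_ge0 ltW.
  rewrite exprVn => h; have [h4 _] := hl (maxn K K3).
  by have := le_lt_trans h4 h; rewrite ltNge amono.
case: (ex_minnP ex) => k /andP[Kk nk] kmin.
have kK : (K < k)%N.
  by rewrite ltn_neqAle Kk andbT; apply/eqP => E; move: nk; rewrite -E ltnNge nK.
have k0 : (0 < k)%N by exact: leq_ltn_trans kK.
have Kk1 : (K <= k.-1)%N by rewrite -ltnS prednK.
have lk1 : (l k.-1 <= n)%N.
  rewrite leqNgt; apply/negP => h; have := kmin k.-1; rewrite Kk1 h => /(_ isT).
  by rewrite leqNgt prednK// leqnn.
have nu : (n <= (l k).-1)%N by rewrite -ltnS prednK// (leq_ltn_trans _ nk).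
have [ak1 _] := hl k.-1; have [_ ak] := hl k.
have uk : ((l k).-1 < l k)%N by rewrite prednK// (leq_ltn_trans _ nk).
have {}ak := ak _ uk.
have lamk : lam ^- k.-1 = lam * lam ^- k.
  by rewrite -[in RHS](prednK k0) exprS invfM mulrA divff ?mul1r// gt_eqF.
have an_lo : a (l k.-1) <= lam * a n.
  apply: le_trans ak1 _; rewrite lamk ler_wpM2l ?(ltW lam0)//.
  by apply: le_trans (ltW ak) _; exact: amono.
have an_hi : a n <= lam * a (l k).-1.
  apply: le_trans (amono _ _ lk1) _; apply: le_trans ak1 _.
  by rewrite lamk ler_wpM2l ?(ltW lam0) ?(ltW ak).
have y1 : `|w - x (l k.-1) / a (l k.-1)| <= e.
  by apply: h1; rewrite /= (leq_trans _ Kk1)// leq_maxl.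
have y2 : `|w - x (l k).-1 / a (l k).-1| <= e.
  by apply: h2; rewrite /= (leq_trans _ Kk)// leq_maxr.
have xl := xmono _ _ lk1; have xu := xmono _ _ nu.
move: y1 y2; rewrite !ler_distlC => /andP[_ y1] /andP[y2 _].
apply/andP; split.
  rewrite ler_pdivrMl// mulrA ler_pdivlMr//.
  apply: (@le_trans _ _ (x (l k).-1 / a (l k).-1 * (lam * a (l k).-1))); last first.
    by rewrite mulrCA divfK ?gt_eqF// ler_wpM2l ?(ltW lam0).
  have [ew|we] := leP (w - e) 0.
    apply: (@le_trans _ _ 0); first by rewrite mulr_le0_ge0 ?(ltW (a0 n)).
    by rewrite !mulr_ge0 ?invr_ge0 ?(ltW (a0 _)) ?(ltW lam0).
  by apply: ler_pM => //; exact: ltW.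
rewrite ler_pdivrMr//; apply: le_trans xl _.
have -> : lam * (w + e) * a n = (w + e) * (lam * a n) by ring.
have we0 : 0 <= w + e.
  by apply: le_trans y1; rewrite divr_ge0// ltW.
apply: (@le_trans _ _ ((w + e) * a (l k.-1))); first by rewrite -ler_pdivrMr.
by rewrite ler_wpM2l.
Unshelve. all: by end_near. Qed.

Lemma exists_levels (a : nat -> R) (lam : R) : 1 < lam ->
  a n @[n --> \oo] --> 0 ->
  exists l : nat -> nat, forall k, a (l k) <= lam ^- k /\ forall j, (j < l k)%N -> lam ^- k < a j.
Proof.
move=> lam1 ca.
have H k : exists n, a n <= lam ^- k /\ forall j, (j < n)%N -> lam ^- k < a j.
  have lk : 0 < lam ^- k by rewrite invr_gt0 exprn_gt0// (lt_trans _ lam1).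
  have [N _ hN] := (cvgrPdist_le _ _).1 ca _ lk.
  have ex : exists n, a n <= lam ^- k.
    exists N; have := hN N (leqnn _); rewrite /= sub0r normrN.
    by apply: le_trans; exact: ler_norm.
  case: (ex_minnP ex) => n hn nmin; exists n; split => // j jn.
  by rewrite ltNge; apply/negP => /nmin; rewrite leqNgt jn.
by have [l hl] := choice H; exists l.
Qed.

Section AlmostSure.
Variable r : R.
Hypothesis r0 : 0 < r.
Hypothesis mr1 : m * r <= 1.

Notation a := (mean_value Q g gM r).
Notation Y := (normalized_value Q g gM r).

Let a0 n : 0 < a n.
Proof. exact: (mean_value_gt0). Qed.
Let adec n : a n.+1 <= a n. Proof. exact: mean_value_antitone. Qed.

Lemma mean_value_cvg0 : a n @[n --> \oo] --> 0.
Proof.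
apply/cvgrPdist_le => e e0.
have [eta [K [/andP[eta0 _] hK]]] := mean_value_small e0.
exists K => // n /= Kn; rewrite sub0r normrN ger0_norm ?(ltW (a0 n))//.
by apply: hK => //; apply: le_trans mr1 _; rewrite lerDl ltW.
Qed.

(** The mean response is at least a fixed share of the mean, since the means are
    bounded by the first one. *)
Lemma mean_value_ratio : exists2 Lam, 1 <= Lam & forall n, a n <= Lam * a n.+1.
Proof.
have s0 : 0 < spread.
  have C0 := Winf_moment_ge1.
  by rewrite powR_gt0// mulr_gt0// (lt_le_trans _ C0).
set K := a 0%N * spread.
have K0 : 0 < K by rewrite mulr_gt0.
pose c := g K / (2 * K).
have c0 : 0 < c by rewrite divr_gt0 ?(resp_gt0 gP)// mulr_gt0.
have rmc : 0 < r * m * c by apply: mulr_gt0 c0; exact: mulr_gt0.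
have H n : a n <= (r * m * c)^-1 * a n.+1.
  rewrite ler_pdivlMl// (mean_valueS iidQ L1_root Ex_root gP r0) -(mulrA (r * m) c).
  rewrite ler_pM2l ?mulr_gt0// .
  apply: (mean_response_lower r0).
  - exact: a0.
  - exact: mean_value_le0.
  - exact: (dominated).
exists (r * m * c)^-1 => //.
have h := le_trans (adec 0) (H 0%N).
by rewrite -(ler_pM2r (a0 1%N)) mul1r.
Qed.

(** As the means decay at most geometrically, the geometric averages in
    [normalized_approx] are governed by their last term, after lowering the
    exponent enough for the averaging weights to win. *)
Lemma normalized_approx_powR : exists th C, [/\ 0 < th, 0 < C &
  forall n, Ex Q (fun nu => `|Y n nu - Wn m n.+1 nu|) <= C * a n `^ th].
Proof.
have [Lam Lam1 hL] := mean_value_ratio.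
have C0 := approx_const_gt0.
have /andP[r0' r1'] := decay_itv m1 p1.
set rho := decay m p in r0' r1'; set C1 := approx_const in C0.
have Lam0 : 0 < Lam by exact: lt_le_trans Lam1.
have [j j0 hj] : exists2 j, (0 < j)%N & Lam * rho ^+ j < 1.
  have cv : geometric Lam rho n @[n --> \oo] --> 0.
    by apply: cvg_geometric; rewrite ger0_norm// ltW.
  have [J _ hJ] := (cvgrPdist_lt _ _).1 cv _ (@ltr01 R).
  exists J.+1 => //; have := hJ J.+1 (leqnSn J); rewrite /= sub0r normrN.
  by apply: le_lt_trans; exact: ler_norm.
pose th := Num.min theta j%:R^-1.
have jR : 0 < j%:R :> R by rewrite ltr0n.
have th0 : 0 < th by rewrite lt_min theta0 invr_gt0.
have thj : th <= j%:R^-1 by rewrite ge_min lexx orbT.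
have tht : th <= theta by rewrite ge_min lexx.
pose kap := rho * Lam `^ th.
have kap0 : 0 < kap by rewrite mulr_gt0// powR_gt0.
have kap1 : kap < 1.
  have h : kap <= rho * Lam `^ j%:R^-1 by rewrite ler_wpM2l ?(ltW r0')// ler_powR.
  apply: le_lt_trans h _; rewrite ltNge; apply/negP => h.
  have := exprn_ege1 j h; rewrite exprMn -(powR_mulrn j (powR_ge0 Lam _)).
  by rewrite -powRrM mulVf ?gt_eqF// powRr1 ?(ltW Lam0)// mulrC leNgt hj.
have kap1' : 0 < 1 - kap by rewrite subr_gt0.
pose A' := a 0 `^ (theta - th).
have A'0 : 0 < A' by rewrite powR_gt0.
pose C := kap * A' / (1 - kap).
have Cp : 0 < C by rewrite divr_gt0// mulr_gt0.
have S n : \sum_(0 <= k < n) rho ^+ (n - k) * a k `^ theta <= C * a n `^ th.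
  elim: n => [|n IH]; first by rewrite big_geq// mulr_ge0 ?powR_ge0 ?(ltW Cp).
  rewrite geometric_convolutionS.
  have h1 : a n `^ theta <= A' * a n `^ th.
    have -> : theta = (theta - th) + th by rewrite subrK.
    rewrite powRD; last by rewrite (gt_eqF (a0 n)) implybT.
    apply: (ler_wpM2r (powR_ge0 _ _)); apply: le_powR; first by rewrite subr_ge0.
      exact: ltW (a0 n).
    exact: mean_value_le0.
  have h2 : a n `^ th <= Lam `^ th * a n.+1 `^ th.
    rewrite -(powRM _ (ltW Lam0) (ltW (a0 n.+1))).
    exact: le_powR (ltW th0) (ltW (a0 n)) (hL n).
  have CA : 0 <= C + A' by rewrite addr_ge0 ?ltW.
  apply: (@le_trans _ _ (rho * ((C + A') * (Lam `^ th * a n.+1 `^ th)))).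
    rewrite ler_wpM2l ?(ltW r0')//; apply: le_trans (lerD IH h1) _.
    by rewrite -mulrDl; exact: ler_wpM2l CA _ _ h2.
  apply: le_of_eq; have -> : rho * ((C + A') * (Lam `^ th * a n.+1 `^ th)) =
    (C + A') * kap * a n.+1 `^ th by rewrite /kap; ring.
  by congr (_ * _); rewrite /C; field; rewrite gt_eqF.
exists th, (C1 * C); split => //; first by rewrite mulr_gt0.
move=> n; apply: le_trans (normalized_approx r0 n) _.
by rewrite -/C1 -(mulrA C1 C); exact: ler_wpM2l (ltW C0) _ _ (S n).
Qed.

(** The bounds of [normalized_approx_powR] are summable along [l]. *)
Lemma normalized_cvg_along (l : nat -> nat) (c lam : R) : 0 < c -> 1 < lam ->
  (forall k, a (l k) <= c * lam ^- k) ->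
  {ae Q, forall nu, Y (l k) nu @[k --> \oo] --> Winf m nu}.
Proof.
move=> c0 lam1 hl; have lam0 : 0 < lam by exact: lt_trans lam1.
have [th [C [th0 C0 hC]]] := normalized_approx_powR.
pose z := lam^-1 `^ th.
have z0 : 0 < z by rewrite powR_gt0 ?invr_gt0.
have z1 : z < 1.
  have -> : (z < 1) = (z < 1 `^ th) by rewrite powR1.
  by rewrite gt0_ltr_powR ?nnegrE ?invr_ge0 ?(ltW lam0)// invf_lt1.
have lY n : L1 Q (Y n).
  by have [] := normalized_L1 r0 n.
have lD n : L1 Q (fun nu => `|Y n nu - Wn m n.+1 nu|).
  by apply: L1_norm; apply: L1B => //; exact: (L1_Wn iidQ L1_root Ex_root).
have bD k : Ex Q (fun nu => `|Y (l k) nu - Wn m (l k).+1 nu|) <= C * c `^ th * z ^+ k.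
  apply: le_trans (hC _) _; rewrite -mulrA ler_wpM2l ?(ltW C0)//.
  rewrite /z -powR_exprn ?invr_ge0 ?(ltW lam0)// -powRM ?(ltW c0)//; last first.
    by rewrite exprn_ge0// invr_ge0 ltW.
  by rewrite le_powR ?(ltW th0) ?(ltW (a0 _))// exprVn.
have ser n : \sum_(0 <= k < n) Ex Q (fun nu => `|Y (l k) nu - Wn m (l k).+1 nu|) <=
    C * c `^ th / (1 - z).
  apply: (@le_trans _ _ (series (geometric (C * c `^ th) z) n)).
    by rewrite /series/=; apply: ler_sum => k _; exact: bD.
  apply: geometric_le_lim => //; last by rewrite ger0_norm// ltW.
  by rewrite mulr_ge0 ?powR_ge0 ?(ltW C0).
have linf N : \forall k \near \oo, (N <= l k)%N.
  have cv : geometric c lam^-1 k @[k --> \oo] --> 0.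
    by apply: cvg_geometric; rewrite ger0_norm ?invf_lt1// invr_ge0 ltW.
  have [K _ hK] := (cvgrPdist_lt _ _).1 cv _ (a0 N).
  exists K => // k /= /hK; rewrite /= sub0r normrN ger0_norm; last first.
    by rewrite mulr_ge0 ?(ltW c0)// exprn_ge0// invr_ge0 ltW.
  rewrite exprVn => h; rewrite leqNgt; apply/negP => lN.
  have := le_lt_trans (hl k) h; rewrite ltNge => /negP; apply.
  move: lN => /ltnW/subnK <-; elim: (N - l k)%N => // i IH.
  by rewrite addSn; apply: le_trans IH.
have h1 := ae_cvg_series (X := fun k (nu : field) => `|Y (l k) nu - Wn m (l k).+1 nu|)
  (fun k nu => normr_ge0 _) (fun k => lD (l k)) ser.
have h2 := Wn_cvg_ae iidQ m1 L1_root Ex_root q1 L1_root_q.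
apply: ae_imply (ae_and h1 h2) => nu [/cvg_series_cvg_0 s0 cW].
have cWl : Wn m (l k).+1 nu @[k --> \oo] --> Winf m nu.
  apply/cvgrPdist_le => e e0; have [N _ hN] := (cvgrPdist_le _ _).1 cW _ e0.
  by apply: filterS (linf N) => k Nk; apply: hN => /=; exact: leqW.
have d0 : (Y (l k) nu - Wn m (l k).+1 nu) @[k --> \oo] --> 0.
  by apply/cvgr0Pnorm_le => e e0; move: s0 => /cvgr0Pnorm_le/(_ _ e0); apply: filterS => k; rewrite normr_id.
have : (Y (l k) nu - Wn m (l k).+1 nu) + Wn m (l k).+1 nu @[k --> \oo] --> 0 + Winf m nu.
  exact: cvgD.
by rewrite add0r; apply: cvg_trans; apply: near_eq_cvg; apply: nearW => k; rewrite subrK.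
Qed.

(** The values at the root are nonincreasing, so that [level_sandwich] applies
    for [lam = 1 + 1 / (j + 1)], and then [j] goes to infinity. *)
Lemma normalized_cvg_ae : {ae Q, forall nu, Y n nu @[n --> \oo] --> Winf m nu}.
Proof.
have [Lam Lam1 hL] := mean_value_ratio.
have Lam0 : 0 < Lam by exact: lt_le_trans Lam1.
pose lam j : R := 1 + j.+1%:R^-1.
have lam1 j : 1 < lam j by rewrite /lam ltrDl invr_gt0.
have lam0 j : 0 < lam j by exact: lt_trans (lam1 j).
have lev j := exists_levels (lam1 j) mean_value_cvg0.
have [l hl] := choice lev.
have A1 j : {ae Q, forall nu, Y (l j k) nu @[k --> \oo] --> Winf m nu}.
  by apply: (normalized_cvg_along ltr01 (lam1 j)) => k; rewrite mul1r; have [] := hl j k.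
have A2 j : {ae Q, forall nu, Y (l j k).-1 nu @[k --> \oo] --> Winf m nu}.
  apply: (normalized_cvg_along Lam0 (lam1 j)) => k.
  apply: (@le_trans _ _ (Lam * a (l j k))); last first.
    by rewrite ler_wpM2l ?(ltW Lam0)//; have [] := hl j k.
  by case: (l j k) => //=; rewrite ler_peMl// ltW.
apply: ae_imply (ae_forall (fun j => ae_and (A1 j) (A2 j))) => nu h.
have W0 := Winf_ge0 m1 nu; set w := Winf m nu in h W0 *.
apply/cvgrPdist_le => e e0.
pose d := Num.min 1 (e / 4).
have d0 : 0 < d by rewrite lt_min ltr01 divr_gt0.
have d1 : d <= 1 by rewrite ge_min lexx.
have de : d <= e / 4 by rewrite ge_min lexx orbT.
have w1 : 0 < w + 1 by lra.
have [j hj] : exists j, j.+1%:R^-1 * (w + 1) <= e / 2.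
  have e2 : 0 < e / 2 / (w + 1) by rewrite !divr_gt0.
  have [j _ hj] := (cvgrPdist_le _ _).1 (@cvg_harmonic R) _ e2.
  exists j; rewrite -ler_pdivlMr//; have := hj j (leqnn _).
  by rewrite /= sub0r normrN; apply: le_trans; exact: ler_norm.
have [cl cu] := h j.
have H := level_sandwich (x := root_value g gM r ^~ nu) (lam1 j) a0 adec
  (fun n => root_value_ge0 gP r0 n nu) (fun n => root_value_antitone gP r0 n nu) (hl j) cl cu d0.
apply: filterS H => n; rewrite -/(Y n nu) => /andP[lo hi].
rewrite ler_distlC; move: hj; rewrite /lam in lo hi lam1 *.
set t := j.+1%:R^-1 in lo hi *; have t0 : 0 < t by rewrite invr_gt0.
rewrite ler_pdivrMl in lo; last by lra.
have Y0 := normalized_ge0 Q gP r0 n nu.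
move: lo hi Y0; set y := Y n nu => lo hi y0 ht.
have td : t * d <= t * 1 by rewrite ler_wpM2l// ltW.
apply/andP; split; last lra.
have [wy|yw] := leP w y; first by lra.
have ty : t * y <= t * w by rewrite ler_wpM2l// ltW.
lra.
Qed.

End AlmostSure.

End Approximation.

(** * Transfer to the given probability space *)
Section Transfer.
Context (R : realType) (d : measure_display) (Omega : measurableType d).
Context (P : probability Omega R) (N : seq nat -> {RV P >-> nat}).
Implicit Types (u : seq nat).

Definition offspring (w : Omega) : field := fun u => N u w.

Lemma measurable_offspring : measurable_fun setT offspring.
Proof.
apply: (@measurability _ _ Omega field setT offspring (cylinders setT)) => //.
move=> _ [_ [J [A [_ _ ->]]] <-]; rewrite setTI.
have -> : offspring @^-1` cylinder J A = \bigcap_(u in [set` J]) (N u @^-1` A u).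
  by apply/seteqP; split => w /= h u; exact: h.
apply: fin_bigcap_measurable; first exact: finite_seq.
by move=> u _; rewrite -[X in measurable X]setTI; exact: measurable_funP.
Qed.

HB.instance Definition _ := isMeasurableFun.Build _ _ _ _ offspring measurable_offspring.

Definition offspring_law : probability field R := distribution P offspring.

Lemma offspring_lawE (E : set field) : offspring_law E = P (offspring @^-1` E).
Proof. by []. Qed.

Lemma integral_offspring (F : field -> R) : measurable_fun setT F -> (forall nu, 0 <= F nu) ->
  (\int[P]_w (F (offspring w))%:E = \int[offspring_law]_nu (F nu)%:E)%E.
Proof.
move=> mF F0.
have mF' : measurable_fun setT (EFin \o F) by exact/measurable_EFinP.
have := ge0_integral_pushforward measurable_offspring P measurableT mF'.
by rewrite preimage_setT => <- // nu _; rewrite lee_fin.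
Qed.

Lemma ae_offspring (A : field -> Prop) : {ae offspring_law, forall nu, A nu} ->
  {ae P, forall w, A (offspring w)}.
Proof.
move=> [B [mB B0 AB]]; exists (offspring @^-1` B); split => //.
  by rewrite -[X in measurable X]setTI; exact: measurable_offspring.
by move=> w; exact: AB.
Qed.

Lemma iid_offspring mu : galton_watson mu N -> iid_field mu offspring_law.
Proof.
move=> [muN ind] J A uJ; rewrite offspring_lawE.
have -> : offspring @^-1` cylinder J A = \bigcap_(u in [set` J]) (N u @^-1` A u).
  by apply/seteqP; split => w /= h u; exact: h.
by rewrite ind//; apply: eq_bigr => u _; rewrite -(muN u).
Qed.

(** The shift [k] skips the indices at which [X] is a dummy value. *)
Lemma cvg_in_Lq_offspring k (q : R) (X : nat -> Omega -> R) (Y : nat -> field -> R)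
    (W : field -> R) : 1 < q ->
  (forall n w, X (n + k)%N w = Y n (offspring w)) ->
  (forall n, measurable_fun setT (Y n)) -> measurable_fun setT W ->
  (forall n, L1 offspring_law (fun nu => `|Y n nu| `^ q)) ->
  L1 offspring_law (fun nu => `|W nu| `^ q) ->
  (forall n, L1 offspring_law (fun nu => `|Y n nu - W nu| `^ q)) ->
  Ex offspring_law (fun nu => `|Y n nu - W nu| `^ q) @[n --> \oo] --> 0 ->
  cvg_in_Lq P q X (fun w => W (offspring w)).
Proof.
move=> q1 XY mY mW lY lW lYW cYW; have q0 : 0 < q by exact: lt_trans q1.
have normE (F : field -> R) : measurable_fun setT F ->
    L1 offspring_law (fun nu => `|F nu| `^ q) ->
    ('N[P]_(q%:E)[EFin \o (F \o offspring)] =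
     ((Ex offspring_law (fun nu => `|F nu| `^ q)) `^ q^-1)%:E)%E.
  move=> mF lF; rewrite unlock -poweR_EFin EFin_Ex// -integral_offspring//.
  exact: measurable_fun_powR (measurable_fun_norm mF).
have LF (F : field -> R) : measurable_fun setT F ->
    L1 offspring_law (fun nu => `|F nu| `^ q) -> F \o offspring \in Lfun P q%:E.
  move=> mF lF; rewrite inE; apply/andP; split; rewrite inE/=.
    exact: (measurableT_comp mF measurable_offspring).
  by rewrite /finite_norm normE// ltry.
split.
- exists k => // n /= kn; rewrite -(subnK kn).
  have -> : X (n - k + k)%N = Y (n - k)%N \o offspring by apply/funext => w; rewrite XY.
  exact: LF.
- exact: LF.
rewrite -(cvg_shiftn k) /=.
have E n : ('N[P]_(q%:E)[EFin \o (X (n + k)%N \- (fun w => W (offspring w)))%R] =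
    ((Ex offspring_law (fun nu => `|Y n nu - W nu| `^ q)) `^ q^-1)%:E)%E.
  rewrite -(normE (fun nu => Y n nu - W nu))//; last exact: measurable_funB.
  by congr Lnorm; apply/funext => w /=; rewrite XY.
under eq_fun do rewrite E.
apply: cvg_EFin; first by apply: nearW => n.
apply/cvgrPdist_le => e e0; have eq0 : 0 < e `^ q by rewrite powR_gt0.
have [K _ hK] := (cvgrPdist_le _ _).1 cYW _ eq0.
exists K => // n /= /hK; rewrite /= !sub0r !normrN.
have P0 : 0 <= Ex offspring_law (fun nu => `|Y n nu - W nu| `^ q).
  by apply: Ex_ge0 => nu; exact: powR_ge0.
rewrite !ger0_norm ?powR_ge0// => h.
have -> : e = (e `^ q) `^ q^-1 by rewrite -powRrM divff ?gt_eqF// powRr1// ltW.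
by apply: le_powR => //; rewrite invr_ge0 ltW.
Qed.

End Transfer.

Lemma B_heightE (R : realType) (g : R -> R) nu r h u :
  B_height g nu r h.+1 u = (root_value g (extend_pinfty g +oo%E) r h (subtree u nu))%:E.
Proof.
elim: h u => [|h IH] u.
  rewrite /= /subtree cats0 /children big_map.
  by rewrite big_const_seq count_predT iter_addr_0 size_iota -mulrA mulr_natr.
rewrite -[LHS]/((r * \sum_(v <- children nu u) extend_pinfty g (B_height g nu r h.+1 v))%:E).
rewrite [RHS]/= branch_subtree /children; congr (_ * _)%:E.
by apply: eq_bigr => v _; rewrite IH.
Qed.

Lemma B_normalizedE (R : realType) (d : measure_display) (Omega : measurableType d)
    (P : probability Omega R) (N : seq nat -> {RV P >-> nat}) (g : R -> R) theta gC (r : nat -> R) n w :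
  response theta g (extend_pinfty g +oo%E) gC -> 0 < r n.+1 ->
  B_normalized P g N r n.+1 w =
  normalized_value (offspring_law N) g (extend_pinfty g +oo%E) (r n.+1) n (offspring N w).
Proof.
move=> gP r0; rewrite /B_normalized /normalized_value.
have E w' : B_root g (N ^~ w') (r n.+1) n.+1 =
    (root_value g (extend_pinfty g +oo%E) (r n.+1) n (offspring N w'))%:E.
  by rewrite /B_root /B_at subn0 B_heightE subtree_nil.
rewrite E; congr (_ / _); rewrite /mean_value /Ex /Rintegral; congr fine.
rewrite -integral_offspring; first by apply: eq_integral => w' _; exact: E.
  exact: measurable_local (local_root_value _ _ _ _).
exact: (root_value_ge0 gP r0).
Qed.

Section OffspringMean.
Context (R : realType) (mu : probability nat R) (Q : probability field R).
Hypothesis iidQ : iid_field mu Q.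

Lemma measurable_root (f : nat -> R) : measurable_fun setT (fun nu : field => f (nu [::])).
Proof. by apply: measurable_local; apply: local_comp; exact: local_coord. Qed.

Lemma L1_offspring : (emean mu < +oo)%E -> L1 Q (fun nu => (nu [::])%:R).
Proof.
move=> fin; apply/(L1_ge0P Q (measurable_root _)) => //.
by rewrite (integral_coord iidQ [::] (fun k => ler0n R k)).
Qed.

Lemma Ex_offspring : Ex Q (fun nu => (nu [::])%:R) = mean mu.
Proof. by rewrite /Ex /Rintegral (integral_coord iidQ [::] (fun k => ler0n R k)). Qed.

Lemma L1_offspring_powR q : (moment mu q < +oo)%E -> L1 Q (fun nu => (nu [::])%:R `^ q).
Proof.
move=> fin; apply/(L1_ge0P Q (measurable_root (fun k => k%:R `^ q))) => [nu|].
  exact: powR_ge0.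
by rewrite (integral_coord iidQ [::] (fun k => powR_ge0 k%:R q)).
Qed.

End OffspringMean.

Lemma mean_gt1 (R : realType) (mu : probability nat R) : mu [set 0%N] = 0%E ->
  (mu [set 1%N] < 1)%E -> (emean mu < +oo)%E -> 1 < mean mu.
Proof.
move=> mu0 mu1 fin.
have l1 : L1 mu (fun k => k%:R) by apply/L1_ge0P.
have lI k : L1 mu (\1_[set k]).
  apply/L1_ge0P => //.
  by rewrite integral_indic// setIT (le_lt_trans (probability_le1 _ _))// ltry.
have eI k : (Ex mu (\1_[set k]))%:E = mu [set k] by rewrite EFin_Ex// integral_indic// setIT.
have e0 : Ex mu (\1_[set 0%N]) = 0 by apply: EFin_inj; rewrite eI.
have e1 : Ex mu (\1_[set 1%N]) < 1 by rewrite -lte_fin eI.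
have -> : mean mu = Ex mu (fun k => k%:R) by [].
(* with equality for [k <= 2], so that the mean is at least [2 - mu [set 1]] *)
have H k : 2 - \1_[set 1%N] k - 2 * \1_[set 0%N] k <= k%:R :> R.
  have inS j : (k \in [set j]) = (k == j) by apply/idP/eqP; rewrite inE.
  rewrite !indicE !inS; case: k {inS} => [|[|k]] /=; rewrite ?mulr0n ?mulr1n.
  - lra.
  - lra.
  - by rewrite mulr0 !subr0 ler_nat.
have l2 := Ex_le (L1B (L1B (L1_cst mu 2) (lI 1)) (L1Z 2 (lI 0%N))) l1 H.
apply: lt_le_trans l2.
rewrite ExB; [|by apply: L1B => //; exact: L1_cst|exact: L1Z].
rewrite ExB//; last exact: L1_cst.
by rewrite ExZ// e0 Ex_cst; lra.
Qed.

Lemma limn_esup_le_near (R : realType) (u : nat -> R) (l e : R) :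
  (limn_esup (fun n => (u n)%:E) <= l%:E)%E -> 0 < e -> \forall n \near \oo, u n <= l + e.
Proof.
move=> ul e0.
have : (limn_esup (fun n => (u n)%:E) < (l + e)%:E)%E.
  by apply: le_lt_trans ul _; rewrite lte_fin ltrDl.
move=> /ereal_inf_lt[_ [V VF <-]] h; apply: filterS VF => n Vn.
rewrite -lee_fin; apply: le_trans (ltW h); apply: ereal_sup_ubound.
by exists n.
Qed.

Theorem theorem1p8 (R : realType) (mu : probability nat R)
    (d : measure_display) (Omega : measurableType d) (P : probability Omega R)
    (N : seq nat -> {RV P >-> nat})
    (s kappa1 kappa2 : R) (g : R -> R) (r : nat -> R)
    (q := s + 1) (m := mean mu) (W := W_limit m N) :
  mu [set 0%N] = 0%E ->
  (mu [set 1%N] < 1)%E ->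
  (emean mu < +oo)%E ->
  galton_watson mu N ->
  0 < s ->
  (moment mu q < +oo)%E ->
  (forall x, 0 <= x -> 0 <= g x) ->
  concave_on_nonneg g ->
  [bounded g x | x in `[0, +oo[%classic] ->
  0 < kappa1 -> 0 < kappa2 ->
  (forall x, 0 < x ->
     x / (1 + kappa1 * x `^ s) `^ (s^-1) <= g x
       <= x / (1 + kappa2 * x `^ s) `^ (s^-1)) ->
  (forall n, 0 < r n) ->
  [/\ cvg_as P (W_martingale m N) W,
      cvg_in_Lq P q (W_martingale m N) W,
      (limn_esup (fun n => (m * r n)%:E) <= 1)%E ->
        0 < inf (range r) ->
        cvg_in_Lq P q (B_normalized P g N r) W &
      forall r0, 0 < r0 <= m^-1 -> (forall n, r n = r0) ->
        cvg_as P (B_normalized P g N r) W].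
Proof.
move=> mu0 mu1 fin GW s0 finq g0 gconc gbd k10 k20 gb r_gt0.
have m1 : 1 < m := mean_gt1 mu0 mu1 fin.
pose Q := offspring_law N.
have iidQ : iid_field mu Q := iid_offspring GW.
have L1_root := L1_offspring iidQ fin.
have Ex_root : Ex Q (fun nu => (nu [::])%:R) = m := Ex_offspring iidQ.
have q1 : 1 < q by rewrite /q; lra.
have q0 : 0 < q by lra.
have L1_root_q : L1 Q (fun nu => (nu [::])%:R `^ q) := L1_offspring_powR iidQ finq.
(* [p < q] makes [q / p - 1] positive, and [1 <= p] makes it at most [s] *)
pose p := Num.min 2 (1 + s / 2).
have p12 : 1 < p <= 2.
  by rewrite lt_min ge_min lexx/= andbT; apply/andP; split; lra.
have pq : p < q by rewrite gt_min; apply/orP; right; rewrite /q; lra.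
have p0 : 0 < p by lra.
have theta_s : 0 < q / p - 1 <= s.
  rewrite subr_gt0 ltr_pdivlMr// mul1r pq/= lerBlDr -/q ler_pdivrMr//.
  by rewrite ler_peMr ?(ltW q0)//; lra.
have gP := response_of_bounds s0 k10 k20 g0 gconc gbd gb theta_s.
set gM := extend_pinfty g +oo%E in gP.
have absq (F : field -> R) : (forall nu, 0 <= F nu) ->
    L1 Q (fun nu => F nu `^ q) -> L1 Q (fun nu => `|F nu| `^ q).
  by move=> F0; apply: eq_L1 => nu; rewrite ger0_norm.
have mW := measurable_Winf iidQ m1 L1_root Ex_root q1 L1_root_q.
have lWq := L1_Winf_q iidQ m1 L1_root Ex_root q1 L1_root_q.
have BE n w : B_normalized P g N r n.+1 w =
    normalized_value Q g gM (r n.+1) n (offspring N w) := B_normalizedE _ _ gP (r_gt0 n.+1).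
split.
- apply: (ae_offspring (A := fun nu => Wn m n nu @[n --> \oo] --> Winf m nu)).
  exact: (Wn_cvg_ae iidQ m1 L1_root Ex_root q1 L1_root_q).
- have [lWn cWn] := Wn_cvg_Lq iidQ m1 L1_root Ex_root q1 L1_root_q.
  apply: (cvg_in_Lq_offspring (k := 0) q1 (Y := Wn m) (W := Winf m)) => //.
  + by move=> n w; rewrite addn0.
  + by move=> n; exact: measurable_local (local_Wn _ _).
  + move=> n; apply: absq; first exact: Wn_ge0.
    exact: (L1_Wn_q iidQ m1 L1_root Ex_root q1 L1_root_q).
  + by apply: absq => //; exact: Winf_ge0.
- move=> lim_r _.
  have mt eta : 0 < eta -> \forall n \near \oo, m * r n.+1 <= 1 + eta.
    move=> eta0; have [K _ hK] := limn_esup_le_near lim_r eta0.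
    by exists K => // n /= Kn; apply: hK => /=; exact: leqW.
  have [_ [lY cY]] := normalized_cvg_Lq iidQ m1 L1_root Ex_root q1 p12 pq L1_root_q gP
    (fun n => r_gt0 n.+1) mt.
  apply: (cvg_in_Lq_offspring (k := 1) q1 (Y := fun n => normalized_value Q g gM (r n.+1) n)
    (W := Winf m)) => //.
  + by move=> n w; rewrite addn1 BE.
  + move=> n; have [l _] := normalized_L1 iidQ m1 L1_root Ex_root q1 L1_root_q gP (r_gt0 n.+1) n.
    exact: L1_measurable l.
  + move=> n; apply: absq; first exact: (normalized_ge0 Q gP (r_gt0 n.+1)).
    exact: (L1_normalized_q q1 L1_root_q gP (r_gt0 n.+1)).
  + by apply: absq => //; exact: Winf_ge0.
- move=> r0 /andP[r00 r0m] rE.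
  have mr1 : m * r0 <= 1 by rewrite -ler_pdivlMl ?mulr1// (lt_trans ltr01).
  have := normalized_cvg_ae iidQ m1 L1_root Ex_root q1 p12 pq L1_root_q gP r00 mr1.
  move=> /ae_offspring; apply: ae_imply => w h; rewrite -cvg_shiftS /=.
  by move: h; apply: cvg_trans; apply: near_eq_cvg; apply: nearW => n; rewrite BE rE.
Qed.
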